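(* Let $k,m\in\mathbb{N}$ with $k$ even and $k>2+N$, where $N=\operatorname{rank}(L)$. Then the Jacobi–Eisenstein series $E_{k,m}$ is a holomorphic function on $\mathcal{H}\times(L\otimes\mathbb{C})$, and its Fourier expansion is \[E_{k,m}(\tau,\mathfrak{z})=\Theta_{mS,0,0}(\tau,\mathfrak{z})+\sum_{\substack{l\in\mathbb{Z}\\ h\in L}} e_{k,m}(l,h)\,e^{2\pi\mathrm{i} l\tau}e^{\pi\mathrm{i}(h,\mathfrak{z})}\] with Fourier–Jacobi coefficients \[e_{k,m}(l,h)=\frac{\gamma(l,h)}{\zeta(k-N)}\sum_{a=1}^{\infty}\frac{\operatorname{N}_a(Q)}{a^{k-1}},\] where $Q(x)=Q_{l,h}(x)=\frac{m(x,x)-(h,x)+2l}{2}$, $\operatorname{N}_a(Q)=\#\{x\bmod a\,|\,Q(x)\equiv 0\bmod a\}$ (with $x$ running over $\mathbb{Z}^N/a\mathbb{Z}^N$), $\zeta$ is the Riemann zeta function, and \[\gamma(l,h)=\int_{\Im(\tau)=y}\tau^{-k}e^{-2\pi\mathrm{i} l\tau}\int_{\Im(\mathfrak{z})=\nu}e^{-\pi\mathrm{i}\left(\frac{m(\mathfrak{z},\mathfrak{z})}{\tau}+(h,\mathfrak{z})\right)}\,\mathrm{d}\mathfrak{z}\,\mathrm{d}\tau\] for arbitrary $y>0$ and $\nu\in\mathbb{R}^N$.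
   Context: $L=\mathbb{Z}^N$ is an even integral positive definite lattice: $S\in\mathbb{Z}^{N\times N}$ is symmetric positive definite with even diagonal, $(x,y)=x^tSy$, extended $\mathbb{C}$-bilinearly to $L\otimes\mathbb{C}=\mathbb{C}^N$. $\mathcal{H}$ is the upper half plane. For $k,m\in\mathbb{N}$ and $\phi:\mathcal{H}\times\mathbb{C}^N\to\mathbb{C}$ put $(\phi|_{k,m}\left(\begin{smallmatrix}a&b\\c&d\end{smallmatrix}\right))(\tau,\mathfrak{z})=(c\tau+d)^{-k}e^{-\pi\mathrm{i} m\frac{c(\mathfrak{z},\mathfrak{z})}{c\tau+d}}\phi(\frac{a\tau+b}{c\tau+d},\frac{\mathfrak{z}}{c\tau+d})$ for matrices in $\mathrm{SL}(2,\mathbb{Z})$, and $(\phi|_m[x,y])(\tau,\mathfrak{z})=e^{\pi\mathrm{i} m((x,x)\tau+2(x,\mathfrak{z}))}\phi(\tau,\mathfrak{z}+x\tau+y)$ for $x,y\in L$; these jointly define an action of the Jacobi group $\Gamma^J=\mathrm{SL}(2,\mathbb{Z})\ltimes(L\times L)$. Let $\Gamma^J_\infty=\{g\in\Gamma^J\,;\,1|_{k,m}g=1\}=\{\{\pm\left(\begin{smallmatrix}1&n\\0&1\end{smallmatrix}\right),[0,y]\}\,;\,n\in\mathbb{Z},y\in L\}$. For even $k$ the Jacobi–Eisenstein series is $E_{k,m}=\sum_{g\in\Gamma^J_\infty\backslash\Gamma^J}1|_{k,m}g$; explicitly $E_{k,m}(\tau,\mathfrak{z})=\frac12\sum_{c,d\in\mathbb{Z},\gcd(c,d)=1}\sum_{x\in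 L}(c\tau+d)^{-k}\exp\big(\pi\mathrm{i} m\frac{(x,x)(a\tau+b)+2(x,\mathfrak{z})-c(\mathfrak{z},\mathfrak{z})}{c\tau+d}\big)$, where $a,b\in\mathbb{Z}$ are chosen with $ad-bc=1$. The theta series is $\Theta_{mS,0,0}(\tau,\mathfrak{z})=\sum_{x\in\mathbb{Z}^N}\exp\big(\pi\mathrm{i} m((x,x)\tau+2(x,\mathfrak{z}))\big)$.
   Formalization: The Fourier sum runs over h in 2L^# (all h with (h,x) even for every x in L) instead of h in L; as printed it fails, e.g. for S=(4), m=1, k=4, where terms with h=±1/2 occur, and N_a(Q) is not well defined when some (h,x) is odd. *)

(* Defs.v *)
From HB Require Import structures.
From mathcomp Require Import all_boot all_order all_algebra.
From mathcomp Require Import all_classical all_reals all_analysis.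
From mathcomp Require Import complex.

Set Implicit Arguments.
Unset Strict Implicit.
Unset Printing Implicit Defensive.

Import Order.TTheory GRing.Theory Num.Theory.
Import numFieldNormedType.Exports.

Local Open Scope classical_set_scope.
Local Open Scope ring_scope.
Local Open Scope complex_scope.

Section ComplexAnalysis.
Variable R : realType.

Definition cexp (w : R[i]) : R[i] :=
  (expR (complex.Re w))%:C * (cos (complex.Im w) +i* sin (complex.Im w)).

Definition epii (w : R[i]) : R[i] := cexp (pi%:C * 'i * w).

(* Sums over arbitrary index sets are absolutely convergent ones; [rsum] and
   [csum] are meaningful only when [csummable] holds. *)
Definition csummable (T : choiceType) (D : set T) (f : T -> R[i]) : Prop :=
  summable D (fun t => (Normc.normc (f t))%:E).

Definition rsum (T : choiceType) (D : set T) (f : T -> R) : R :=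
  fine (\esum_(t in D) (f^\+ t)%:E) - fine (\esum_(t in D) (f^\- t)%:E).

Definition csum (T : choiceType) (D : set T) (f : T -> R[i]) : R[i] :=
  rsum D (fun t => complex.Re (f t)) +i* rsum D (fun t => complex.Im (f t)).

Definition cintegral (f : R -> R[i]) : R[i] :=
  (\int[lebesgue_measure]_t complex.Re (f t))%R
    +i* (\int[lebesgue_measure]_t complex.Im (f t))%R.

(* Lebesgue integral over R^n, as the iterated integral du_1 ... du_n; note
   that n.+1 is convertible to 1 + n. *)
Fixpoint cintegral_n (n : nat) : ('cV[R]_n -> R[i]) -> R[i] :=
  if n is n'.+1 then
    fun f => cintegral (fun t =>
      cintegral_n (fun u : 'cV[R]_n' => f (col_mx (t%:M : 'cV[R]_1) u)))
  else fun f => f 0.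

(* Only meaningful for s > 1. *)
Definition zeta (s : nat) : R :=
  limn (series (fun n : nat => (n.+1%:R : R) ^- s)).

End ComplexAnalysis.

Section JacobiEisenstein.
Variables (R : realType) (N : nat) (S : 'M[int]_N).
Implicit Types (k m : nat) (tau : R[i]) (z : 'cV[R[i]]_N).

Definition blin (A : comPzRingType) (x y : 'cV[A]_N) : A :=
  (x^T *m map_mx intr S *m y) ord0 ord0.

Definition lat (A : comPzRingType) (x : 'cV[int]_N) : 'cV[A]_N :=
  map_mx intr x.

Definition even_posdef : Prop :=
  [/\ S^T = S,
      forall i, (2 %| S i i)%Z &
      forall x : 'cV[R]_N, x != 0 -> 0 < blin x x].

(* Only the values at 0 < Im tau are meaningful. *)
Definition jfun := R[i] -> 'cV[R[i]]_N -> R[i].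

Definition slash_SL k m (M : 'M[int]_2) (phi : jfun) : jfun := fun tau z =>
  let a := (M 0 0)%:~R : R[i] in let b := (M 0 1)%:~R : R[i] in
  let c := (M 1 0)%:~R : R[i] in let d := (M 1 1)%:~R : R[i] in
  (c * tau + d) ^- k
  * epii (- (m%:R * (c * blin z z / (c * tau + d))))
  * phi ((a * tau + b) / (c * tau + d)) ((c * tau + d)^-1 *: z).

Definition slash_heis m (xy : 'cV[int]_N * 'cV[int]_N) (phi : jfun) : jfun :=
  fun tau z =>
  let x := lat R[i] xy.1 in let y := lat R[i] xy.2 in
  epii (m%:R * (blin x x * tau + 2 * blin x z)) * phi tau (z + tau *: x + y).

(* (M, (x, y)) stands for {M, [x, y]} = M * [x, y]. *)
Definition jelt : Type := 'M[int]_2 * ('cV[int]_N * 'cV[int]_N).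

Definition jacobi_group : set jelt := [set g | \det g.1 = 1].

Definition slash k m (g : jelt) (phi : jfun) : jfun :=
  slash_heis m g.2 (slash_SL k m g.1 phi).

(* {M, [x, y]} {M', [x', y']} = {M M', [x, y] M' + [x', y']}, where SL(2, Z)
   acts on [x, y] from the right; this makes [slash] a right action. *)
Definition jmul (g h : jelt) : jelt :=
  (g.1 *m h.1,
   (h.1 0 0 *: g.2.1 + h.1 1 0 *: g.2.2 + h.2.1,
    h.1 0 1 *: g.2.1 + h.1 1 1 *: g.2.2 + h.2.2)).

Definition jone : jelt := (1%:M, (0, 0)).

Definition one_jfun : jfun := fun _ _ => 1.

Definition jacobi_inf k m : set jelt :=
  [set g | jacobi_group g /\
     forall tau z, 0 < complex.Im tau -> slash k m g one_jfun tau z = 1].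

Definition jcoset k m (g : jelt) : set jelt :=
  [set jmul h g | h in jacobi_inf k m].

Definition jcosets k m : set (set jelt) :=
  [set jcoset k m g | g in jacobi_group].

Definition eis_term k m tau z (C : set jelt) : R[i] :=
  slash k m (xget jone C) one_jfun tau z.

Definition eisenstein k m : jfun := fun tau z =>
  csum (jcosets k m) (eis_term k m tau z).

Definition theta m : jfun := fun tau z =>
  csum [set: 'cV[int]_N] (fun x =>
    epii (m%:R * (blin (lat R[i] x) (lat R[i] x) * tau
                  + 2 * blin (lat R[i] x) z))).

(* R[i]^o is R[i] as a normed module over itself, so that [differentiable] is
   complex differentiability. *)
Definition holomorphic_on_H (phi : jfun) : Prop :=
  forall p : (R[i]^o * 'cV[R[i]]_N)%type : normedModType R[i],
    0 < complex.Im p.1 ->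
    differentiable (fun q : R[i]^o * 'cV[R[i]]_N => phi q.1 q.2 : R[i]^o) p.

Definition dual_lattice : set 'cV[R]_N :=
  [set v | forall x : 'cV[int]_N, blin v (lat R x) \is a Num.int].

(* The h with e^{pi i (h, z)} invariant under z -> z + L, i.e. with (h, x) even
   for all x in L; exactly for these h is Q_{l,h} integral and N_a well defined. *)
Definition twice_dual : set 'cV[R]_N := [set h | dual_lattice (2^-1 *: h)].

Definition Qlh m (l : int) (h : 'cV[R]_N) (x : 'cV[int]_N) : R :=
  (m%:R * blin (lat R x) (lat R x) - blin h (lat R x) + 2 * l%:~R) / 2.

Definition Na m (l : int) (h : 'cV[R]_N) (a : nat) : nat :=
  #|[pred x : 'cV['I_a]_N |
      Qlh m l h (map_mx (fun j : 'I_a => (j : nat)%:Z) x) / a%:R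
        \is a Num.int]|.

Definition cvec (u : 'cV[R]_N) : 'cV[R[i]]_N := map_mx (fun t => t%:C) u.

(* The lines Im tau = y and Im z = nu are parametrized by their real parts. *)
Definition gamma k m (y : R) (nu : 'cV[R]_N) (l : int) (h : 'cV[R]_N) : R[i] :=
  cintegral (fun t : R =>
    let tau := t +i* y in
    tau ^- k * epii (- (2 * l%:~R * tau))
    * cintegral_n (fun u : 'cV[R]_N =>
        let z := cvec u + 'i *: cvec nu in
        epii (- (m%:R * blin z z / tau + blin (cvec h) z)))).

Definition fj_coef k m (y : R) (nu : 'cV[R]_N) (l : int) (h : 'cV[R]_N) : R[i] :=
  gamma k m y nu l h / (zeta R (k - N))%:C
  * (limn (series (fun n : nat => (Na m l h n.+1)%:R / (n.+1%:R : R) ^+ k.-1)))%:C.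

Definition fourier_term k m (y : R) (nu : 'cV[R]_N) tau z
    (lh : int * 'cV[R]_N) : R[i] :=
  fj_coef k m y nu lh.1 lh.2 * epii (2 * lh.1%:~R * tau)
  * epii (blin (cvec lh.2) z).

Definition fourier_index : set (int * 'cV[R]_N) := [set lh | twice_dual lh.2].

End JacobiEisenstein.

(* Main.v *)
Require Import Defs.
From HB Require Import structures.
From mathcomp Require Import all_boot all_order all_algebra.
From mathcomp Require Import all_classical all_reals all_analysis.
From mathcomp Require Import measurable_realfun complex ring lra zify.
Import Order.TTheory GRing.Theory Num.Theory.
Import numFieldNormedType.Exports.
Set Implicit Arguments.
Unset Strict Implicit.
Unset Printing Implicit Defensive.
Local Open Scope classical_set_scope.
Local Open Scope ring_scope.
Local Open Scope complex_scope.

(* For c > 0, completing the square shows that the term of E_{k,m} attached to the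
   coset with invariants (c, d, lambda), lambda = d x - c y, is a root of unity times
   c^-k F(tau + d/c, z - lambda/c), where F(tau, z) = tau^-k e^{-pi i m (z,z)/tau}; the
   cosets with c = 0 give the theta series.  Split d and lambda into residues mod c and
   multiples of c, and apply Poisson summation to F, first in z (successive square
   completions reduce the n-dimensional Gaussian to one variable), then in tau.  The
   result is gamma(l, h) e^{2 pi i l tau} e^{pi i (h, z)} times
   c^-k G_c(l, h), where G_c is the sum of e^{2 pi i d Q(x)/c} over x mod c and d mod c
   prime to c.  Put K(e/n) = n^-N sum_{x mod n} e^{2 pi i e Q(x)/n}, a function of the
   fraction e/n.  Then N_n(Q) = n^{N-1} sum_{e mod n} K(e/n) and
   G_c = c^N sum_d K(d/c), so writing each e/n in lowest terms gives
   sum_n N_n(Q) n^{1-k} = zeta(k-N) sum_c c^-k G_c.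
   The integral gamma does not depend on the height y because its derivative in y is the
   integral of a derivative; moving y up and down makes the Fourier coefficients decay.
   Holomorphy is read off the Fourier expansions of both parts, whose terms are
   exponentials of real linear forms in (tau, z). *)

(** Poisson summation is proved by Fejér averaging: the integral of f against the kernel of order
    J^2 is within O(1/J) of the sum of f(n) and within O(1/J^2) of the sum of the Fourier
    coefficients, with explicit constants. The second estimate asks for Fourier coefficients
    summable against 1 + |l|, which is why the summability lemmas carry that weight. No branch of a
    square root is chosen: the Gaussian integral stays an integral, and its holomorphy in tau comes
    from its logarithmic derivative 1/(2 tau), obtained by differentiating under the integral sign.
    Holomorphy along lines is expressed by real derivatives, so shifting a line of integration needs
    no contour. Sums are unordered, so each exchange rests on absolute summability, with bounds
    depending on tau and z through imaginary parts only; the same bound then serves all residue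
    classes mod c. The condition k > N + 2 enters twice: tau^(N-k) must decay like 1/(1 + t^2), and
    the c^(N+1) residue classes of size c^-k must be summable over c. For holomorphy, the series is
    dominated near a point by its values at finitely many points with shifted imaginary parts. *)

Notation normc := Normc.normc.

(** * Complex numbers *)

Section ComplexBasics.
Variable R : realType.
Implicit Types (x y w : R[i]) (r : R).

Lemma Re_add x y : complex.Re (x + y) = complex.Re x + complex.Re y.
Proof. by case: x; case: y. Qed.
Lemma Im_add x y : complex.Im (x + y) = complex.Im x + complex.Im y.
Proof. by case: x; case: y. Qed.
Lemma Re_mul x y : complex.Re (x * y) =
  complex.Re x * complex.Re y - complex.Im x * complex.Im y.
Proof. by case: x; case: y. Qed.
Lemma Im_mul x y : complex.Im (x * y) =
  complex.Re x * complex.Im y + complex.Im x * complex.Re y.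
Proof. by case: x; case: y. Qed.
Lemma Re_opp x : complex.Re (- x) = - complex.Re x.
Proof. by case: x. Qed.
Lemma Im_opp x : complex.Im (- x) = - complex.Im x.
Proof. by case: x. Qed.
Lemma Re_real r : complex.Re (r%:C) = r. Proof. by []. Qed.
Lemma Im_real r : complex.Im (r%:C) = 0. Proof. by []. Qed.
Lemma Re_cplx r (s : R) : complex.Re (r +i* s) = r. Proof. by []. Qed.
Lemma Im_cplx r (s : R) : complex.Im (r +i* s) = s. Proof. by []. Qed.
Lemma Re_i : complex.Re ('i : R[i]) = 0. Proof. by []. Qed.
Lemma Im_i : complex.Im ('i : R[i]) = 1. Proof. by []. Qed.
Lemma Re_1 : complex.Re (1 : R[i]) = 1. Proof. by []. Qed.
Lemma Im_1 : complex.Im (1 : R[i]) = 0. Proof. by []. Qed.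
Lemma Re_0 : complex.Re (0 : R[i]) = 0. Proof. by []. Qed.
Lemma Im_0 : complex.Im (0 : R[i]) = 0. Proof. by []. Qed.
Definition ReImE := (Re_1, Im_1, Re_0, Im_0, Re_i, Im_i, Re_add, Im_add, Re_mul, Im_mul, Re_opp, Im_opp,
  Re_real, Im_real, Re_cplx, Im_cplx).

Lemma complex_ext x y : complex.Re x = complex.Re y ->
  complex.Im x = complex.Im y -> x = y.
Proof. by case: x; case: y => a b c d /= -> ->. Qed.

Lemma natrC n : (n%:R : R[i]) = (n%:R)%:C.
Proof. by rewrite (rmorph_nat (real_complex R)). Qed.
Lemma intrC (n : int) : (n%:~R : R[i]) = (n%:~R)%:C.
Proof. by rewrite (rmorph_int (real_complex R)). Qed.
Lemma realCD r (s : R) : (r + s)%:C = r%:C + s%:C.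
Proof. exact: (rmorphD (real_complex R)). Qed.
Lemma realCM r (s : R) : (r * s)%:C = r%:C * s%:C.
Proof. exact: (rmorphM (real_complex R)). Qed.
Lemma realCV r : (r^-1)%:C = (r%:C)^-1.
Proof. exact: (fmorphV (real_complex R)). Qed.
Lemma realCX r n : (r ^+ n)%:C = (r%:C) ^+ n.
Proof. exact: (rmorphXn (real_complex R)). Qed.
Lemma realCN r : (- r)%:C = - (r%:C).
Proof. exact: (rmorphN (real_complex R)). Qed.
Lemma real_complex_eq0 r : (r%:C == 0 :> R[i]) = (r == 0).
Proof. exact: (fmorph_eq0 (real_complex R)). Qed.

Lemma normc_sqr x : normc x ^+ 2 = complex.Re x ^+ 2 + complex.Im x ^+ 2.
Proof. by case: x => a b /=; rewrite sqr_sqrtr// addr_ge0// sqr_ge0. Qed.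
Lemma normc_ge0 x : 0 <= normc x.
Proof. by case: x => a b /=; rewrite sqrtr_ge0. Qed.
Lemma normc_real r : normc (r%:C) = `|r|.
Proof. by rewrite /= expr0n /= addr0 sqrtr_sqr. Qed.
Lemma normcX x n : normc (x ^+ n) = normc x ^+ n.
Proof.
by elim: n => [|n IH]; rewrite ?expr0 ?Normc.normc1// !exprS Normc.normcM IH.
Qed.
Lemma normc_Re x : `|complex.Re x| <= normc x.
Proof.
by rewrite -(ler_sqr (normr_ge0 _) (normc_ge0 _))// real_normK ?num_real//
  normc_sqr lerDl sqr_ge0.
Qed.
Lemma normc_Im x : `|complex.Im x| <= normc x.
Proof.
by rewrite -(ler_sqr (normr_ge0 _) (normc_ge0 _))// real_normK ?num_real//
  normc_sqr lerDr sqr_ge0.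
Qed.
Lemma normc_le_ReIm x : normc x <= `|complex.Re x| + `|complex.Im x|.
Proof.
rewrite -(ler_sqr (normc_ge0 _) _) ?nnegrE ?addr_ge0//.
rewrite sqrrD !real_normK ?num_real// normc_sqr addrAC lerDl.
by rewrite mulrn_wge0// mulr_ge0.
Qed.
Lemma normc_i : normc ('i : R[i]) = 1.
Proof. by rewrite /= expr0n expr1n /= add0r sqrtr1. Qed.
Lemma normcB x y : normc (x - y) <= normc x + normc y.
Proof. by rewrite -(normcN y); exact: le_normcD. Qed.
Lemma normc_eq0 x : (normc x == 0) = (x == 0).
Proof.
by apply/eqP/eqP => [/Normc.eq0_normc//|->]; rewrite Normc.normc0.
Qed.
Lemma normc_gt0 x : (0 < normc x) = (x != 0).
Proof. by rewrite lt_def normc_ge0 andbT normc_eq0. Qed.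
Lemma normc_sum (I : finType) (P : pred I) (F : I -> R[i]) :
  normc (\sum_(i | P i) F i) <= \sum_(i | P i) normc (F i).
Proof.
elim/big_ind2 : _ => [|a b c d H1 H2|//]; first by rewrite Normc.normc0.
by rewrite (le_trans (le_normcD _ _))// lerD.
Qed.
Lemma normr_normc x : `|x| = (normc x)%:C. Proof. by []. Qed.

Lemma cexpD x y : cexp (x + y) = cexp x * cexp y.
Proof.
rewrite /cexp Re_add Im_add expRD cosD sinD.
by apply: complex_ext; rewrite !ReImE; ring.
Qed.
Lemma cexp0 : cexp (0 : R[i]) = 1.
Proof. by rewrite /cexp /= expR0 cos0 sin0 mul1r. Qed.
Lemma normc_cexp x : normc (cexp x) = expR (complex.Re x).
Proof.
rewrite /cexp Normc.normcM normc_real ger0_norm ?expR_ge0//.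
by rewrite /= cos2Dsin2 sqrtr1 mulr1.
Qed.
Lemma cexp_neq0 x : cexp x != 0.
Proof. by rewrite -normc_gt0 normc_cexp expR_gt0. Qed.

Lemma epiiD x y : epii (x + y) = epii x * epii y.
Proof. by rewrite /epii mulrDr cexpD. Qed.
Lemma epii0 : epii (0 : R[i]) = 1.
Proof. by rewrite /epii mulr0 cexp0. Qed.
Lemma normc_epii x : normc (epii x) = expR (- (pi * complex.Im x)).
Proof. by rewrite /epii normc_cexp !ReImE; congr expR; ring. Qed.
Lemma epii_neq0 x : epii x != 0. Proof. exact: cexp_neq0. Qed.
Lemma epiiN x : epii (- x) = (epii x)^-1.
Proof.
by apply: (mulfI (epii_neq0 x)); rewrite -epiiD subrr epii0 divff ?epii_neq0.
Qed.
Lemma epii2 : epii (2 : R[i]) = 1.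
Proof.
rewrite /epii /cexp natrC !ReImE /= mulr0 !mul0r subr0 mulr1 mul0r mulr0 !subr0.
by rewrite mul0r add0r addr0 expR0 mulr_natr cos2pi sin2pi mul1r.
Qed.
Lemma epiiMn x n : epii (x *+ n) = epii x ^+ n.
Proof. by elim: n => [|n IH]; rewrite ?epii0// mulrS epiiD IH exprS. Qed.
Lemma epii_even (n : int) : epii (2 * n%:~R : R[i]) = 1.
Proof.
case: n => n; first by rewrite -pmulrn mulr_natr epiiMn epii2 expr1n.
by rewrite NegzE mulrNz mulrN epiiN -pmulrn mulr_natr epiiMn epii2 expr1n invr1.
Qed.

End ComplexBasics.

(** * Absolutely convergent sums *)

Section NonnegativeSums.
Variable R : realType.
Local Notation esumT f := (\esum_(t in [set: _]) (f t)%:E)%E.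

Lemma esumZ (T : choiceType) (D : set T) (r : R) (a : T -> \bar R) : 0 <= r ->
  (forall t, 0 <= a t)%E ->
  (\esum_(t in D) (r%:E * a t) = r%:E * \esum_(t in D) a t)%E.
Proof.
rewrite le_eqVlt => /predU1P[<- a0|r0 a0].
  by rewrite mul0e esum1// => i _; rewrite mul0e.
(* The reverse inequality is [le1] again, for the scalar [r^-1] and the family already multiplied by
   [r]. *)
have le1 (s : R) (b : T -> \bar R) : 0 < s -> (forall t, 0 <= b t)%E ->
    (\esum_(t in D) (s%:E * b t) <= s%:E * \esum_(t in D) b t)%E.
  move=> s0 b0; apply: ge_ereal_sup => _ [X [finX XD] <-].
  rewrite -ge0_mule_fsumr// lee_pmul2l//.
  by apply: ereal_sup_ubound; exists X.
apply/eqP; rewrite eq_le le1//=.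
have H : (\esum_(t in D) ((r^-1)%:E * (r%:E * a t)) <=
    (r^-1)%:E * \esum_(t in D) (r%:E * a t))%E.
  by apply: le1 => [|t]; [rewrite invr_gt0|rewrite mule_ge0// lee_fin ltW].
rewrite -(@lee_pmul2l _ (r^-1)%:E) ?lte_fin ?invr_gt0// muleA -EFinM.
rewrite mulVf ?gt_eqF// mul1e; apply: le_trans H; apply: le_esum => t _.
by rewrite muleA -EFinM mulVf ?gt_eqF// mul1e.
Qed.

Lemma esum_pair (T1 T2 : choiceType) (f : T1 * T2 -> R) : (forall p, 0 <= f p) ->
  (esumT f = \esum_(i in [set: T1]) \esum_(j in [set: T2]) (f (i, j))%:E)%E.
Proof.
move=> f0; rewrite (@esum_esum _ _ _ setT (fun=> setT) (fun i j => (f (i, j))%:E)).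
  by congr esum; [apply/seteqP; split => -[]|apply/funext => -[]].
by move=> i j _ _; rewrite lee_fin.
Qed.

Lemma esum_fine (T : choiceType) (f : T -> R) : (forall p, 0 <= f p) ->
  (esumT f < +oo)%E -> esumT f = (fine (esumT f))%:E.
Proof.
move=> f0 H; rewrite fineK// ge0_fin_numE//.
by apply: esum_ge0 => t _; rewrite lee_fin.
Qed.

Lemma esum_bij (T T' : choiceType) (e : T' -> T) (f : T -> \bar R) :
  bijective e -> (\esum_(t in [set: T]) f t = \esum_(t in [set: T']) f (e t))%E.
Proof.
move=> be; apply: (@reindex_esum _ _ _ setT setT e); split => //.
  by apply: in2W; exact: bij_inj.
by move=> t _; case: be => g _ ge; exists (g t).
Qed.

Lemma esum_pair_le (T1 T2 : choiceType) (f : T1 * T2 -> R) (b : T1 -> R) :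
  (forall p, 0 <= f p) ->
  (forall i, \esum_(j in [set: T2]) (f (i, j))%:E <= (b i)%:E)%E ->
  (esumT f <= esumT b)%E.
Proof. by move=> f0 fb; rewrite esum_pair//; apply: le_esum => i _. Qed.

Lemma esum_fin (T : finType) (f : T -> R) : (forall p, 0 <= f p) ->
  esumT f = (\sum_t f t)%:E.
Proof.
move=> f0; rewrite esum_fset; [|exact: finite_finset|by move=> i _; rewrite lee_fin].
rewrite (_ : [set: T] = [set` index_enum T]); last first.
  by apply/seteqP; split => i //= _; rewrite mem_index_enum.
by rewrite -fsbig_seq ?index_enum_uniq// sumEFin.
Qed.

Lemma esum_fin_num (T : choiceType) (h : T -> R) :
  (forall t, 0 <= h t) -> (esumT h < +oo)%E -> esumT h \is a fin_num.
Proof. by move=> h0 hf; rewrite esum_fine. Qed.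

Definition rsummable (T : choiceType) (f : T -> R) : Prop :=
  (\esum_(t in [set: T]) (`|f t|)%:E < +oo)%E.

Section RealSums.
Variable T : choiceType.
Implicit Types f g : T -> R.

Lemma rsummable_le f g : (forall t, `|f t| <= g t) -> (esumT g < +oo)%E ->
  rsummable f.
Proof. by move=> fg; apply: le_lt_trans; apply: le_esum => t _; rewrite lee_fin. Qed.

(** [rsum] is defined through the positive and negative parts; any other decomposition into summable
    nonnegative families gives the same value. Linearity follows, although the positive part of a
    sum is not the sum of the positive parts. *)
Lemma rsumB f g : (forall t, 0 <= f t) -> (forall t, 0 <= g t) ->
  (esumT f < +oo)%E -> (esumT g < +oo)%E ->
  rsum setT (fun t => f t - g t) = fine (esumT f) - fine (esumT g).
Proof.
move=> f0 g0 sf sg.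
have H := @esumB _ _ [set: T] (EFin \o f) (EFin \o g).
have sf' : summable [set: T] (EFin \o f).
  by rewrite /summable; under eq_esum do rewrite /= ger0_norm//.
have sg' : summable [set: T] (EFin \o g).
  by rewrite /summable; under eq_esum do rewrite /= ger0_norm//.
have {}H := H sf' sg' (fun t _ => f0 t) (fun t _ => g0 t).
rewrite /rsum -!fineB.
- rewrite /= in H; rewrite -H.
  by rewrite -(_ : (EFin \o (f \- g)) = (fun x => (f x)%:E - (g x)%:E)%E)// funerpos funerneg.
- by rewrite esum_fine.
- by rewrite esum_fine.
- rewrite ge0_fin_numE; last by apply: esum_ge0 => t _; rewrite lee_fin.
  apply: le_lt_trans sf; apply: le_esum => t _; rewrite lee_fin /funrpos.
  by rewrite ge_max f0 gerBl g0.
- rewrite ge0_fin_numE; last by apply: esum_ge0 => t _; rewrite lee_fin.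
  apply: le_lt_trans sg; apply: le_esum => t _; rewrite lee_fin /funrneg.
  by rewrite ge_max g0 opprB gerBl f0.
Qed.

Lemma rsummable_pos f : rsummable f -> (esumT f^\+ < +oo)%E.
Proof.
apply: le_lt_trans; apply: le_esum => t _; rewrite lee_fin.
by rewrite /funrpos ge_max normr_ge0 ler_norm.
Qed.
Lemma rsummable_neg f : rsummable f -> (esumT f^\- < +oo)%E.
Proof.
apply: le_lt_trans; apply: le_esum => t _; rewrite lee_fin.
by rewrite /funrneg ge_max normr_ge0 -normrN ler_norm.
Qed.

Lemma rsumD f g : rsummable f -> rsummable g ->
  rsum setT (fun t => f t + g t) = rsum setT f + rsum setT g.
Proof.
move=> sf sg.
have -> : (fun t => f t + g t) =
    (fun t => (f^\+ t + g^\+ t) - (f^\- t + g^\- t)).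
  by rewrite -[RHS]/(f^\+ + g^\+ - (f^\- + g^\-)) funrDB.
have [p1 p2 p3 p4] := And4 (rsummable_pos sf) (rsummable_pos sg)
  (rsummable_neg sf) (rsummable_neg sg).
have q := @esum_fin_num T.
rewrite rsumB; first last.
- by under eq_esum do rewrite EFinD; rewrite esumD// ?lte_add_pinfty// => t _; rewrite lee_fin.
- by under eq_esum do rewrite EFinD; rewrite esumD// ?lte_add_pinfty// => t _; rewrite lee_fin.
- by move=> t; rewrite addr_ge0.
- by move=> t; rewrite addr_ge0.
under eq_esum do rewrite EFinD.
rewrite esumD; [|by move=> t _; rewrite lee_fin..].
under [X in _ - fine X = _]eq_esum do rewrite EFinD.
rewrite esumD; [|by move=> t _; rewrite lee_fin..].
rewrite !fineD ?q//; rewrite /rsum; ring.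
Qed.

Lemma rsumN f : rsum setT (fun t => - f t) = - rsum setT f.
Proof.
by rewrite -[X in rsum _ X]/(\- f) /rsum funrposN funrnegN opprB.
Qed.

Lemma rsumZ r f : rsummable f -> rsum setT (fun t => r * f t) = r * rsum setT f.
Proof.
wlog r0 : r f / 0 <= r.
  move=> H sf; have [/H->//|r0] := leP 0 r.
  have := H (- r) f; rewrite oppr_ge0 => /(_ (ltW r0) sf).
  under [X in rsum _ X]funext do rewrite mulNr.
  by rewrite rsumN mulNr => /oppr_inj.
move=> sf.
have -> : (fun t => r * f t) = (fun t => r * f^\+ t - r * f^\- t).
  by apply/funext => t; rewrite -mulrBr -[in LHS](funrposBneg f).
have s1 : (esumT (fun t => r * f^\+ t) = r%:E * esumT f^\+)%E.
  by under eq_esum do rewrite EFinM; rewrite esumZ// => t; rewrite lee_fin.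
have s2 : (esumT (fun t => r * f^\- t) = r%:E * esumT f^\-)%E.
  by under eq_esum do rewrite EFinM; rewrite esumZ// => t; rewrite lee_fin.
have q := @esum_fin_num T.
have [p1 p2] := (rsummable_pos sf, rsummable_neg sf).
rewrite rsumB.
- by rewrite s1 s2 !fineM ?q// mulrBr.
- by move=> t; rewrite mulr_ge0.
- by move=> t; rewrite mulr_ge0.
- by rewrite s1 -(fineK (q _ _ p1))// ltry.
- by rewrite s2 -(fineK (q _ _ p2))// ltry.
Qed.

Lemma rsum_norm_le f : rsummable f ->
  `|rsum setT f| <= fine (\esum_(t in [set: T]) (`|f t|)%:E)%E.
Proof.
move=> sf; have [p1 p2] := (rsummable_pos sf, rsummable_neg sf).
have q := @esum_fin_num T.
have -> : (\esum_(t in [set: T]) (`|f t|)%:E = esumT f^\+ + esumT f^\-)%E.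
  rewrite -esumD; [|by move=> t _; rewrite lee_fin..].
  by apply: eq_esum => t _; rewrite -EFinD -[in LHS]/((Num.Def.normr \o f) t) -funrposDneg.
rewrite fineD ?q// /rsum.
have a0 : 0 <= fine (esumT f^\+) by apply/fine_ge0/esum_ge0 => t _; rewrite lee_fin.
have b0 : 0 <= fine (esumT f^\-) by apply/fine_ge0/esum_ge0 => t _; rewrite lee_fin.
by rewrite (le_trans (ler_normB _ _))// !ger0_norm.
Qed.

Lemma rsum_ge0E f : (forall t, 0 <= f t) -> rsum setT f = fine (esumT f).
Proof.
move=> f0; rewrite /rsum (_ : \esum_(t in setT) _ = esumT f)%E; last first.
  by apply: eq_esum => t _; rewrite /funrpos max_l.
by rewrite (_ : (\esum_(t in setT) (f^\- t)%:E = 0)%E) ?subr0// esum1// => t _; rewrite /funrneg max_r// oppr_le0.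
Qed.
End RealSums.

Lemma rsum_pair (T1 T2 : choiceType) (f : T1 * T2 -> R) : rsummable f ->
  rsum setT f = rsum setT (fun i => rsum setT (fun j => f (i, j))).
Proof.
move=> sf; have [p1 p2] := (rsummable_pos sf, rsummable_neg sf).
(* Row sums of a summable nonnegative family are finite, hence given by a real function [g]; [rsumB]
   then applies to the row sums of the two parts. *)
have fi (h : T1 * T2 -> R) : (forall p, 0 <= h p) -> (esumT h < +oo)%E ->
  exists g : T1 -> R, [/\ (forall i, 0 <= g i)%R, esumT h = esumT g &
    forall i, \esum_(j in [set: T2]) ((h (i, j))%:E) = ((g i)%:E)]%E.
  move=> h0 hf; exists (fun i => fine (\esum_(j in [set: T2]) (h (i, j))%:E)%E).
  have g0 i : (0 <= \esum_(j in [set: T2]) (h (i, j))%:E)%E.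
    by apply: esum_ge0 => j _; rewrite lee_fin.
  have gK i : (\esum_(j in [set: T2]) (h (i, j))%:E =
     (fine (\esum_(j in [set: T2]) (h (i, j))%:E))%:E)%E.
    rewrite fineK// ge0_fin_numE//; move: hf; rewrite esum_pair// => hf.
    have : summable [set: T1] (fun i => \esum_(j in [set: T2]) (h (i, j))%:E)%E.
      by rewrite /summable; under eq_esum do rewrite gee0_abs//.
    by move/summable_pinfty => /(_ i I); rewrite gee0_abs.
  split=> [i||//]; first exact: fine_ge0.
  by rewrite esum_pair//; apply: eq_esum => i _.
have [g [g0 gE gi]] := fi f^\+ (@funrpos_ge0 _ _ f) p1.
have [h [h0 hE hi]] := fi f^\- (@funrneg_ge0 _ _ f) p2.
rewrite {1}/rsum gE hE -rsumB//; [|by rewrite -gE|by rewrite -hE].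
congr rsum; apply/funext => i; rewrite /rsum.
by rewrite -[g i]/(fine (g i)%:E) -[h i]/(fine (h i)%:E) -gi -hi.
Qed.

End NonnegativeSums.

Section ComplexSums.
Variable R : realType.
Local Notation esumT f := (\esum_(t in [set: _]) (f t)%:E)%E.
Local Notation csm f := (csummable [set: _] f).
Local Notation csumT f := (csum [set: _] f).

Lemma csummableE (T : choiceType) (D : set T) (f : T -> R[i]) :
  csummable D f <-> (\esum_(t in D) (normc (f t))%:E < +oo)%E.
Proof.
rewrite /csummable /summable.
by under eq_esum do rewrite gee0_abs ?lee_fin ?normc_ge0//.
Qed.

Section OneType.
Variable T : choiceType.
Implicit Types (f g : T -> R[i]).

Lemma csummable_le f (g : T -> R) : (forall t, normc (f t) <= g t) ->
  (esumT g < +oo)%E -> csm f.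
Proof.
move=> fg; rewrite csummableE; apply: le_lt_trans.
by apply: le_esum => t _; rewrite lee_fin.
Qed.

Lemma csummable_norm_le f g : (forall t, normc (f t) <= normc (g t)) ->
  csm g -> csm f.
Proof. by move=> fg /csummableE; apply: csummable_le. Qed.

Lemma csummable_Re f : csm f -> rsummable (fun t => complex.Re (f t)).
Proof. by move=> /csummableE; apply: rsummable_le => t; exact: normc_Re. Qed.
Lemma csummable_Im f : csm f -> rsummable (fun t => complex.Im (f t)).
Proof. by move=> /csummableE; apply: rsummable_le => t; exact: normc_Im. Qed.

Lemma csummable0 : csm (fun _ : T => 0 : R[i]).
Proof. by rewrite csummableE esum1// => t _; rewrite Normc.normc0. Qed.

Lemma csummableD f g : csm f -> csm g -> csm (fun t => f t + g t).
Proof.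
move=> /csummableE sf /csummableE sg.
apply: (csummable_le (g := fun t => normc (f t) + normc (g t))).
  by move=> t; exact: le_normcD.
under eq_esum do rewrite EFinD.
by rewrite esumD ?lte_add_pinfty// => t _; rewrite lee_fin normc_ge0.
Qed.

Lemma csummableZ c f : csm f -> csm (fun t => c * f t).
Proof.
move=> /csummableE sf; apply/csummableE.
under eq_esum do rewrite Normc.normcM EFinM.
rewrite esumZ ?normc_ge0//; last by move=> t; rewrite lee_fin normc_ge0.
by rewrite esum_fine// => [|t]; rewrite -?EFinM ?ltry ?normc_ge0.
Qed.

Lemma csumE f : csumT f = rsum setT (fun t => complex.Re (f t)) +i*
   rsum setT (fun t => complex.Im (f t)).
Proof. by []. Qed.

Lemma csumD f g : csm f -> csm g -> csumT (fun t => f t + g t) = csumT f + csumT g.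
Proof.
move=> sf sg; apply: complex_ext; rewrite !csumE !ReImE.
  rewrite -rsumD; [|exact: csummable_Re..].
  by congr rsum; apply/funext => t; rewrite Re_add.
rewrite -rsumD; [|exact: csummable_Im..].
by congr rsum; apply/funext => t; rewrite Im_add.
Qed.

Lemma rsummableZ r (f : T -> R) : rsummable f -> rsummable (fun t => r * f t).
Proof.
rewrite /rsummable => sf; under eq_esum do rewrite normrM EFinM.
rewrite esumZ//; by rewrite (esum_fine _ sf)// -EFinM ltry.
Qed.

Lemma csumZ c f : csm f -> csumT (fun t => c * f t) = c * csumT f.
Proof.
move=> sf; have [sr si] := (csummable_Re sf, csummable_Im sf).
apply: complex_ext; rewrite !csumE !ReImE.
  rewrite -!rsumZ// -rsumN -rsumD.
  - by congr rsum; apply/funext => t; rewrite Re_mul.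
  - exact: rsummableZ.
  - by under eq_fun do rewrite -mulNr; exact: rsummableZ.
rewrite -!rsumZ// -rsumD.
- by congr rsum; apply/funext => t; rewrite Im_mul addrC.
- exact: rsummableZ.
- exact: rsummableZ.
Qed.

Lemma csumN f : csumT (fun t => - f t) = - csumT f.
Proof.
by apply: complex_ext; rewrite !csumE !ReImE -rsumN; congr rsum;
  apply/funext => t; rewrite ?Re_opp ?Im_opp.
Qed.

(** The factor 2 comes from bounding real and imaginary parts separately. The sharp constant 1 would
    change nothing later. *)
Lemma csum_normc_le f : csm f ->
  normc (csumT f) <= 2 * fine (\esum_(t in [set: T]) (normc (f t))%:E)%E.
Proof.
move=> sf; apply: (le_trans (normc_le_ReIm _)).
rewrite mulr2n mulrDl !mul1r csumE !ReImE; move/csummableE : (sf) => sn.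
have h (g : T -> R) : rsummable g -> (forall t, `|g t| <= normc (f t)) ->
   `|rsum setT g| <= fine (\esum_(t in [set: T]) (normc (f t))%:E)%E.
  move=> sg gf; apply: (le_trans (rsum_norm_le sg)); apply: fine_le.
  - exact: esum_fin_num.
  - by apply: esum_fin_num => // t; exact: normc_ge0.
  - by apply: le_esum => t _; rewrite lee_fin.
by apply: lerD; apply: h; [exact: csummable_Re|move=> t; exact: normc_Re|
  exact: csummable_Im|move=> t; exact: normc_Im].
Qed.

Lemma csum_normc_bound f (g : T -> R) (B : R) : (forall t, normc (f t) <= g t) ->
  (esumT g <= B%:E)%E -> normc (csumT f) <= 2 * B.
Proof.
move=> fg gB; have sg : (esumT g < +oo)%E by rewrite (le_lt_trans gB) ?ltry.
have sf := csummable_le fg sg.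
apply: (le_trans (csum_normc_le sf)); rewrite ler_pM2l// -lee_fin fineK.
  by apply: le_trans gB; apply: le_esum => t _; rewrite lee_fin.
apply: esum_fin_num => [t|]; first exact: normc_ge0.
exact: (csummableE _ _).1 sf.
Qed.

Lemma csum0 : csumT (fun _ : T => 0 : R[i]) = 0.
Proof.
rewrite -[RHS](mul0r (csumT (fun _ : T => 0 : R[i]))) -(csumZ 0 csummable0).
by congr csum; apply/funext => t; rewrite mul0r.
Qed.

Lemma csum_real (f : T -> R) : (forall t, 0 <= f t) ->
  csumT (fun t => (f t)%:C) = (fine (esumT f))%:C.
Proof.
move=> f0; apply: complex_ext; rewrite csumE !ReImE.
  by rewrite -rsum_ge0E.
by have := csum0 => /(congr1 (@complex.Im R)).
Qed.

Lemma rsum_mkcond (D : set T) (f : T -> R) :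
  rsum D f = rsum setT (fun t => if t \in D then f t else 0).
Proof.
rewrite /rsum !(esum_mkcond D); congr (fine _ - fine _); apply: eq_esum => t _.
  by rewrite /funrpos; case: ifP => // _; rewrite maxxx.
by rewrite /funrneg; case: ifP => // _; rewrite oppr0 maxxx.
Qed.

Lemma csum_mkcond (D : set T) f :
  csum D f = csumT (fun t => if t \in D then f t else 0).
Proof.
apply: complex_ext; rewrite csumE !ReImE [LHS]rsum_mkcond;
  by congr rsum; apply/funext => t; case: ifP.
Qed.

Lemma csummable_mkcond (D : set T) f :
  csummable D f <-> csm (fun t => if t \in D then f t else 0).
Proof.
rewrite !csummableE esum_mkcond.
rewrite (_ : \esum_(t in [set: T]) (normc (if t \in D then f t else 0))%:E =
  \esum_(i in [set: T]) (if i \in D then (normc (f i))%:E else 0))%E//.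
by apply: eq_esum => t _; case: ifP => //; rewrite Normc.normc0.
Qed.

End OneType.

Lemma csum_reindex (T T' : choiceType) (P : set T) (Q : set T') (e : T -> T')
    (f : T' -> R[i]) : set_bij P Q e ->
  csum Q f = csum P (fun t => f (e t)).
Proof.
by move=> be; rewrite /csum /rsum !(reindex_esum _ _ _ _ be).
Qed.

Lemma csummable_reindex (T T' : choiceType) (P : set T) (Q : set T')
    (e : T -> T') (f : T' -> R[i]) : set_bij P Q e ->
  csummable Q f <-> csummable P (fun t => f (e t)).
Proof. by move=> be; rewrite !csummableE (reindex_esum _ _ _ _ be). Qed.

Lemma bijective_set_bij (T T' : Type) (e : T -> T') : bijective e ->
  set_bij [set: T] [set: T'] e.
Proof.
move=> be; split => //; first by apply: in2W; exact: bij_inj.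
by move=> t _; case: be => g _ ge; exists (g t).
Qed.

Lemma csum_bij (T T' : choiceType) (e : T -> T') (f : T' -> R[i]) :
  bijective e -> csumT f = csumT (fun t => f (e t)).
Proof. by move=> be; apply: csum_reindex; exact: bijective_set_bij. Qed.

Lemma csummable_bij (T T' : choiceType) (e : T -> T') (f : T' -> R[i]) :
  bijective e -> csm f <-> csm (fun t => f (e t)).
Proof. by move=> be; apply: csummable_reindex; exact: bijective_set_bij. Qed.

Section Pairs.
Variables T1 T2 : choiceType.
Implicit Type f : T1 * T2 -> R[i].

Lemma csummable_row f : csm f -> forall i, csm (fun j => f (i, j)).
Proof.
move=> /csummableE; rewrite esum_pair; last by move=> p; exact: normc_ge0.
move=> H i; apply/csummableE.
have g0 k : (0 <= \esum_(j in [set: T2]) (normc (f (k, j)))%:E)%E.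
  by apply: esum_ge0 => j _; rewrite lee_fin normc_ge0.
have : summable [set: T1] (fun i => \esum_(j in [set: T2]) (normc (f (i, j)))%:E)%E.
  by rewrite /summable; under eq_esum do rewrite gee0_abs//.
by move/summable_pinfty => /(_ i I); rewrite gee0_abs.
Qed.

Lemma csummable_csum_row f : csm f -> csm (fun i => csumT (fun j => f (i, j))).
Proof.
move=> sf; have sr := csummable_row sf.
apply: (csummable_le (g := fun i =>
  2 * fine (\esum_(j in [set: T2]) (normc (f (i, j)))%:E)%E)).
  by move=> i; exact: csum_normc_le.
have n0 p := normc_ge0 (f p).
under eq_esum => i _.
  rewrite EFinM -esum_fine//; last exact: (csummableE _ _).1 (sr i).
  over.
rewrite esumZ//=; last by move=> i; apply: esum_ge0 => j _; rewrite lee_fin.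
by move/csummableE : sf => sf; rewrite -(esum_pair (f := fun p => normc (f p)))// (esum_fine n0 sf) -EFinM ltry.
Qed.

Lemma csum_pair f : csm f ->
  csumT f = csumT (fun i => csumT (fun j => f (i, j))).
Proof.
move=> sf; apply: complex_ext; rewrite !csumE !ReImE.
  by rewrite (rsum_pair (csummable_Re sf)).
by rewrite (rsum_pair (csummable_Im sf)).
Qed.

Lemma csummable_swap f : csm f -> csm (fun p : T2 * T1 => f (p.2, p.1)).
Proof.
move=> sf; have be : bijective (fun p : T2 * T1 => (p.2, p.1)).
  by exists (fun p => (p.2, p.1)) => -[].
exact: (csummable_bij f be).1.
Qed.

Lemma csum_swap f : csm f -> csumT f = csumT (fun p : T2 * T1 => f (p.2, p.1)).
Proof.
by move=> sf; apply: csum_bij; exists (fun p => (p.2, p.1)) => -[].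
Qed.

Lemma csummable_pair_le f (b : T1 -> R) :
  (forall i, \esum_(j in [set: T2]) (normc (f (i, j)))%:E <= (b i)%:E)%E ->
  (esumT b < +oo)%E -> csm f.
Proof.
move=> fb sb; apply/csummableE; apply: le_lt_trans sb.
by apply: esum_pair_le => // p; exact: normc_ge0.
Qed.

Lemma csummable_mul (f : T1 -> R[i]) (g : T2 -> R[i]) : csm f -> csm g ->
  csm (fun p => f p.1 * g p.2).
Proof.
move=> /csummableE sf /csummableE sg.
have gK : _ = _%:E := esum_fine (fun p => normc_ge0 (g p)) sg.
set G := fine _ in gK.
apply: (csummable_pair_le (b := fun i => normc (f i) * G)).
  move=> i /=; under eq_esum do rewrite Normc.normcM EFinM.
  rewrite esumZ ?normc_ge0// => [|t]; last by rewrite lee_fin normc_ge0.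
  by rewrite gK EFinM.
under eq_esum do rewrite mulrC EFinM.
have G0 : 0 <= G by apply/fine_ge0/esum_ge0 => t _; rewrite lee_fin normc_ge0.
rewrite esumZ// => [|t]; last by rewrite lee_fin normc_ge0.
by rewrite (esum_fine _ sf) -?EFinM ?ltry// => p; exact: normc_ge0.
Qed.

Lemma csum_mul (f : T1 -> R[i]) (g : T2 -> R[i]) : csm f -> csm g ->
  csumT (fun p => f p.1 * g p.2) = csumT f * csumT g.
Proof.
move=> sf sg; rewrite csum_pair; last exact: csummable_mul.
rewrite mulrC -csumZ//; congr csum; apply/funext => i /=.
by rewrite csumZ// mulrC.
Qed.

End Pairs.

Lemma csum_exchange (T1 T2 : choiceType) (f : T1 * T2 -> R[i]) : csm f ->
  csumT (fun i => csumT (fun j => f (i, j))) =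
  csumT (fun j => csumT (fun i => f (i, j))).
Proof.
move=> sf; rewrite -csum_pair// (csum_swap sf).
by rewrite (csum_pair (csummable_swap sf)).
Qed.


Lemma csum_fin (T : finType) (f : T -> R[i]) : csumT f = \sum_t f t.
Proof.
have rs (g : T -> R) : rsum setT g = \sum_t g t.
  rewrite /rsum !esum_fin//= -sumrB.
  by apply: eq_bigr => t _; rewrite -[in RHS](funrposBneg g).
rewrite csumE !rs.
apply: complex_ext; rewrite ReImE; symmetry.
  exact: (big_morph _ (@Re_add R)).
exact: (big_morph _ (@Im_add R)).
Qed.

Lemma csummable_fin (T : finType) (f : T -> R[i]) : csm f.
Proof. by apply/csummableE; rewrite esum_fin ?ltry// => t; exact: normc_ge0. Qed.

(** Passes between unordered sums and the ordered series in which [zeta] and the sum over [Na] are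
    stated. *)
Lemma csum_nat_series (u : nat -> R) : (forall n, 0 <= u n) ->
  csm (fun n => (u n)%:C) ->
  csumT (fun n => (u n)%:C) = (limn (series u))%:C.
Proof.
move=> u0 /csummableE su; rewrite csum_real//; congr (_ %:C).
have su' : (\esum_(t in [set: nat]) (u t)%:E < +oo)%E.
  apply: le_lt_trans su; apply: le_esum => t _.
  by rewrite lee_fin normc_real ler_norm.
rewrite -nneseries_esumT//=.
have := @summable_nneseries_lim R predT (EFin \o u) => -> //=; first by move=> i _; rewrite lee_fin.
rewrite /summable; apply: le_lt_trans su'.
rewrite [X in (esum X _ <= _)%E](_ : _ = setT); last by apply/seteqP.
by apply: le_esum => t _ /=; rewrite ger0_norm.
Qed.

End ComplexSums.

(** * Complex integrals along horizontal lines *)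

Section CurveDerivatives.
Variable R : realType.
Implicit Types (g h : R -> R[i]) (x : R).

(** Derivatives are taken along a real parameter and split into two real ones, so that the real mean
    value theorem, the fundamental theorem of calculus and differentiation under the integral apply
    directly. *)
Definition cderive g x (l : R[i]) : Prop :=
  is_derive x 1 (fun t => complex.Re (g t)) (complex.Re l) /\
  is_derive x 1 (fun t => complex.Im (g t)) (complex.Im l).

Lemma cderive_eq g x l l' : cderive g x l -> l = l' -> cderive g x l'.
Proof. by move=> H <-. Qed.

Lemma cderive_ext g h x l : (forall t, g t = h t) -> cderive g x l -> cderive h x l.
Proof. by move=> /funext ->. Qed.

Lemma cderive_cst c x : cderive (fun=> c) x 0.
Proof. by split; exact: is_derive_cst. Qed.

Lemma cderive_real x : cderive (fun t => t%:C) x 1.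
Proof. by split; [exact: is_derive_id|exact: is_derive_cst]. Qed.

Lemma cderiveD g h x l l' : cderive g x l -> cderive h x l' ->
  cderive (fun t => g t + h t) x (l + l').
Proof.
move=> [g1 g2] [h1 h2]; split.
  under eq_fun do rewrite Re_add; rewrite Re_add; exact: is_deriveD.
by under eq_fun do rewrite Im_add; rewrite Im_add; exact: is_deriveD.
Qed.

Lemma cderiveM g h x l l' : cderive g x l -> cderive h x l' ->
  cderive (fun t => g t * h t) x (l * h x + g x * l').
Proof.
move=> [g1 g2] [h1 h2]; split.
  under eq_fun do rewrite Re_mul.
  have H := is_deriveB (is_deriveM g1 h1) (is_deriveM g2 h2).
  apply: (@is_derive_eq _ _ _ _ _ _ _ _ H).
  by rewrite !ReImE /GRing.scale/=; ring.
under eq_fun do rewrite Im_mul.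
have H := is_deriveD (is_deriveM g1 h2) (is_deriveM g2 h1).
apply: (@is_derive_eq _ _ _ _ _ _ _ _ H).
by rewrite !ReImE /GRing.scale/=; ring.
Qed.

Lemma cderiveZ c g x l : cderive g x l -> cderive (fun t => c * g t) x (c * l).
Proof.
move=> H; apply: (cderive_eq (cderiveM (cderive_cst c x) H)).
by rewrite mul0r add0r.
Qed.

Lemma cderiveN g x l : cderive g x l -> cderive (fun t => - g t) x (- l).
Proof.
move=> H; rewrite -mulN1r; apply: cderive_ext (cderiveZ (-1) H) => t.
by rewrite mulN1r.
Qed.

Lemma cderiveX g x l n : cderive g x l ->
  cderive (fun t => g t ^+ n) x (n%:R * g x ^+ n.-1 * l).
Proof.
move=> H; elim: n => [|n IH].
  by rewrite !mul0r; under eq_fun do rewrite expr0; exact: cderive_cst.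
under eq_fun do rewrite exprS.
apply: (cderive_eq (cderiveM H IH)).
case: n {IH} => [|n]; first by rewrite !expr0; ring.
by rewrite -natr1 /= exprS; ring.
Qed.

Lemma cderive_cexp g x l : cderive g x l ->
  cderive (fun t => cexp (g t)) x (cexp (g x) * l).
Proof.
move=> [g1 g2].
have e1 := is_derive1_comp (is_derive_expR _) g1.
have c1 := is_derive1_comp (is_derive_cos _) g2.
have s1 := is_derive1_comp (is_derive_sin _) g2.
split.
  rewrite (_ : (fun t => complex.Re (cexp (g t))) =
   (fun t => expR (complex.Re (g t)) * cos (complex.Im (g t)))); last first.
    by apply/funext => t; rewrite /cexp !ReImE mul0r subr0.
  apply: (@is_derive_eq _ _ _ _ _ _ _ _ (is_deriveM e1 c1)).
  by rewrite /cexp !ReImE /GRing.scale/=; ring.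
rewrite (_ : (fun t => complex.Im (cexp (g t))) =
   (fun t => expR (complex.Re (g t)) * sin (complex.Im (g t)))); last first.
  by apply/funext => t; rewrite /cexp !ReImE mul0r addr0.
apply: (@is_derive_eq _ _ _ _ _ _ _ _ (is_deriveM e1 s1)).
by rewrite /cexp !ReImE /GRing.scale/=; ring.
Qed.

Lemma cderive_epii g x l : cderive g x l ->
  cderive (fun t => epii (g t)) x (epii (g x) * (pi%:C * 'i * l)).
Proof. by move=> H; apply: cderive_cexp; exact: cderiveZ. Qed.

Lemma Re_inv (z : R[i]) : complex.Re z^-1 =
  complex.Re z / (complex.Re z * complex.Re z + complex.Im z * complex.Im z).
Proof. by case: z. Qed.
Lemma Im_inv (z : R[i]) : complex.Im z^-1 =
  - (complex.Im z / (complex.Re z * complex.Re z + complex.Im z * complex.Im z)).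
Proof. by case: z. Qed.

Lemma ReIm2_neq0 (z : R[i]) : z != 0 ->
  complex.Re z * complex.Re z + complex.Im z * complex.Im z != 0.
Proof. by rewrite -!expr2 -normc_sqr sqrf_eq0 normc_eq0. Qed.

Lemma cderiveV g x l : g x != 0 -> cderive g x l ->
  cderive (fun t => (g t)^-1) x (- (l / g x ^+ 2)).
Proof.
move=> gx [g1 g2]; have n0 := ReIm2_neq0 gx.
have dn := is_deriveD (is_deriveM g1 g1) (is_deriveM g2 g2).
have dv := @is_deriveV R (fun t => complex.Re (g t) * complex.Re (g t) +
  complex.Im (g t) * complex.Im (g t)) x _ 1 n0 dn.
have -> : - (l / g x ^+ 2) = - (l * ((g x)^-1 * (g x)^-1)) by rewrite expr2 invfM.
split.
  under eq_fun do rewrite Re_inv.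
  apply: (@is_derive_eq _ _ _ _ _ _ _ _ (is_deriveM g1 dv)).
  rewrite !(ReImE, Re_inv, Im_inv) /GRing.scale/=.
  by field.
under eq_fun do rewrite Im_inv.
apply: (@is_derive_eq _ _ _ _ _ _ _ _ (is_deriveN (is_deriveM g2 dv))).
rewrite !(ReImE, Re_inv, Im_inv) /GRing.scale/=.
by field.
Qed.

Definition ccont g : Prop := continuous (fun t => complex.Re (g t)) /\
  continuous (fun t => complex.Im (g t)).

Lemma cderive_ccont g dg : (forall x, cderive g x (dg x)) -> ccont g.
Proof.
move=> H; split => x; apply/differentiable_continuous/derivable1_diffP.
  by have [[]] := H x.
by have [_ []] := H x.
Qed.

Lemma ccontM g h : ccont g -> ccont h -> ccont (fun t => g t * h t).
Proof.
move=> [g1 g2] [h1 h2]; split => x.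
  under eq_fun do rewrite Re_mul.
  by apply: cvgB; apply: cvgM; [exact: g1|exact: h1|exact: g2|exact: h2].
under eq_fun do rewrite Im_mul.
by apply: cvgD; apply: cvgM; [exact: g1|exact: h2|exact: g2|exact: h1].
Qed.

Lemma ccont_cst c : ccont (fun=> c).
Proof. by split => x; exact: cvg_cst. Qed.

Lemma ccontD g h : ccont g -> ccont h -> ccont (fun t => g t + h t).
Proof.
move=> [g1 g2] [h1 h2]; split => x.
  by under eq_fun do rewrite Re_add; apply: cvgD; [exact: g1|exact: h1].
by under eq_fun do rewrite Im_add; apply: cvgD; [exact: g2|exact: h2].
Qed.

Lemma ccont_shift g (s : R) : ccont g -> ccont (fun t => g (t + s)).
Proof.
move=> [g1 g2]; have cs : continuous (fun t : R => t + s).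
  by move=> t; apply: cvgD; [exact: cvg_id|exact: cvg_cst].
by split => t; [exact: (continuous_comp (cs t) (g1 (t + s)))|
  exact: (continuous_comp (cs t) (g2 (t + s)))].
Qed.

End CurveDerivatives.

Section ComplexIntegrals.
Variable R : realType.
Notation mu := (@lebesgue_measure R).
Implicit Types (f g : R -> R[i]) (D : set (measurableTypeR R)).

Definition cint (D : set R) f : R[i] :=
  (\int[mu]_(t in D) complex.Re (f t))%R +i* (\int[mu]_(t in D) complex.Im (f t))%R.

Definition cintegrable D f : Prop :=
  mu.-integrable D (EFin \o (fun t => complex.Re (f t))) /\
  mu.-integrable D (EFin \o (fun t => complex.Im (f t))).

Lemma cintegralE f : cintegral f = cint setT f. Proof. by []. Qed.

Lemma eq_cint D f g : (forall t, D t -> f t = g t) -> cint D f = cint D g.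
Proof.
by move=> fg; rewrite /cint; congr (_ +i* _); apply: eq_Rintegral => t /set_mem Dt;
  rewrite fg.
Qed.

Lemma cintegrableD D f g : measurable D -> cintegrable D f -> cintegrable D g ->
  cintegrable D (fun t => f t + g t).
Proof.
move=> mD [f1 f2] [g1 g2]; split.
  apply: (eq_integrable mD _ _ _ (integrableD mD f1 g1)) => t _ /=.
  by rewrite Re_add.
apply: (eq_integrable mD _ _ _ (integrableD mD f2 g2)) => t _ /=.
by rewrite Im_add.
Qed.

Lemma cintD D f g : measurable D -> cintegrable D f -> cintegrable D g ->
  cint D (fun t => f t + g t) = cint D f + cint D g.
Proof.
move=> mD [f1 f2] [g1 g2]; apply: complex_ext; rewrite /cint !ReImE -RintegralD//;
  by apply: eq_Rintegral => t _; rewrite ?Re_add ?Im_add.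
Qed.

Lemma cintegrableZ D c f : measurable D -> cintegrable D f ->
  cintegrable D (fun t => c * f t).
Proof.
move=> mD [f1 f2]; split.
  have H := integrableB mD (integrableZl mD (complex.Re c) f1)
     (integrableZl mD (complex.Im c) f2).
  by apply: (eq_integrable mD _ _ _ H) => t _ /=; rewrite Re_mul EFinB !EFinM.
have H := integrableD mD (integrableZl mD (complex.Re c) f2)
     (integrableZl mD (complex.Im c) f1).
by apply: (eq_integrable mD _ _ _ H) => t _ /=; rewrite Im_mul EFinD !EFinM.
Qed.

Lemma cintZ D c f : measurable D -> cintegrable D f ->
  cint D (fun t => c * f t) = c * cint D f.
Proof.
move=> mD [f1 f2]; apply: complex_ext; rewrite /cint !ReImE -!RintegralZl//.
  rewrite -RintegralB//.
  - by apply: eq_Rintegral => t _; rewrite Re_mul.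
  - exact: (integrableZl mD _ f1).
  - exact: (integrableZl mD _ f2).
rewrite -RintegralD//.
- by apply: eq_Rintegral => t _; rewrite Im_mul.
- exact: (integrableZl mD _ f2).
- exact: (integrableZl mD _ f1).
Qed.

Lemma cintegralZ c f : cintegrable setT f ->
  cintegral (fun t => c * f t) = c * cintegral f.
Proof. by move=> intf; rewrite !cintegralE cintZ. Qed.

Lemma cintegralD f g : cintegrable setT f -> cintegrable setT g ->
  cintegral (fun t => f t + g t) = cintegral f + cintegral g.
Proof. by move=> intf intg; rewrite !cintegralE cintD. Qed.

Lemma cint_normc_le D f (G : R -> R) : measurable D -> cintegrable D f ->
  mu.-integrable D (EFin \o G) -> (forall t, D t -> normc (f t) <= G t) ->
  normc (cint D f) <= 2 * (\int[mu]_(t in D) G t)%R.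
Proof.
move=> mD [f1 f2] iG fG; apply: (le_trans (normc_le_ReIm _)).
rewrite mulr2n mulrDl !mul1r /cint !ReImE; apply: lerD.
  apply: (le_trans (le_normr_Rintegral mD f1)); apply: le_Rintegral => //.
    exact: integrable_norm f1.
  by move=> t Dt; apply: le_trans (fG t Dt); exact: normc_Re.
apply: (le_trans (le_normr_Rintegral mD f2)); apply: le_Rintegral => //.
  exact: integrable_norm f2.
by move=> t Dt; apply: le_trans (fG t Dt); exact: normc_Im.
Qed.

Lemma ccont_measurable D f : ccont f ->
  measurable_fun D (fun t => complex.Re (f t)) /\
  measurable_fun D (fun t => complex.Im (f t)).
Proof.
by move=> [f1 f2]; split; apply: measurable_funTS; exact: continuous_measurable_fun.
Qed.

Lemma cintegrable_le D f (G : R -> R) : measurable D -> ccont f ->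
  mu.-integrable D (EFin \o G) -> (forall t, D t -> normc (f t) <= G t) ->
  cintegrable D f.
Proof.
move=> mD cf iG fG; have [m1 m2] := ccont_measurable D cf; split.
  apply: (le_integrable mD _ _ iG); first exact/measurable_EFinP.
  move=> t Dt; rewrite /= lee_fin; apply: le_trans (normc_Re _) _.
  by apply: le_trans (fG t Dt) _; exact: ler_norm.
apply: (le_integrable mD _ _ iG); first exact/measurable_EFinP.
move=> t Dt; rewrite /= lee_fin; apply: le_trans (normc_Im _) _.
by apply: le_trans (fG t Dt) _; exact: ler_norm.
Qed.

Lemma integrable_oneDsqrV : mu.-integrable setT (EFin \o (fun t => (1 + t ^+ 2)^-1)).
Proof.
have c := @continuous_oneDsqrV R.
apply/integrableP; split.
  by apply/measurable_EFinP; exact: (continuous_measurable_fun c).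
have g0 x : 0 <= (@oneDsqr R x)^-1 by rewrite invr_ge0 (le_trans ler01)// oneDsqr_ge1.
under eq_integral do rewrite /= ger0_norm ?g0//.
rewrite (@ge0_symfun_integralT _ (fun x => (oneDsqr x)^-1))//; last first.
  by move=> x /=; rewrite /oneDsqr sqrrN.
by rewrite -set_itvcy integral0y_oneDsqr -EFinM ltry.
Qed.

Lemma Rintegral_oneDsqrV : (\int[mu]_t (1 + t ^+ 2)^-1)%R = pi :> R.
Proof.
have c := @continuous_oneDsqrV R.
have g0 x : 0 <= (@oneDsqr R x)^-1 by rewrite invr_ge0 (le_trans ler01)// oneDsqr_ge1.
rewrite /Rintegral (@ge0_symfun_integralT _ (fun x => (oneDsqr x)^-1))//; last first.
  by move=> x /=; rewrite /oneDsqr sqrrN.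
by rewrite -set_itvcy integral0y_oneDsqr -EFinM /=; field.
Qed.

(** The common domination hypothesis: 1/(1 + t^2) is integrable over the line, summable over the
    integers, and stable under translation up to a constant. *)
Definition decays (M : R) f := forall t, normc (f t) <= M / (1 + t ^+ 2).

Lemma integrable_decay M : mu.-integrable setT (EFin \o (fun t => M / (1 + t ^+ 2))).
Proof. exact: (integrableZl measurableT M integrable_oneDsqrV). Qed.

Lemma cintegrable_decay M f : ccont f -> decays M f -> cintegrable setT f.
Proof.
move=> cf df; apply: (cintegrable_le measurableT cf (integrable_decay M)).
by move=> t _; exact: df.
Qed.

Lemma cintegral_decay_le M f : ccont f -> decays M f ->
  normc (cintegral f) <= 2 * (M * pi).
Proof.
move=> cf df; rewrite cintegralE.
apply: (le_trans (cint_normc_le measurableT (cintegrable_decay cf df)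
  (integrable_decay M) (fun t _ => df t))).
by rewrite RintegralZl ?Rintegral_oneDsqrV//; exact: integrable_oneDsqrV.
Qed.

Lemma ge0_integral_translate (G : R -> R) (s : R) : continuous G ->
  (forall x, 0 <= G x) ->
  (\int[mu]_x (G x)%:E = \int[mu]_x (G (x + s))%:E)%E.
Proof.
move=> cG G0.
have dF : (fun x : R => x + s)^`()%classic = cst 1.
  by apply/funext => x; rewrite derive1E deriveD// derive_id derive_cst addr0.
rewrite (@increasing_ge0_integration_by_substitutionT _ (fun x => x + s))//.
- by apply: eq_integral => x _; rewrite /= fctE/= dF mulr1.
- by move=> x y; rewrite ltrD2r.
- by rewrite dF => x; exact: cvg_cst.
- by rewrite dF; exact: is_cvg_cst.
- by rewrite dF; exact: is_cvg_cst.
- exact: cvg_addrr_Ny.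
- exact: cvg_addrr.
Qed.

Lemma Rintegral_translate (G : R -> R) (s : R) : continuous G ->
  mu.-integrable setT (EFin \o G) ->
  (\int[mu]_x G x = \int[mu]_x (G (x + s)))%R.
Proof.
move=> cG iG; rewrite /Rintegral; congr fine; rewrite [LHS]integralE [RHS]integralE.
have cp (H : R -> R) : continuous H -> continuous H^\+.
  by move=> cH x; apply: (@continuous_max _ _ H (cst 0)); [exact: cH|exact: cvg_cst].
have cn (H : R -> R) : continuous H -> continuous H^\-.
  by move=> cH; rewrite -funrposN; apply: cp => x; apply: cvgN; exact: cH.
congr (_ - _)%E.
  transitivity (\int[mu]_x (G^\+ x)%:E)%E.
    by apply: eq_integral => x _; rewrite -[LHS]/((EFin \o G)^\+%E x) funerpos.
  rewrite (ge0_integral_translate s (cp _ cG)); last exact: funrpos_ge0.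
  by apply: eq_integral => x _; rewrite -[RHS]/((EFin \o (fun x => G (x + s)%R))^\+%E x) funerpos.
transitivity (\int[mu]_x (G^\- x)%:E)%E.
  by apply: eq_integral => x _; rewrite -[LHS]/((EFin \o G)^\-%E x) funerneg.
rewrite (ge0_integral_translate s (cn _ cG)); last exact: funrneg_ge0.
by apply: eq_integral => x _; rewrite -[RHS]/((EFin \o (fun x => G (x + s)%R))^\-%E x) funerneg.
Qed.

Lemma cintegral_translate M f (s : R) : ccont f -> decays M f ->
  cintegral f = cintegral (fun t => f (t + s)).
Proof.
move=> [c1 c2] df; have [i1 i2] := cintegrable_decay (conj c1 c2) df.
by rewrite /cintegral (Rintegral_translate s c1 i1) (Rintegral_translate s c2 i2).
Qed.

Lemma cderive_cintegral (F dF : R -> R -> R[i]) (u v a M : R) : u < a < v ->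
  (forall x, u < x < v -> ccont (F x)) ->
  (forall x, u < x < v -> decays M (F x)) ->
  (forall x, u < x < v -> decays M (dF x)) ->
  (forall x t, u < x < v -> cderive (F ^~ t) x (dF x t)) ->
  cderive (fun x => cintegral (F x)) a (cintegral (dF a)).
Proof.
move=> uav cF dcF dcdF derF.
have intF x : u < x < v -> cintegrable setT (F x).
  by move=> ux; apply: cintegrable_decay (dcF x ux); exact: cF.
have M0 : 0 <= M.
  have := dcF a uav 0; rewrite expr0n addr0 divr1; apply: le_trans; exact: normc_ge0.
have G0 t : 0 <= M / (1 + t ^+ 2) by rewrite divr_ge0// addr_ge0// sqr_ge0.
(* The argument is run once for a real functional [p], then used for real and imaginary parts. *)
have key (p : R[i] -> R) (dp : forall g x l, cderive g x l -> is_derive x 1 (fun t => p (g t)) (p l))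
   (pn : forall z, `|p z| <= normc z) (ip : forall x, u < x < v ->
     mu.-integrable setT (EFin \o (fun t => p (F x t)))) :
   is_derive a 1 (fun x => (\int[mu]_t p (F x t))%R) (\int[mu]_t p (dF a t))%R.
  have d1 x t : u < x < v -> partial1of2 (fun x t => p (F x t)) x t = p (dF x t).
    by move=> ux; rewrite partial1of2E; have [_ ->] := dp _ _ _ (derF x t ux).
  have a1 : `]u, v[%classic a by rewrite /= in_itv.
  have i1 x : `]u, v[%classic x -> mu.-integrable setT (EFin \o (fun t => p (F x t))).
    by rewrite /= in_itv => /ip.
  have r1 x t : `]u, v[%classic x -> setT t -> derivable (fun x => p (F x t)) x 1.
    by rewrite /= in_itv => ux _; have [] := dp _ _ _ (derF x t ux).
  have b1 x t : `]u, v[%classic x -> setT t ->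
      `|partial1of2 (fun x t => p (F x t)) x t| <= M / (1 + t ^+ 2).
    rewrite /= in_itv => ux _; rewrite d1//; apply: le_trans (pn _) _.
    exact: dcdF.
  apply: DeriveDef.
    exact: (derivable_under_integral measurableT a1 i1 r1 G0 (integrable_decay M) b1).
  rewrite -derive1E (differentiation_under_integral measurableT a1 i1 r1 G0 (integrable_decay M) b1).
  by apply: eq_Rintegral => t _; rewrite d1.
split.
  apply: key => [g x l []//|z|x ux]; first exact: normc_Re.
  by have [] := intF x ux.
apply: key => [g x l []//|z|x ux]; first exact: normc_Im.
by have [] := intF x ux.
Qed.

End ComplexIntegrals.

(** * Moving an integral between horizontal lines *)

Section HorizontalShift.
Variable R : realType.
Implicit Types (F dF : R[i] -> R[i]) (U : set R[i]).

(** Holomorphy on [U] with derivative [dF], tested along real lines in every direction [v]. That the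
    derivative is [dF] times the complex number [v] encodes the Cauchy-Riemann equations. *)
Definition hol U F dF : Prop := forall (tau v : R[i]) (x : R),
  U (tau + x%:C * v) ->
  cderive (fun x => F (tau + x%:C * v)) x (dF (tau + x%:C * v) * v).

Definition line (F : R[i] -> R[i]) (y : R) : R -> R[i] := fun t => F (t +i* y).

Lemma lineE (t y : R) : (t +i* y) = (0 +i* y) + t%:C * 1.
Proof. by apply: complex_ext; rewrite !ReImE; ring. Qed.

Lemma hol_ccont U F dF y : hol U F dF -> (forall t, U (t +i* y)) ->
  ccont (line F y).
Proof.
move=> hF Uy; apply: (@cderive_ccont _ _ (fun t => dF (t +i* y))) => t.
rewrite /line (_ : (fun t => F (t +i* y)) = (fun t => F ((0 +i* y) + t%:C * 1))).
  have := hF (0 +i* y) 1 t; rewrite -lineE mulr1; apply; exact: Uy.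
by apply/funext => s; rewrite lineE.
Qed.

Definition strip (a b : R) : set R[i] := [set z | a < complex.Im z < b].

Lemma oneDsqr_shift (t x : R) : `|x| <= 1 -> (1 + (t + x) ^+ 2)^-1 <= 3 / (1 + t ^+ 2).
Proof.
rewrite ler_norml => /andP[x1 x2].
have p1 (z : R) : 0 < 1 + z ^+ 2 by rewrite ltr_pwDl// sqr_ge0.
rewrite ler_pdivlMr// ler_pdivrMl//.
have h1 : x * x <= 1 by nra.
(* The difference 3 (1 + (t + x)^2) - (1 + t^2) equals 2 (t + 3x/2)^2 + 2 - 3x^2/2. *)
by have := sqr_ge0 (t + 3 / 2 * x); nra.
Qed.

(** Translating along the line does not change the integral, so its derivative in the real
    direction, the integral of [dF], is 0. In the vertical direction the derivative is i times the
    same integral, hence also 0, and the mean value theorem gives constancy. *)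
Lemma cintegral_shift F dF (a b M : R) :
  hol (strip a b) F dF ->
  (forall y, a < y < b -> decays M (line F y)) ->
  (forall y, a < y < b -> decays M (line dF y)) ->
  (forall y, a < y < b -> ccont (line dF y)) ->
  (forall y, a < y < b -> cintegral (line dF y) = 0) /\
  (forall y1 y2, a < y1 < b -> a < y2 < b ->
    cintegral (line F y1) = cintegral (line F y2)).
Proof.
move=> hF dcF dcdF ccdF.
have Uy y t : a < y < b -> strip a b (t +i* y) by [].
have cF y : a < y < b -> ccont (line F y).
  by move=> aby; apply: hol_ccont hF _ => t; exact: Uy.
have M0 y : a < y < b -> 0 <= M.
  move=> aby; have := dcF y aby 0.
  by rewrite expr0n addr0 divr1; apply: le_trans; exact: normc_ge0.
have i0 y : a < y < b -> cintegral (line dF y) = 0.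
  move=> aby.
  have H : cderive (fun x => cintegral (fun t => F (t +i* y + x%:C * 1))) 0
     (cintegral (fun t => dF (t +i* y + 0%:C * 1))).
    have E (t x : R) : t +i* y + x%:C * 1 = (t + x) +i* y.
      by rewrite mulr1; apply: complex_ext; rewrite !ReImE ?addr0.
    have S (x : R) : -1 < x < 1 -> `|x| <= 1.
      by move=> /andP[/ltW x1 /ltW x2]; rewrite ler_norml x1.
    apply: (@cderive_cintegral R (fun x t => F (t +i* y + x%:C * 1))
      (fun x t => dF (t +i* y + x%:C * 1)) (-1) 1 0 (M * 3)).
    - by rewrite ltrN10 ltr01.
    - move=> x _; under eq_fun do rewrite E.
      exact: (ccont_shift x (cF y aby)).
    - move=> x /S x1 t; rewrite E; apply: le_trans (dcF y aby _) _.
      by rewrite -mulrA ler_wpM2l ?(M0 y)// oneDsqr_shift.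
    - move=> x /S x1 t; rewrite E; apply: le_trans (dcdF y aby _) _.
      by rewrite -mulrA ler_wpM2l ?(M0 y)// oneDsqr_shift.
    - move=> x t _; apply: (cderive_eq (hF (t +i* y) 1 x _) (mulr1 _)).
      by rewrite E; exact: Uy.
  (* The same derivative evaluated a second time: by translation invariance the function of [x] is
     constant. Comparing with [H] gives the vanishing. *)
  have H0 : cderive (fun x => cintegral (fun t => F (t +i* y + x%:C * 1))) 0 0.
    apply: cderive_ext (cderive_cst (cintegral (line F y)) 0) => x.
    rewrite (cintegral_translate x (cF y aby) (dcF y aby)); congr cintegral.
    by apply/funext => t; rewrite /line; congr F; apply: complex_ext; rewrite !ReImE; ring.
  have -> : cintegral (line dF y) = cintegral (fun t => dF (t +i* y + 0%:C * 1)).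
    congr cintegral; apply/funext => t; rewrite /line; congr dF.
    by apply: complex_ext; rewrite !ReImE; ring.
  case: H H0 => [[_ H1] [_ H2]] [[_ H3] [_ H4]].
  by apply: complex_ext; rewrite -?H1 -?H2 ?H3 ?H4.
split=> // y1 y2 aby1 aby2.
have der y : a < y < b -> cderive (fun y => cintegral (line F y)) y 0.
  move=> aby; rewrite -(mul0r 'i) -(i0 y aby) mulrC.
  rewrite -cintegralZ; last exact: cintegrable_decay (ccdF y aby) (dcdF y aby).
  apply: (@cderive_cintegral R (fun y t => F (t +i* y)) (fun y t => 'i * dF (t +i* y)) a b y M) => //.
  - by move=> x abx t; rewrite Normc.normcM normc_i mul1r; exact: dcdF.
  - move=> x t abx; have := hF t%:C 'i x.
    have E (z : R) : t%:C + z%:C * 'i = t +i* z.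
      by apply: complex_ext; rewrite !ReImE; ring.
    rewrite E mulrC; under eq_fun do rewrite E; apply; exact: Uy.
have cst0 (p : R -> R) z1 z2 : (forall y, a < y < b -> is_derive y 1 p 0) ->
    a < z1 < b -> a < z2 < b -> z1 < z2 -> p z1 = p z2.
  move=> dp az1 az2 z12.
  have inn y : y \in `[z1, z2] -> a < y < b.
    rewrite in_itv /= => /andP[h1 h2]; apply/andP; split.
      by apply: lt_le_trans h1; case/andP: az1.
    by apply: le_lt_trans h2 _; case/andP: az2.
  have [| |c _] := @MVT _ p (fun=> 0) z1 z2 z12.
  - by move=> y yz; apply: dp; apply: inn; exact: subset_itv_oo_cc.
  - apply: derivable_within_continuous => y /inn/dp []//.
  - by rewrite mul0r => /eqP; rewrite subr_eq0 => /eqP ->.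
wlog y12 : y1 y2 aby1 aby2 / y1 < y2.
  move=> H; have [/H->//|/H->//|->//] := ltgtP y1 y2.
by apply: complex_ext; [apply: (cst0 (fun y => complex.Re (cintegral (line F y))))|
  apply: (cst0 (fun y => complex.Im (cintegral (line F y))))] => // y /der [].
Qed.

End HorizontalShift.

(** * Poisson summation *)

Section UnitIntervals.
Variable R : realType.
Notation mu := (@lebesgue_measure R).

Definition int_of_nat (n : nat) : int := if odd n then Negz n./2 else Posz n./2.
Definition nat_of_int (z : int) : nat :=
  match z with Posz n => n.*2 | Negz n => n.*2.+1 end.

Lemma int_of_natK : cancel int_of_nat nat_of_int.
Proof.
move=> n; rewrite /int_of_nat; case: ifP => no /=.
  by rewrite -[in RHS](odd_double_half n) no add1n.
by rewrite -[in RHS](odd_double_half n) no add0n.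
Qed.
Lemma nat_of_intK : cancel nat_of_int int_of_nat.
Proof.
by case=> n; rewrite /int_of_nat /= ?odd_double /= ?doubleK// uphalf_double.
Qed.
Lemma int_of_nat_bij : bijective int_of_nat.
Proof. exact: (Bijective int_of_natK nat_of_intK). Qed.

(** Cells are centred at the integers, so that the peak of the Fejér kernel lies in the middle of
    its cell; half-open intervals make them a partition. *)
Definition uitv (n : int) : set (measurableTypeR R) :=
  `[(n%:~R - 2^-1)%R, (n%:~R + 2^-1)%R[%classic.

Lemma uitvE (n : int) t : uitv n t <-> Num.floor (t + 2^-1) = n.
Proof.
rewrite /uitv /= in_itv /=; split => [/andP[h1 h2]|<-].
  by apply: floor_def; rewrite intrD; apply/andP; split; lra.
have := floor_itv (t + 2^-1); rewrite intrD => /andP[h1 h2].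
by apply/andP; split; lra.
Qed.

Lemma measurable_uitv n : measurable (uitv n).
Proof. exact: measurable_itv. Qed.

Lemma uitv_trivIset : trivIset setT (fun i => uitv (int_of_nat i)).
Proof.
apply/trivIsetP => i j _ _ /eqP ij; apply/seteqP; split => // t [/uitvE h1 /uitvE h2].
by apply: ij; apply: (can_inj int_of_natK); rewrite -h1 -h2.
Qed.

Lemma bigcup_uitv : \bigcup_i uitv (int_of_nat i) = setT.
Proof.
apply/seteqP; split => // t _; exists (nat_of_int (Num.floor (t + 2^-1))) => //.
by apply/uitvE; rewrite nat_of_intK.
Qed.

Lemma ge0_integral_uitv (h : R -> R) : (forall t, 0 <= h t) ->
  measurable_fun setT h ->
  (\int[mu]_t (h t)%:E = \esum_(n in [set: int]) \int[mu]_(t in uitv n) (h t)%:E)%E.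
Proof.
move=> h0 mh; rewrite -bigcup_uitv ge0_integral_bigcup//=.
- rewrite nneseries_esumT => [|i]; last by apply: integral_ge0 => t _; rewrite lee_fin.
  by rewrite (esum_bij _ int_of_nat_bij).
- by move=> k; exact: measurable_uitv.
- by apply/measurable_EFinP; rewrite bigcup_uitv.
- by move=> x _; rewrite lee_fin.
- exact: uitv_trivIset.
Qed.

Lemma Rintegral_uitv (h : R -> R) : mu.-integrable setT (EFin \o h) ->
  rsummable (fun n : int => (\int[mu]_(t in uitv n) h t)%R) /\
  (\int[mu]_t h t)%R = rsum setT (fun n : int => (\int[mu]_(t in uitv n) h t)%R).
Proof.
move=> ih; have mh : measurable_fun setT h.
  by apply/measurable_EFinP; exact: (measurable_int mu ih).
have pos (g : R -> R) : (forall t, 0 <= g t) -> mu.-integrable setT (EFin \o g) ->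
  (\esum_(n in [set: int]) ((\int[mu]_(t in uitv n) g t)%R)%:E = \int[mu]_t (g t)%:E)%E.
  move=> g0 ig; rewrite ge0_integral_uitv//; last first.
    by apply/measurable_EFinP; exact: (measurable_int mu ig).
  apply: eq_esum => n _; rewrite /Rintegral fineK//.
  by apply: integrable_fin_num; [exact: measurable_uitv|
     apply: integrableS ig => //; exact: measurable_uitv].
have fin (g : R -> R) : mu.-integrable setT (EFin \o g) ->
    (\int[mu]_t (g t)%:E < +oo)%E.
  move=> ig; have : (\int[mu]_t (EFin \o g) t)%E \is a fin_num by exact: integrable_fin_num.
  by rewrite fin_numElt => /andP[].
have ip : mu.-integrable setT (EFin \o h^\+).
  by have := integrable_funepos measurableT ih; rewrite funerpos.
have in' : mu.-integrable setT (EFin \o h^\-).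
  by have := integrable_funeneg measurableT ih; rewrite funerneg.
have sub (g : R -> R) n : mu.-integrable setT (EFin \o g) -> mu.-integrable (uitv n) (EFin \o g).
  by move=> ig; apply: integrableS ig => //; exact: measurable_uitv.
have dec n : (\int[mu]_(t in uitv n) h t)%R =
   (\int[mu]_(t in uitv n) h^\+ t)%R - (\int[mu]_(t in uitv n) h^\- t)%R.
  rewrite -RintegralB; [|exact: measurable_uitv|exact: sub|exact: sub].
  by apply: eq_Rintegral => t _; rewrite -[in LHS](funrposBneg h).
have [pp pn] := (pos _ (@funrpos_ge0 _ _ h) ip, pos _ (@funrneg_ge0 _ _ h) in').
have g1 n : 0 <= (\int[mu]_(t in uitv n) h^\+ t)%R by apply: Rintegral_ge0 => t _; exact: funrpos_ge0.
have g2 n : 0 <= (\int[mu]_(t in uitv n) h^\- t)%R by apply: Rintegral_ge0 => t _; exact: funrneg_ge0.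
split.
  apply: (rsummable_le (g := fun n => (\int[mu]_(t in uitv n) h^\+ t)%R + (\int[mu]_(t in uitv n) h^\- t)%R)).
    by move=> n; rewrite dec (le_trans (ler_normB _ _))// !ger0_norm.
  under eq_esum do rewrite EFinD.
  rewrite esumD; [|by move=> n _; rewrite lee_fin..].
  by rewrite pp pn lte_add_pinfty// fin.
under [in RHS]eq_fun do rewrite dec.
rewrite rsumB//; [|by rewrite pp fin|by rewrite pn fin].
rewrite pp pn -[LHS]/(\int[mu]_(t in setT) h t)%R.
rewrite -RintegralB//.
by apply: eq_Rintegral => t _; rewrite -[in LHS](funrposBneg h).
Qed.

Lemma cintegral_uitv (h : R -> R[i]) : cintegrable setT h ->
  csummable [set: int] (fun n => cint (uitv n) h) /\
  cintegral h = csum [set: int] (fun n => cint (uitv n) h).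
Proof.
move=> [i1 i2]; have [s1 e1] := Rintegral_uitv i1; have [s2 e2] := Rintegral_uitv i2.
split; last by apply: complex_ext; rewrite /cintegral !ReImE ?e1 ?e2.
apply: (csummable_le (g := fun n : int => `|(\int[mu]_(t in uitv n) complex.Re (h t))%R| +
   `|(\int[mu]_(t in uitv n) complex.Im (h t))%R|)).
  by move=> n; exact: normc_le_ReIm.
under eq_esum do rewrite EFinD.
by rewrite esumD; [rewrite lte_add_pinfty|move=> n _; rewrite lee_fin..].
Qed.

Lemma cint_FTC (G g : R -> R[i]) (a b : R) : a < b -> ccont g ->
  (forall t, cderive G t (g t)) -> cint `[a, b] g = G b - G a.
Proof.
move=> ab [c1 c2] dG.
have key (P p : R -> R) : continuous p -> (forall t : R, is_derive t 1 P (p t)) ->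
    (\int[mu]_(t in `[a, b]) p t)%R = P b - P a.
  move=> cp dP; rewrite /Rintegral (@continuous_FTC2 _ p P)//.
  - exact: continuous_subspaceT.
  - have cP : continuous P.
      move=> x; apply/differentiable_continuous/derivable1_diffP.
      by have [] := dP x.
    split=> [x _||]; first by have [] := dP x.
      by apply: cvg_at_right_filter; exact: cP.
    by apply: cvg_at_left_filter; exact: cP.
  - by move=> x _; rewrite derive1E; have [_ ->] := dP x.
apply: complex_ext; rewrite /cint !ReImE.
  exact: (key (fun t => complex.Re (G t)) (fun t => complex.Re (g t)) c1 (fun t => (dG t).1)).
exact: (key (fun t => complex.Im (G t)) (fun t => complex.Im (g t)) c2 (fun t => (dG t).2)).
Qed.

End UnitIntervals.

(** * The Fejér kernel on unit intervals *)

Section FejerKernel.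
Variable R : realType.
Notation mu := (@lebesgue_measure R).

(** A crude form of Jordan's inequality. If cos u >= 1/2, the mean value theorem gives sin u = u cos
    c with cos c > 1/2; otherwise sin u > 1/2, while u/4 < 1/2 because pi/2 < 2. *)
Lemma sin_ge_quarter (u : R) : 0 <= u <= pi / 2 -> u / 4 <= sin u.
Proof.
move=> /andP[u0 u1]; have := @pihalf_lt2 R => pi2.
have cu0 : 0 <= cos u by apply: cos_ge0_pihalf; rewrite u1 andbT (le_trans _ u0)// oppr_le0 divr_ge0 ?pi_ge0.
have su0 : 0 <= sin u by apply: sin_ge0_pi; rewrite u0 /=; have := @pi_ge0 R; lra.
have [c1|c1] := leP 2^-1 (cos u); last first.
  have := cos2Dsin2 u; nra.
move: u0; rewrite le_eqVlt => /predU1P[<-|u0]; first by rewrite sin0 mul0r.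
have [|c] := @MVT _ sin cos 0 u u0.
  by apply: continuous_subspaceT; exact: continuous_sin.
rewrite in_itv /= => /andP[c0 cu]; rewrite sin0 !subr0 => ->.
have : cos u < cos c.
  by rewrite ltr_cos// in_itv /=; apply/andP; split; have := @pi_ge0 R; lra.
nra.
Qed.

Definition dirichlet (M : nat) (t : R) : R[i] :=
  \sum_(j < M) epii (2 * t%:C) ^+ j.

(** This is sin^2(pi M t) / (M sin^2(pi t)), written as a normalized square: nonnegativity and the
    expansion into characters are then immediate, also at integers. *)
Definition fejer (M : nat) (t : R) : R := normc (dirichlet M t) ^+ 2 / M%:R.

Lemma epii_realE (x : R) : epii x%:C = cos (pi * x) +i* sin (pi * x).
Proof.
rewrite /epii /cexp !ReImE !(mulr0, mul0r, mulr1, subr0, addr0, add0r, sub0r, oppr0).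
by rewrite expR0 mul1r.
Qed.

Lemma normc_epii_real (x : R) : normc (epii x%:C) = 1.
Proof. by rewrite normc_epii Im_real mulr0 oppr0 expR0. Qed.

Lemma two_realC (t : R) : 2 * t%:C = (2 * t)%:C :> R[i].
Proof. by rewrite realCM natrC. Qed.

Lemma normc_epii_sub1 (t : R) : normc (epii (2 * t%:C) - 1) ^+ 2 = 4 * sin (pi * t) ^+ 2.
Proof.
rewrite two_realC epii_realE normc_sqr !ReImE.
have -> : pi * (2 * t) = (pi * t) *+ 2 by rewrite mulr2n; ring.
rewrite cos_mulr2n sin_mulr2n; have := cos2Dsin2 (pi * t) => h.
set s := sin _ in h *; set c := cos _ in h *.
have -> : (c ^+ 2 *+ 2 - 1 - 1) ^+ 2 + ((c * s) *+ 2 - 0) ^+ 2 =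
  4 * ((c ^+ 2 - 1) ^+ 2 + c ^+ 2 * s ^+ 2) by ring.
by have -> : c ^+ 2 = 1 - s ^+ 2; [rewrite -h; ring|ring].
Qed.

Lemma fejer_ge0 M t : 0 <= fejer M t.
Proof. by rewrite divr_ge0// sqr_ge0. Qed.

(** The geometric sum times (w - 1) is w^M - 1, of modulus at most 2, where w = e^{2 pi i t} and |w
    - 1|^2 = 4 sin^2(pi t). *)
Lemma fejer_sin M t : (0 < M)%N -> sin (pi * t) ^+ 2 * fejer M t <= M%:R^-1.
Proof.
move=> M0; rewrite /fejer mulrA ler_piMl ?invr_ge0//.
have := subrX1 (epii (2 * t%:C)) M; rewrite -/(dirichlet M t) => /(congr1 (@normc R)).
rewrite Normc.normcM => h1.
have h : normc (epii (2 * t%:C) ^+ M - 1) ^+ 2 = 4 * sin (pi * t) ^+ 2 * normc (dirichlet M t) ^+ 2.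
  by rewrite h1 exprMn normc_epii_sub1.
have : normc (epii (2 * t%:C) ^+ M - 1) <= 2.
  apply: (le_trans (normcB _ _)); rewrite Normc.normc1 normcX two_realC normc_epii_real expr1n.
  by [].
have := normc_ge0 (epii (2 * t%:C) ^+ M - 1); nra.
Qed.

Lemma fejer_le M t : fejer M t <= M%:R.
Proof.
case: M => [|M]; first by rewrite /fejer invr0 mulr0.
rewrite /fejer ler_pdivrMr// -expr2 ler_sqr ?nnegrE ?normc_ge0//.
apply: (le_trans (normc_sum _ _)); apply: (@le_trans _ _ (\sum_(i < M.+1) 1)); last by rewrite sumr_const card_ord.
apply: ler_sum => i _.
by rewrite normcX two_realC normc_epii_real expr1n.
Qed.

Lemma conjc_epii (x : R) : ((epii x%:C)^*)%C = epii (- x)%:C.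
Proof. by rewrite !epii_realE /= mulrN cosN sinN. Qed.

Lemma fejerE M t : (fejer M t)%:C =
  M%:R^-1 * \sum_(i < M) \sum_(j < M) epii (2 * ((i : nat)%:Z - (j : nat)%:Z)%:~R * t%:C).
Proof.
rewrite /fejer realCM realCV -natrC mulrC realCX -normr_normc sqr_normc; congr (_ * _).
rewrite /dirichlet rmorph_sum /= mulr_suml; apply: eq_bigr => i _.
rewrite mulr_sumr; apply: eq_bigr => j _.
have -> : ((epii (2 * t%:C) ^+ j)^*)%C = ((epii (2 * t%:C))^*)%C ^+ j :> R[i].
  exact: (rmorphXn (@conjc R)).
rewrite two_realC conjc_epii -!epiiMn -epiiD; congr epii.
by rewrite intrB -!pmulrn realCN -two_realC mulNrn -[_ *+ i]mulr_natr -[_ *+ j]mulr_natr; ring.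
Qed.

Lemma cderive_char (l : int) (t : R) :
  cderive (fun t => epii (2 * l%:~R * t%:C)) t (epii (2 * l%:~R * t%:C) * (pi%:C * 'i * (2 * l%:~R))).
Proof.
apply: cderive_epii; apply: (cderive_eq (cderiveZ _ (cderive_real t))).
by rewrite mulr1.
Qed.

Lemma ccont_char (l : int) : ccont (fun t : R => epii (2 * l%:~R * t%:C)).
Proof. exact: cderive_ccont (cderive_char l). Qed.

Lemma normc_char (l : int) (t : R) : normc (epii (2 * l%:~R * t%:C)) = 1.
Proof. by rewrite intrC -mulrA -realCM two_realC normc_epii_real. Qed.

Lemma normc_char_le (l : int) (t : R) : normc (epii (2 * l%:~R * t%:C)) <= 1.
Proof. by rewrite normc_char. Qed.

Lemma cintegrable_uitv (g : R -> R[i]) (B : R) n : ccont g -> (forall t, normc (g t) <= B) ->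
  cintegrable (uitv n) g.
Proof.
(* On the cell |t| <= |n| + 1, so [C / (1 + t ^+ 2)] is at least [B] there. *)
move=> cg gB; set C := B * (1 + (`|n%:~R| + 1) ^+ 2) : R.
apply: (cintegrable_le (measurable_uitv n) cg (G := fun t => C / (1 + t ^+ 2))).
  apply: integrableS (integrable_decay C) => //; exact: measurable_uitv.
move=> t; rewrite /uitv /= in_itv /= => /andP[h1 h2].
have B0 : 0 <= B by apply: le_trans (gB 0); exact: normc_ge0.
apply: (le_trans (gB t)); rewrite ler_pdivlMr; last by rewrite ltr_pwDl// sqr_ge0.
rewrite /C ler_wpM2l// lerD2l -ler_sqrt ?sqr_ge0// !sqrtr_sqr.
rewrite [leRHS]ger0_norm ?addr_ge0//.
have : `|t - n%:~R| <= 1 by rewrite ler_norml; apply/andP; split; lra.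
by move=> h; rewrite -[t in leLHS](subrK n%:~R) (le_trans (ler_normD _ _))// addrC lerD2l.
Qed.

Lemma cint_uitv_char (n l : int) :
  cint (uitv n) (fun t : R => epii (2 * l%:~R * t%:C)) = (l == 0)%:R.
Proof.
have ci := cintegrable_uitv n (ccont_char l) (normc_char_le l).
have ab : n%:~R - 2^-1 < n%:~R + 2^-1 :> R by lra.
have -> : cint (uitv n) (fun t : R => epii (2 * l%:~R * t%:C)) =
    cint `[n%:~R - 2^-1, n%:~R + 2^-1] (fun t : R => epii (2 * l%:~R * t%:C)).
  by case: ci => i1 i2; rewrite /cint /uitv !Rintegral_itv_bndo_bndc.
have [->|l0] := eqVneq l 0.
  rewrite (@cint_FTC _ (fun t => t%:C))//.
  - by rewrite -realCN -realCD (_ : _ + _ = 1 :> R)//; field.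
  - exact: ccont_char.
  - by move=> t; rewrite mulr0 mul0r epii0; exact: cderive_real.
have c0 : pi%:C * 'i * (2 * l%:~R) != 0 :> R[i].
  rewrite !mulf_neq0//; last by rewrite intr_eq0.
    by rewrite real_complex_eq0 gt_eqF// pi_gt0.
  by rewrite -normc_gt0 normc_i ltr01.
rewrite (@cint_FTC _ (fun t => (pi%:C * 'i * (2 * l%:~R))^-1 * epii (2 * l%:~R * t%:C)))//.
- rewrite -mulrBr (_ : epii (2 * l%:~R * (n%:~R + 2^-1)%:C) =
     epii (2 * l%:~R * (n%:~R - 2^-1)%:C)) ?subrr ?mulr0//.
  rewrite (_ : 2 * l%:~R * (n%:~R + 2^-1)%:C = 2 * l%:~R * (n%:~R - 2^-1)%:C + 2 * l%:~R :> R[i]).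
    by rewrite epiiD epii_even mulr1.
  by rewrite !realCD realCN realCV -natrC; field.
- exact: ccont_char.
- move=> t; apply: (cderive_eq (cderiveZ _ (cderive_char l t))).
  by rewrite mulrCA mulVf// mulr1.
Qed.

Lemma ccont_sum n (g : 'I_n -> R -> R[i]) : (forall i, ccont (g i)) ->
  ccont (fun t => \sum_(i < n) g i t).
Proof.
elim: n g => [|n IH] g cg.
  by under eq_fun do rewrite big_ord0; exact: ccont_cst.
under eq_fun do rewrite big_ord_recr /=.
by apply: ccontD => //; apply: IH.
Qed.

Lemma ccont_fejer M : ccont (fun t => (fejer M t)%:C).
Proof.
under eq_fun do rewrite fejerE.
apply: ccontM; first exact: ccont_cst.
by apply: ccont_sum => i; apply: ccont_sum => j; exact: ccont_char.
Qed.

Lemma cint_sum n (D : set (measurableTypeR R)) (g : 'I_n -> R -> R[i]) : measurable D ->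
  (forall i, cintegrable D (g i)) ->
  cintegrable D (fun t => \sum_(i < n) g i t) /\
  cint D (fun t => \sum_(i < n) g i t) = \sum_(i < n) cint D (g i).
Proof.
move=> mD; elim: n g => [|n IH] g ig.
  split.
    by split; under eq_fun do rewrite big_ord0 /=; exact: integrable0.
  rewrite big_ord0; under eq_cint do rewrite big_ord0.
  by rewrite /cint /= Rintegral_cst// mul0r.
have [i1 e1] := IH (fun i => g (widen_ord (leqnSn n) i)) (fun i => ig _).
split.
  by under eq_fun do rewrite big_ord_recr; exact: cintegrableD.
by under eq_cint do rewrite big_ord_recr; rewrite cintD// e1 big_ord_recr.
Qed.

Lemma cint_uitv_fejer M n : (0 < M)%N -> cint (uitv n) (fun t : R => (fejer M t)%:C) = 1.
Proof.
move=> M0; have mn := @measurable_uitv R n.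
have ic l := cintegrable_uitv n (ccont_char l) (normc_char_le l).
under eq_cint do rewrite fejerE.
have i2 (i : 'I_M) := cint_sum mn (fun j : 'I_M => ic ((i : nat)%:Z - (j : nat)%:Z)).
have [i1 e1] := cint_sum mn (fun i : 'I_M => (i2 i).1).
rewrite cintZ// e1.
under eq_bigr => i _.
  rewrite (i2 i).2.
  under eq_bigr do rewrite cint_uitv_char subr_eq0.
  rewrite (bigD1 i)//= eqxx big1 ?addr0; last first.
    by move=> j ji; rewrite eqz_nat eq_sym -val_eqE/= in ji *; rewrite (negbTE ji).
  over.
by rewrite sumr_const card_ord mulVf// pnatr_eq0 -lt0n.
Qed.

Lemma uitv_le_sin (n : int) (t : R) : uitv n t -> `|t - n%:~R| <= 2 * `|sin (pi * t)|.
Proof.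
rewrite /uitv /= in_itv /= => /andP[h1 h2].
have -> : `|sin (pi * t)| = sin (pi * `|t - n%:~R|).
  (* Periodicity of |sin(pi x)| is read off |e^{2 pi i x} - 1|, which does not see the integer
     [n]. *)
  have E x : `|sin (pi * (x - n%:~R))| = `|sin (pi * x)| :> R.
    have := normc_epii_sub1 (x - n%:~R); have := normc_epii_sub1 x.
    rewrite (_ : 2 * (x - n%:~R)%:C = 2 * x%:C + 2 * (- n)%:~R); last first.
      by rewrite realCD realCN -intrC intrN; ring.
    rewrite epiiD epii_even mulr1 => -> h.
    have {}h : sin (pi * x) ^+ 2 = sin (pi * (x - n%:~R)) ^+ 2 by lra.
    by rewrite -!sqrtr_sqr h.
  rewrite -E; set u := t - n%:~R in h1 h2 *.
  have u1 : `|u| <= 2^-1 by rewrite ler_norml /u; apply/andP; split; lra.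
  have [u0|u0] := leP 0 u.
    rewrite (ger0_norm u0) ger0_norm// sin_ge0_pi// mulr_ge0 ?pi_ge0//=.
    by rewrite ger0_norm// in u1; rewrite ler_piMr ?pi_ge0//; lra.
  rewrite -(normrN (sin _)) -sinN -mulrN -(ltr0_norm u0).
  rewrite (@ger0_norm _ (sin _))// sin_ge0_pi// mulr_ge0 ?pi_ge0//=.
  by rewrite ler_piMr ?pi_ge0//; lra.
have u1 : `|t - n%:~R| <= 2^-1 by rewrite ler_norml; apply/andP; split; lra.
have := @sin_ge_quarter (pi * `|t - n%:~R|).
rewrite mulr_ge0 ?pi_ge0//= ler_wpM2l ?pi_ge0// => /(_ isT).
by have := @pi_ge2 R; have := normr_ge0 (t - n%:~R); nra.
Qed.

End FejerKernel.

(** * Majorants for sums over the integers *)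

Section IntegerSums.
Variable R : realType.
Local Notation esumT f := (\esum_(t in [set: _]) (f t)%:E)%E.

Lemma esum_nat_le (u : nat -> R) (B : R) : (forall n, 0 <= u n) ->
  (forall n, \sum_(i < n) u i <= B) -> (esumT u <= B%:E)%E.
Proof.
move=> u0 uB; rewrite -nneseries_esumT//.
apply: lime_le; first by apply: is_cvg_nneseries => n _ _; rewrite lee_fin.
by apply: nearW => n; rewrite big_mkord sumEFin lee_fin.
Qed.

Lemma esum_inv_oneDsqr : (\esum_(j in [set: nat]) ((1 + (j%:R : R) ^+ 2)^-1)%:E <= 3%:E)%E.
Proof.
apply: esum_nat_le => [n|n]; first by rewrite invr_ge0 addr_ge0// sqr_ge0.
(* Telescoping majorant: the increment 3/(n+1) - 3/(n+2) is 3/((n+1)(n+2)). *)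
suff : \sum_(i < n) (1 + (i%:R : R) ^+ 2)^-1 <= 3 - 3 / n.+1%:R.
  by move=> /le_trans; apply; rewrite gerBl divr_ge0.
elim: n => [|n IH]; first by rewrite big_ord0 divr1 subrr.
rewrite big_ord_recr /=; apply: le_trans (lerD IH (lexx _)) _.
suff : (1 + n%:R ^+ 2)^-1 <= 3 / n.+1%:R - 3 / n.+2%:R :> R.
  by move: (_ ^-1) (3 / n.+1%:R) (3 / n.+2%:R) => b a c; lra.
(* The inequality (x+1)(x+2) <= 3(1+x^2) amounts to (2x-1)(x-1) >= 0. It fails for 1/2 < x < 1, so
   it matters that x is a natural number. *)
have x0 := ler0n R n; have x01 : n%:R = 0 :> R \/ 1 <= n%:R :> R.
  by case: (n) => [|k]; [left|right; rewrite ler1n].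
rewrite -[n.+2%:R]natr1 -[n.+1%:R]natr1; move: (n%:R : R) x0 x01 => {IH} x x0 x01.
have -> : 3 / (x + 1) - 3 / (x + 1 + 1) = 3 / ((x + 1) * (x + 2)).
  by field; rewrite !gt_eqF//; lra.
rewrite ler_pdivlMr ?mulr_gt0//; [|lra..].
rewrite ler_pdivrMl ?ltr_pwDl ?sqr_ge0//.
by case: x01 => [->|x1]; [rewrite expr2 mulr0; lra|nra].
Qed.

Definition int_of_pair (p : bool * nat) : int := if p.1 then Posz p.2 else Negz p.2.
Lemma int_of_pair_bij : bijective int_of_pair.
Proof.
exists (fun z => match z with Posz n => (true, n) | Negz n => (false, n) end).
  by case=> -[] n.
by case.
Qed.

(** Reindexing replaces [t] by its fractional part u. Then |u + j| >= j and |u - (j+1)| >= j for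
    natural j, so each half of the integers contributes at most [B]. *)
Lemma esum_int_shift_le (g : R -> R) (B : R) : (forall x, 0 <= g x) ->
  (forall x y, `|x| <= `|y| -> g y <= g x) ->
  (\esum_(j in [set: nat]) (g j%:R)%:E <= B%:E)%E ->
  forall t, (\esum_(n in [set: int]) (g (t + n%:~R))%:E <= (2 * B)%:E)%E.
Proof.
move=> g0 gm gB t.
pose u := t - (Num.floor t)%:~R.
have /andP[u0 u1] : 0 <= u < 1.
  by have := floor_itv t; rewrite intrD /u => /andP[h1 h2]; apply/andP; split; lra.
have be : bijective (fun n : int => n - Num.floor t).
  by exists (fun n => n + Num.floor t) => n; rewrite ?subrK ?addrK.
rewrite (esum_bij _ be).
under eq_esum => n _.
  rewrite (_ : t + (n - Num.floor t)%:~R = u + n%:~R); last by rewrite intrB /u; ring.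
  over.
rewrite (esum_bij _ int_of_pair_bij).
apply: (@le_trans _ _ (\esum_(b in [set: bool]) B%:E)%E).
  apply: (esum_pair_le (f := fun p => g (u + (int_of_pair p)%:~R))) => [p//|b].
  apply: le_trans gB; apply: le_esum => j _; rewrite lee_fin; apply: gm.
  rewrite ger0_norm//; case: b; rewrite /int_of_pair /fst /snd.
    by rewrite -pmulrn; apply: le_trans (ler_norm _); rewrite lerDr.
  rewrite NegzE intrN -pmulrn -normrN opprD opprK; apply: le_trans (ler_norm _).
  by rewrite -natr1; lra.
have B0 : 0 <= B.
  by rewrite -lee_fin; apply: le_trans gB; apply: esum_ge0 => j _; rewrite lee_fin.
by rewrite esum_fin// big_bool /= lee_fin; lra.
Qed.

Lemma esum_int_inv_oneDsqr (t : R) :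
  (\esum_(n in [set: int]) ((1 + (t + n%:~R) ^+ 2)^-1)%:E <= 6%:E)%E.
Proof.
have -> : 6 = 2 * 3 :> R by lra.
apply: (esum_int_shift_le (g := fun x => (1 + x ^+ 2)^-1)).
- by move=> x; rewrite invr_ge0 addr_ge0// sqr_ge0.
- move=> x y xy; rewrite lef_pV2 ?posrE ?ltr_pwDl ?sqr_ge0// lerD2l.
  by rewrite -(real_normK (num_real x)) -(real_normK (num_real y)) ler_sqr ?nnegrE.
- exact: esum_inv_oneDsqr.
Qed.

End IntegerSums.

(** * Poisson summation by Fejér averaging *)

Section Poisson.
Variable R : realType.
Notation mu := (@lebesgue_measure R).
Local Notation csm f := (csummable [set: _] f).
Local Notation csumT f := (csum [set: _] f).

Definition fourier (f : R -> R[i]) (l : int) : R[i] :=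
  cintegral (fun t => f t * epii (2 * (- l)%:~R * t%:C)).

Lemma normc_le_inv_eq0 (x : R[i]) (C : R) :
  (forall j : nat, normc x <= C / j.+1%:R) -> x = 0.
Proof.
move=> H; apply/eqP; rewrite -normc_eq0; apply/eqP/le_anti.
rewrite normc_ge0 andbT; apply/ler_addgt0Pl => e e0; rewrite addr0.
pose j := Num.bound (C / e).
apply: (le_trans (H j)); rewrite ler_pdivrMr// mulrC -ler_pdivrMr//.
have [C0|C0] := leP 0 (C / e); last by apply: ltW; apply: lt_le_trans C0 _.
by rewrite ltW// (lt_le_trans (Num.Theory.archi_boundP C0))// ler_nat.
Qed.

Lemma diff_le (p dp : R -> R) (K n t : R) : (forall x : R, is_derive x 1 p (dp x)) ->
  (forall x, `|x - n| <= 1 -> `|dp x| <= K) -> `|t - n| <= 1 ->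
  `|p t - p n| <= K * `|t - n|.
Proof.
move=> dp1 dpK tn.
have cp (a b : R) : {within `[a, b], continuous p}.
  apply: continuous_subspaceT => x; apply/differentiable_continuous/derivable1_diffP.
  by have [] := dp1 x.
have [tn1|tn1|->] := ltgtP t n; last by rewrite !subrr normr0 mulr0.
  have [c] := @MVT _ p dp t n tn1 (fun x _ => dp1 x) (cp t n).
  rewrite in_itv /= => /andP[c1 c2] E; rewrite distrC E normrM [`|n - t|]distrC.
  by rewrite ler_wpM2r// dpK// ler_norml; move: tn; rewrite ler_norml => /andP[h1 h2]; apply/andP; split; lra.
have [c] := @MVT _ p dp n t tn1 (fun x _ => dp1 x) (cp n t).
rewrite in_itv /= => /andP[c1 c2] E; rewrite E normrM.
by rewrite ler_wpM2r// dpK// ler_norml; move: tn; rewrite ler_norml => /andP[h1 h2]; apply/andP; split; lra.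
Qed.

(** Expand (1 - J s)^2 F >= 0. With J^2 the order of the kernel, the hypothesis is [fejer_sin]; as F
    + 1 has integral 2 over a cell, |sin| F has integral O(1/J) without cutting the cell near its
    centre. *)
Lemma fejer_amgm (s F J : R) : 0 <= F -> J ^+ 2 * (s ^+ 2 * F) <= 1 ->
  J * (2 * s * F) <= F + 1.
Proof.
move=> F0 h1; have h2 : 0 <= (1 - J * s) ^+ 2 * F by rewrite mulr_ge0 ?sqr_ge0.
by nra.
Qed.

Section Hypotheses.
Variables (f df : R -> R[i]) (M : R).
Hypothesis f_der : forall t, cderive f t (df t).
Hypothesis f_dec : decays M f.
Hypothesis df_dec : decays M df.

Let M0 : 0 <= M.
Proof.
by have := f_dec 0; rewrite expr0n addr0 divr1; apply: le_trans; exact: normc_ge0.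
Qed.

Let cf : ccont f. Proof. exact: cderive_ccont f_der. Qed.

(** Lipschitz constant of [f] about [n] on the cell: a factor 3 from [oneDsqr_shift], a factor 2
    from treating real and imaginary parts separately. *)
Let K (n : int) : R := 6 * M / (1 + n%:~R ^+ 2).

Let K0 n : 0 <= K n.
Proof. by rewrite /K divr_ge0 ?mulr_ge0// addr_ge0// sqr_ge0. Qed.

Let f_local n t : uitv n t -> normc (f t - f n%:~R) <= K n * `|t - n%:~R|.
Proof.
rewrite /uitv /= in_itv /= => /andP[h1 h2].
have tn : `|t - n%:~R| <= 1 by rewrite ler_norml; apply/andP; split; lra.
have dK x : `|x - n%:~R| <= 1 -> normc (df x) <= 3 * M / (1 + n%:~R ^+ 2).
  move=> xn; apply: (le_trans (df_dec x)); rewrite -(subrKC n%:~R x).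
  rewrite [3 * M]mulrC -mulrA ler_wpM2l//; exact: oneDsqr_shift.
apply: (le_trans (normc_le_ReIm _)); rewrite !ReImE.
have -> : K n = 3 * M / (1 + n%:~R ^+ 2) + 3 * M / (1 + n%:~R ^+ 2) by rewrite /K; lra.
rewrite mulrDl; apply: lerD.
  apply: (diff_le (p := fun t => complex.Re (f t)) (dp := fun t => complex.Re (df t))) => // [x|x xn].
    by have [] := f_der x.
  by apply: le_trans (normc_Re _) (dK _ xn).
apply: (diff_le (p := fun t => complex.Im (f t)) (dp := fun t => complex.Im (df t))) => // [x|x xn].
  by have [] := f_der x.
by apply: le_trans (normc_Im _) (dK _ xn).
Qed.

Let fF_dec N : decays (M * N%:R) (fun t => f t * (fejer N t)%:C).
Proof.
move=> t; rewrite Normc.normcM normc_real ger0_norm ?fejer_ge0//.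
rewrite mulrAC ler_pM ?normc_ge0 ?fejer_ge0 ?fejer_le//; exact: f_dec.
Qed.

Let fF_int N : cintegrable setT (fun t => f t * (fejer N t)%:C).
Proof.
apply: cintegrable_decay (fF_dec N); apply: ccontM => //; exact: ccont_fejer.
Qed.

(** The kernel has mass 1 on the cell, so the difference is the integral of (f(t) - f(n)) F_N(t),
    bounded through |t - n| <= 2 |sin(pi t)| and [fejer_amgm] with J = j + 1. The constant 4 is the
    integral 2 of F_N + 1 times the 2 of [cint_normc_le]. *)
Let cell j n (N : nat) : N = (j.+1 ^ 2)%N ->
  normc (cint (uitv n) (fun t => f t * (fejer N t)%:C) - f n%:~R) <= 4 * K n / j.+1%:R.
Proof.
move=> NE; have N0 : (0 < N)%N by rewrite NE expn_gt0.
have mn := @measurable_uitv R n.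
have fej_le1 (t : R) : normc ((fejer N t)%:C) <= N%:R.
  by rewrite normc_real ger0_norm ?fejer_ge0// fejer_le.
have iF := cintegrable_uitv n (@ccont_fejer R N) fej_le1.
have ifF : cintegrable (uitv n) (fun t => f t * (fejer N t)%:C).
  by have [i1 i2] := fF_int N; split; [apply: integrableS i1|apply: integrableS i2].
have -> : cint (uitv n) (fun t => f t * (fejer N t)%:C) - f n%:~R =
   cint (uitv n) (fun t => (f t - f n%:~R) * (fejer N t)%:C).
  under [RHS]eq_cint do rewrite mulrBl -mulNr.
  by rewrite cintD// ?cintZ// ?cint_uitv_fejer// ?mulr1//; exact: cintegrableZ.
pose G t := K n / j.+1%:R * (fejer N t + 1).
have intF : mu.-integrable (uitv n) (EFin \o (fejer N)) by case: iF.
have int1 : mu.-integrable (uitv n) (EFin \o (fun=> 1 : R)).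
  have n1 (t : R) : normc (1 : R[i]) <= 1 by rewrite Normc.normc1.
  by have [] := cintegrable_uitv n (@ccont_cst R 1) n1.
have iFS : mu.-integrable (uitv n) (EFin \o (fun t => fejer N t + 1)).
  by apply: (eq_integrable mn _ _ _ (integrableD mn intF int1)).
have iG : mu.-integrable (uitv n) (EFin \o G) by exact: (integrableZl mn _ iFS).
have EG : (\int[mu]_(t in uitv n) G t)%R = 2 * K n / j.+1%:R.
  rewrite /G RintegralZl// RintegralD//.
  have -> : (\int[mu]_(t in uitv n) fejer N t)%R = 1.
    by have := @cint_uitv_fejer R N n N0 => /(congr1 (@complex.Re R)).
  have -> : (\int[mu]_(_ in uitv n) 1)%R =
      complex.Re (cint (uitv n) (fun t : R => epii (2 * 0%:~R * t%:C))).
    by rewrite /cint Re_cplx; apply: eq_Rintegral => t _; rewrite mulr0 mul0r epii0.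
  rewrite cint_uitv_char eqxx -[complex.Re _]/1.
  by ring.
have -> : 4 * K n / j.+1%:R = 2 * (2 * K n / j.+1%:R) by ring.
rewrite -EG; apply: cint_normc_le => //.
- under eq_fun do rewrite mulrBl -mulNr.
  by apply: cintegrableD => //; exact: cintegrableZ.
- move=> t tn; rewrite Normc.normcM normc_real ger0_norm ?fejer_ge0//.
  apply: (le_trans (ler_wpM2r (fejer_ge0 _ _) (f_local tn))).
  apply: (@le_trans _ _ (K n * (j.+1%:R^-1 * (fejer N t + 1)))); last by rewrite /G mulrA.
  rewrite -(mulrA (K n)); apply: ler_wpM2l; first exact: K0.
  rewrite ler_pdivlMl//.
  apply: (le_trans (ler_wpM2l _ (ler_wpM2r (fejer_ge0 _ _) (uitv_le_sin tn)))) => //.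
  have := fejer_sin t N0; have := fejer_ge0 N t.
  rewrite NE natrX -NE.
  have -> : sin (pi * t) ^+ 2 = `|sin (pi * t)| ^+ 2 by rewrite real_normK ?num_real.
  set s := `|_|; set F := fejer _ _; set J := j.+1%:R => F0 sF.
  have J0 : 0 < J by rewrite /J.
  have {}sF : J ^+ 2 * (s ^+ 2 * F) <= 1.
    by rewrite -(mulfV (_ : J ^+ 2 != 0)) ?ler_wpM2l ?sqr_ge0// expf_neq0 ?gt_eqF.
  exact: fejer_amgm.
Qed.

Let Ksum (B : R) : (0 <= B) -> (\esum_(n in [set: int]) (B * K n)%:E <= (B * (36 * M))%:E)%E.
Proof.
move=> B0.
have E n : (B * K n)%:E = ((B * (6 * M))%:E * ((1 + (0 + n%:~R) ^+ 2)^-1)%:E)%E.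
  by rewrite -EFinM /K add0r -!mulrA.
under eq_esum do rewrite E.
rewrite esumZ ?mulr_ge0//; last by move=> n; rewrite lee_fin invr_ge0 addr_ge0// sqr_ge0.
apply: (le_trans (lee_wpmul2l _ (esum_int_inv_oneDsqr 0))); first by rewrite lee_fin !mulr_ge0.
by rewrite -EFinM lee_fin; lra.
Qed.

Let f_summable : csm (fun n : int => f n%:~R).
Proof.
apply: (csummable_le (g := fun n : int => 1 * K n)).
  move=> n; rewrite mul1r; apply: (le_trans (f_dec _)); rewrite /K ler_wpM2r//.
    by rewrite invr_ge0 addr_ge0// sqr_ge0.
  by rewrite ler_peMl// ler1n.
by apply: le_lt_trans (Ksum ler01) _; rewrite ltry.
Qed.

Let step2 j N : N = (j.+1 ^ 2)%N ->
  normc (cintegral (fun t => f t * (fejer N t)%:C) - csumT (fun n : int => f n%:~R))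
   <= (288 * M) / j.+1%:R.
Proof.
move=> NE; have [s1 ->] := cintegral_uitv (fF_int N).
rewrite -csumN -csumD//; last first.
  by apply: csummable_norm_le f_summable => n; rewrite normcN.
have -> : 288 * M / j.+1%:R = 2 * (4 / j.+1%:R * (36 * M)) by ring.
apply: (csum_normc_bound (g := fun n => 4 / j.+1%:R * K n)).
  by move=> n; apply: (le_trans (cell n NE)); rewrite mulrAC.
by apply: Ksum; rewrite divr_ge0.
Qed.

Let fc_int l : cintegrable setT (fun t => f t * epii (2 * l%:~R * t%:C)).
Proof.
apply: (@cintegrable_decay _ M); first by apply: ccontM => //; exact: ccont_char.
by move=> t; rewrite Normc.normcM normc_char mulr1; exact: f_dec.
Qed.

(** Expanding the kernel into characters exhibits the averaged integral as a Cesàro mean of Fourier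
    coefficients. *)
Let step3 N : cintegral (fun t => f t * (fejer N t)%:C) =
  N%:R^-1 * \sum_(i < N) \sum_(j < N) fourier f ((j : nat)%:Z - (i : nat)%:Z).
Proof.
have E t : f t * (fejer N t)%:C = N%:R^-1 * \sum_(i < N) \sum_(j < N)
    (f t * epii (2 * ((i : nat)%:Z - (j : nat)%:Z)%:~R * t%:C)).
  rewrite fejerE mulrCA; congr (_ * _); rewrite mulr_sumr.
  by apply: eq_bigr => i _; rewrite mulr_sumr.
under eq_fun do rewrite E.
have i2 (i : 'I_N) := cint_sum (@measurableT _ (measurableTypeR R))
  (fun j : 'I_N => fc_int ((i : nat)%:Z - (j : nat)%:Z)).
have [i1 e1] := cint_sum (@measurableT _ (measurableTypeR R)) (fun i : 'I_N => (i2 i).1).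
rewrite cintegralZ// cintegralE e1; congr (_ * _); apply: eq_bigr => i _.
rewrite (i2 i).2; apply: eq_bigr => j _.
by rewrite /fourier cintegralE opprB.
Qed.

Hypothesis fh_summable : csm (fun l : int => (1 + `|l|%:~R) * fourier f l).

Lemma fourier_summable : csm (fourier f).
Proof.
apply: csummable_norm_le fh_summable => l; rewrite Normc.normcM.
rewrite ler_peMl ?normc_ge0// intrC -realCD normc_real ger0_norm ?addr_ge0 ?ler0z//.
by rewrite lerDl ler0z.
Qed.

(** Of the N values of i, at most |l| have no partner j = l + i in range. This counts how often the
    coefficient of index l is missing from the double sum. *)
Let card_out (N : nat) (l : int) :
  (\sum_(i < N) (~~ (0 <= l + (i : nat)%:Z < N%:Z)%R) <= `|l|)%N.
Proof.
case: l => l.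
  rewrite absz_nat (reindex_inj rev_ord_inj) /=.
  apply: (@leq_trans (\sum_(i < N) (i < l))%N).
    by apply: leq_sum => i _; have := ltn_ord i; lia.
  elim: N => [|N IH]; first by rewrite big_ord0.
  rewrite big_ord_recr /=; case: (ltnP N l) => h; last by rewrite addn0.
  rewrite addn1; apply: leq_ltn_trans h.
  by rewrite (leq_trans (leq_sum _ (fun i _ => leq_b1 _)))// sum_nat_const card_ord muln1.
apply: (@leq_trans (\sum_(i < N) (i < l.+1))%N).
  by apply: leq_sum => i _; have := ltn_ord i; lia.
rewrite NegzE abszN absz_nat.
elim: N => [|N IH]; first by rewrite big_ord0.
rewrite big_ord_recr /=; case: (ltnP N l.+1) => h; last by rewrite addn0.
rewrite addn1; apply: leq_ltn_trans h.
by rewrite (leq_trans (leq_sum _ (fun i _ => leq_b1 _)))// sum_nat_const card_ord muln1.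
Qed.

Let A := fine (\esum_(l in [set: int]) (normc ((1 + `|l|%:~R) * fourier f l))%:E)%E.

(** The Cesàro mean differs from the full sum by N^-1 times missing coefficients, the l-th missing
    at most |l| times; hence the hypothesis with weight 1 + |l|. *)
Let step4 N : (0 < N)%N ->
  normc (N%:R^-1 * \sum_(i < N) \sum_(j < N) fourier f ((j : nat)%:Z - (i : nat)%:Z)
    - csumT (fourier f)) <= (2 * A) / N%:R.
Proof.
move=> N0; set a := fourier f; have sa := fourier_summable.
pose b (i : 'I_N) (l : int) := if (0 <= l + (i : nat)%:Z < N%:Z)%R then 0 else a l.
have sb i : csm (b i).
  by apply: csummable_norm_le sa => l; rewrite /b; case: ifP => // _; rewrite Normc.normc0 normc_ge0.
have E (i : 'I_N) : \sum_(j < N) a ((j : nat)%:Z - (i : nat)%:Z) = csumT a - csumT (b i).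
  (* For fixed i the differences j - i run exactly over [D]; the rest of the full sum is [b i]. *)
  pose D := [set l : int | (0 <= l + (i : nat)%:Z < N%:Z)%R].
  have -> : csumT a - csumT (b i) = csum D a.
    rewrite -csumN -csumD//; last by apply: csummable_norm_le (sb i) => l; rewrite normcN.
    rewrite [RHS]csum_mkcond; congr csum; apply/funext => l; rewrite /b.
    by have [/set_mem ->|nD] := boolP (l \in D); rewrite ?oppr0 ?addr0// ifF ?subrr//;
      apply/negbTE; move: nD; rewrite notin_setE /D /= => /negP.
  rewrite -csum_fin (@csum_reindex _ _ _ setT D (fun j : 'I_N => (j : nat)%:Z - (i : nat)%:Z))//.
  have surj (l : int) : (0 <= l + (i : nat)%:Z < N%:Z)%R ->
      exists j : 'I_N, (j : nat)%:Z - (i : nat)%:Z = l.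
    move=> /andP[l0 lN]; have lt : (absz (l + (i : nat)%:Z)%R < N)%N by lia.
    by exists (Ordinal lt) => /=; lia.
  split=> [j _|j1 j2 _ _ H|l /surj [j jl]].
  - by rewrite /D /= subrK; have := ltn_ord j; lia.
  - by apply: val_inj => /=; lia.
  - by exists j.
under eq_bigr do rewrite E.
rewrite sumrB sumr_const card_ord.
have -> : N%:R^-1 * (csumT a *+ N - \sum_(i < N) csumT (b i)) - csumT a =
    - (N%:R^-1 * \sum_(i < N) csumT (b i)).
  by rewrite -mulr_natr; field; rewrite pnatr_eq0 -lt0n.
rewrite normcN Normc.normcM Normc.normcV natrC normc_real ger0_norm// mulrC ler_wpM2r ?invr_ge0//.
have spb : csm (fun p : 'I_N * int => b p.1 p.2).
  apply: (csummable_norm_le _ (csummable_mul (csummable_fin (fun _ : 'I_N => 1 : R[i])) sa)) => -[i l].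
  by rewrite /fst /snd mul1r /b; case: ifP => // _; rewrite Normc.normc0 normc_ge0.
rewrite -csum_fin (csum_exchange spb).
apply: (csum_normc_bound (g := fun l => normc ((1 + `|l|%:~R) * a l))); last first.
  rewrite /A -esum_fine// => [l|]; first exact: normc_ge0.
  exact: (csummableE _ _).1 fh_summable.
move=> l; rewrite csum_fin; apply: (le_trans (normc_sum _ _)).
apply: (@le_trans _ _ (\sum_(i < N) normc (a l) * (~~ (0 <= l + (i : nat)%:Z < N%:Z)%R)%:R)).
  by apply: ler_sum => i _; rewrite /fst /snd /b; case: ifP => _;
    rewrite ?Normc.normc0 ?mulr_ge0 ?normc_ge0 ?ler_peMr ?normc_ge0 ?ler1n.
rewrite -mulr_sumr -natr_sum Normc.normcM mulrC ler_wpM2r ?normc_ge0//.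
rewrite intrC -realCD normc_real ger0_norm ?addr_ge0 ?ler0z//.
apply: (@le_trans _ _ (`|l|%N%:R)); first by rewrite ler_nat card_out.
by rewrite pmulrn abszE lerDr.
Qed.

(** Both sums lie within a constant over j + 1 of the integral against the kernel of order (j+1)^2,
    for every j. Here 288 = 2 * 4 * 36, from [csum_normc_bound], [cell] and [Ksum]. *)
Theorem poisson_summation :
  [/\ csm (fun n : int => f n%:~R), csm (fourier f) &
  csumT (fun n : int => f n%:~R) = csumT (fourier f)].
Proof.
split; [exact: f_summable|exact: fourier_summable|].
apply/eqP; rewrite -subr_eq0; apply/eqP.
have A0 : 0 <= A by apply/fine_ge0/esum_ge0 => l _; rewrite lee_fin normc_ge0.
apply: (@normc_le_inv_eq0 _ (288 * M + 2 * A)) => j.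
have N0 : (0 < j.+1 ^ 2)%N by rewrite expn_gt0.
have h2 := step2 (erefl (j.+1 ^ 2)%N); have h4 := step4 N0.
rewrite step3 in h2; set X := _^-1 * _ in h2 h4.
rewrite (_ : _ - _ = (X - csumT (fourier f)) - (X - csumT (fun n : int => f n%:~R))); last by ring.
apply: (le_trans (normcB _ _)); rewrite addrC mulrDl lerD//.
apply: (le_trans h4); rewrite ler_wpM2l ?mulr_ge0// lef_pV2 ?posrE ?ltr0n//.
by rewrite ler_nat expnS expn1 leq_pmulr.
Qed.

End Hypotheses.
End Poisson.

(** * Gaussian integrals *)

Section Holomorphy.
Variable R : realType.
Implicit Types (U : set R[i]) (F G dF dG : R[i] -> R[i]).

Lemma hol_id U : hol U id (fun=> 1).
Proof.
move=> tau v x _; rewrite mul1r.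
have := cderiveD (cderive_cst tau x) (cderiveM (cderive_real x) (cderive_cst v x)).
by move=> /cderive_eq; apply; rewrite mulr0 mul1r addr0 add0r.
Qed.

Lemma hol_cst U c : hol U (fun=> c) (fun=> 0).
Proof. by move=> tau v x _; rewrite mul0r; exact: cderive_cst. Qed.

Lemma holM U F dF G dG : hol U F dF -> hol U G dG ->
  hol U (fun z => F z * G z) (fun z => dF z * G z + F z * dG z).
Proof.
move=> hF hG tau v x Ux.
apply: (cderive_eq (cderiveM (hF tau v x Ux) (hG tau v x Ux))); ring.
Qed.

Lemma holD U F dF G dG : hol U F dF -> hol U G dG ->
  hol U (fun z => F z + G z) (fun z => dF z + dG z).
Proof.
move=> hF hG tau v x Ux.
apply: (cderive_eq (cderiveD (hF tau v x Ux) (hG tau v x Ux))); ring.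
Qed.

Lemma holZ U F dF c : hol U F dF -> hol U (fun z => c * F z) (fun z => c * dF z).
Proof.
move=> hF tau v x Ux.
by apply: (cderive_eq (cderiveZ c (hF tau v x Ux))); rewrite mulrA.
Qed.

Lemma holX U F dF n : hol U F dF ->
  hol U (fun z => F z ^+ n) (fun z => n%:R * F z ^+ n.-1 * dF z).
Proof.
move=> hF tau v x Ux.
by apply: (cderive_eq (cderiveX n (hF tau v x Ux))); rewrite mulrA.
Qed.

Lemma hol_epii U F dF : hol U F dF ->
  hol U (fun z => epii (F z)) (fun z => epii (F z) * (pi%:C * 'i * dF z)).
Proof.
move=> hF tau v x Ux.
by apply: (cderive_eq (cderive_epii (hF tau v x Ux))); rewrite !mulrA.
Qed.

Lemma holV U F dF : (forall z, U z -> F z != 0) -> hol U F dF ->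
  hol U (fun z => (F z)^-1) (fun z => - (dF z / F z ^+ 2)).
Proof.
move=> F0 hF tau v x Ux.
by apply: (cderive_eq (cderiveV (F0 _ Ux) (hF tau v x Ux))); rewrite mulNr mulrAC.
Qed.

Lemma hol_eq U F dF G dG : hol U F dF -> (forall z, F z = G z) ->
  (forall z, U z -> dF z = dG z) -> hol U G dG.
Proof.
move=> hF /funext <- dFG tau v x Ux; rewrite -dFG//; exact: hF.
Qed.

Lemma hol_sub U V F dF : V `<=` U -> hol U F dF -> hol V F dF.
Proof. by move=> VU hF tau v x /VU; exact: hF. Qed.

End Holomorphy.

(** * One-variable Gaussian integrals and their dependence on tau *)

Section Gaussian.
Variable R : realType.
Notation mu := (@lebesgue_measure R).
Implicit Types (b z w tau : R[i]).

(** Distribute the exponential over the n factors: with d = c/n, each (1 + x^2) e^{-d x^2} is at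
    most (1 + x^2)/(1 + d x^2) <= 1 + 1/d. *)
Lemma poly_gauss_le (c : R) (n : nat) : 0 < c ->
  exists2 K : R, 0 <= K & forall x : R, (1 + x ^+ 2) ^+ n * expR (- (c * x ^+ 2)) <= K.
Proof.
move=> c0; case: n => [|n].
  exists 1 => // x; rewrite expr0 mul1r -expR0 ler_expR oppr_le0 mulr_ge0 ?sqr_ge0//.
  exact: ltW.
pose d := c / n.+1%:R; have d0 : 0 < d by rewrite divr_gt0.
exists ((1 + d^-1) ^+ n.+1); first by rewrite exprn_ge0// addr_ge0// invr_ge0 ltW.
move=> x; have -> : - (c * x ^+ 2) = (- (d * x ^+ 2)) * n.+1%:R.
  by rewrite /d; field; rewrite gt_eqF// ltr_pwDr// ler0n.
rewrite expRM_natr -exprMn ler_pXn2r// ?nnegrE ?mulr_ge0 ?addr_ge0 ?sqr_ge0 ?expR_ge0 ?invr_ge0 ?(ltW d0)//.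
rewrite expRN ler_pdivrMr ?expR_gt0//.
have h := expR_ge1Dx (d * x ^+ 2).
apply: (@le_trans _ _ ((1 + d^-1) * (1 + d * x ^+ 2))); last first.
  by rewrite ler_wpM2l// addr_ge0// invr_ge0 ltW.
rewrite [leRHS](_ : _ = 1 + d^-1 + d * x ^+ 2 + x ^+ 2); last by field; rewrite gt_eqF.
have := sqr_ge0 x; have : 0 <= d^-1 by rewrite invr_ge0 ltW.
have : 0 <= d * x ^+ 2 by rewrite mulr_ge0 ?sqr_ge0 ?ltW.
lra.
Qed.

(** Decays along the real line exactly when Im b < 0, which holds for b = sigma/tau with sigma > 0
    and tau in the upper half plane. *)
Definition gauss b z : R[i] := epii (- (b * z ^+ 2)).

Lemma gauss_bound b (Y : R) (n : nat) : complex.Im b < 0 ->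
  exists2 K : R, 0 <= K & forall z, `|complex.Im z| <= Y ->
    (1 + complex.Re z ^+ 2) ^+ n * normc (gauss b z) <= K.
Proof.
move=> b0; pose a := - complex.Im b; have a0 : 0 < a by rewrite oppr_gt0.
pose r := complex.Re b.
have [K K0 HK] := @poly_gauss_le (pi * a / 2) n (divr_gt0 (mulr_gt0 (pi_gt0 R) a0) (ltr0n _ 2)).
(* With b = r - i a and z = x + i y, the exponent is pi (2 r x y - a x^2 + a y^2). Half of a x^2 is
   kept for decay; the other half absorbs the cross term, the slack being (a x - 2 r y)^2/(2a). *)
pose E := expR (pi * ((2 * r ^+ 2 / a + a) * Y ^+ 2)).
exists (K * E); first by rewrite mulr_ge0 ?expR_ge0.
move=> z zY; rewrite /gauss normc_epii.
have E1 : expR (- (pi * complex.Im (- (b * z ^+ 2)))) <=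
   expR (- (pi * a / 2 * complex.Re z ^+ 2)) * E.
  rewrite /E -expRD ler_expR expr2 !ReImE -/r.
  have -> : complex.Im b = - a by rewrite /a opprK.
  set x := complex.Re z; set y := complex.Im z in zY *.
  have yY : y ^+ 2 <= Y ^+ 2.
    have Y0 : 0 <= Y by apply: le_trans zY.
    by rewrite -(real_normK (num_real y)) ler_sqr ?nnegrE.
  have -> : - (pi * a / 2 * x ^+ 2) + pi * ((2 * r ^+ 2 / a + a) * Y ^+ 2) =
     pi * ((2 * r ^+ 2 / a + a) * Y ^+ 2 - a / 2 * x ^+ 2) by field; rewrite gt_eqF.
  rewrite -mulrN ler_wpM2l ?pi_ge0//.
  apply: (@le_trans _ _ ((2 * r ^+ 2 / a + a) * y ^+ 2 - a / 2 * x ^+ 2)); last first.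
    by rewrite lerD2r ler_wpM2l// addr_ge0 ?(ltW a0)// divr_ge0 ?(ltW a0)// mulr_ge0// sqr_ge0.
  rewrite -subr_ge0; set e := (X in 0 <= X).
  have -> : e = (a * x - 2 * r * y) ^+ 2 / (2 * a).
    by rewrite /e; field; rewrite gt_eqF.
  by rewrite divr_ge0 ?sqr_ge0// mulr_ge0// ltW.
apply: (@le_trans _ _ ((1 + complex.Re z ^+ 2) ^+ n * (expR (- (pi * a / 2 * complex.Re z ^+ 2)) * E))).
  by rewrite ler_wpM2l// exprn_ge0// addr_ge0// sqr_ge0.
by rewrite mulrA ler_wpM2r ?expR_ge0.
Qed.

Lemma hol_gauss U b : hol U (gauss b) (fun z => gauss b z * (pi%:C * 'i * (- (b * (2 * z))))).
Proof.
apply: (hol_eq (hol_epii (holZ (- b) (holX 2 (@hol_id R U))))) => z.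
  by rewrite /gauss mulNr.
by move=> _; rewrite /gauss mulNr /= expr1 mulr1 mulNr.
Qed.

(** Equal to (i b)^(-1/2), principal branch. It is kept as an integral; later only its size and its
    logarithmic derivative are used. *)
Definition kappa b : R[i] := cintegral (fun t => gauss b t%:C).

Lemma decaysP (F : R -> R[i]) (K : R) :
  (forall t, (1 + t ^+ 2) * normc (F t) <= K) -> decays K F.
Proof.
by move=> H t; rewrite ler_pdivlMr ?ltr_pwDl ?sqr_ge0// mulrC.
Qed.

Lemma normc_le_oneDsqr z (Y : R) : `|complex.Im z| <= Y ->
  normc z <= (1 + Y) * (1 + complex.Re z ^+ 2).
Proof.
move=> zY; apply: (le_trans (normc_le_ReIm z)).
have Y0 : 0 <= Y by apply: le_trans zY.
have h : `|complex.Re z| <= 1 + complex.Re z ^+ 2.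
  rewrite -(real_normK (num_real (complex.Re z))); have := normr_ge0 (complex.Re z).
  by move: `|_| => x x0; nra.
have h2 := sqr_ge0 (complex.Re z).
rewrite mulrDl mul1r lerD//; apply: (le_trans zY); rewrite ler_peMr//; lra.
Qed.

Lemma ccont_line_hol (F dF : R[i] -> R[i]) y : hol setT F dF -> ccont (line F y).
Proof. by move=> hF; apply: hol_ccont hF _. Qed.

Lemma gauss_line_decay b (Y : R) : complex.Im b < 0 -> exists M : R,
  (forall y : R, - Y < y < Y -> decays M (line (gauss b) y)) /\
  (forall y : R, - Y < y < Y -> decays M (line (fun z => gauss b z * (pi%:C * 'i * (- (b * (2 * z))))) y)).
Proof.
move=> b0; have [K1 K10 H1] := gauss_bound Y 1 b0; have [K2 K20 H2] := gauss_bound Y 2 b0.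
pose c := pi * (normc b * (2 * (1 + Y))).
have yY (y : R) : - Y < y < Y -> `|y| <= Y by move=> /andP[h1 h2]; rewrite ler_norml !ltW.
exists (K1 + c * K2); split => y /yY h; apply: decaysP => t.
  have := H1 (t +i* y) h; rewrite expr1 Re_cplx => /le_trans; apply.
  by rewrite lerDl /c !mulr_ge0 ?pi_ge0 ?normc_ge0// addr_ge0// (le_trans _ h).
have := H2 (t +i* y) h; rewrite Re_cplx => H.
apply: (@le_trans _ _ (c * ((1 + t ^+ 2) ^+ 2 * normc (gauss b (t +i* y))))); last first.
  have : 0 <= c by rewrite /c !mulr_ge0 ?pi_ge0 ?normc_ge0// addr_ge0// (le_trans _ h).
  by nra.
rewrite /line (Normc.normcM (gauss b _)) (Normc.normcM (pi%:C * 'i)) (Normc.normcM pi%:C).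
rewrite normcN (Normc.normcM b) (Normc.normcM 2) normc_i mulr1 normc_real ger0_norm ?pi_ge0//.
rewrite natrC normc_real ger0_norm//.
have hz := @normc_le_oneDsqr (t +i* y) Y h; rewrite Re_cplx in hz.
rewrite /c; move: (normc (gauss b _)) (normc_ge0 (gauss b (t +i* y))) => g g0.
have p1 : 0 <= 1 + t ^+ 2 by rewrite addr_ge0// sqr_ge0.
rewrite [leLHS](_ : _ = (1 + t ^+ 2) * g * pi * normc b * 2 * normc (t +i* y)); last by ring.
rewrite [leRHS](_ : _ = (1 + t ^+ 2) * g * pi * normc b * 2 * ((1 + Y) * (1 + t ^+ 2))); last by ring.
by rewrite ler_wpM2l// !mulr_ge0// ?pi_ge0 ?normc_ge0.
Qed.

(** The imaginary part of [w] is removed by moving the line inside the strip |Im| < |Im w| + 1, the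
    real part by a translation. *)
Lemma gauss_integral_shift b w : complex.Im b < 0 ->
  cintegral (fun t => gauss b (t%:C + w)) = kappa b.
Proof.
move=> b0; set y := complex.Im w; pose Y : R := `|y| + 1.
have [M [d1 d2]] := gauss_line_decay Y b0.
have Yy : - Y < y < Y by rewrite -ltr_norml /Y ltrDl.
have Y0 : - Y < 0 < Y by rewrite -ltr_norml normr0 /Y ltr_wpDl.
have cg (z : R) : ccont (line (gauss b) z) by exact: ccont_line_hol (@hol_gauss setT b).
have hd := holM (@hol_gauss setT b) (holZ (pi%:C * 'i) (holZ (-1) (holZ b (holZ 2 (@hol_id R setT))))).
have cd (z : R) : ccont (line (fun z => gauss b z * (pi%:C * 'i * (- (b * (2 * z))))) z).
  have := ccont_line_hol z hd; congr ccont; apply/funext => t.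
  by rewrite /line mulN1r.
have [_ sh] := cintegral_shift (hol_sub (@subsetT _ _) (@hol_gauss setT b)) d1 d2 (fun y _ => cd y).
have -> : kappa b = cintegral (line (gauss b) 0).
  by congr cintegral; apply/funext => t; rewrite /line complexr0.
rewrite (sh 0 y Y0 Yy) (cintegral_translate (complex.Re w) (cg y) (d1 y Yy)).
congr cintegral; apply/funext => t; rewrite /line; congr gauss.
by apply: complex_ext; rewrite !ReImE// add0r.
Qed.

Lemma gauss_decay b w : complex.Im b < 0 -> exists M, decays M (fun t => gauss b (t%:C + w)).
Proof.
move=> b0; have [K K0 HK] := gauss_bound `|complex.Im w| 1 b0.
exists (3 * (1 + complex.Re w ^+ 2) * K); apply: decaysP => t.
have h := HK (t%:C + w); rewrite !ReImE add0r expr1 in h; have {}h := h (lexx _).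
set x := complex.Re w in h *.
apply: (@le_trans _ _ (3 * (1 + x ^+ 2) * ((1 + (t + x) ^+ 2) * normc (gauss b (t%:C + w))))); last first.
  by rewrite ler_wpM2l// mulr_ge0// addr_ge0// sqr_ge0.
rewrite [leRHS]mulrA ler_wpM2r ?normc_ge0//.
have := sqr_ge0 (t + x); have := sqr_ge0 x; have := sqr_ge0 (t + 2 * x); have := sqr_ge0 (x * (t + x)).
nra.
Qed.

Lemma ccont_gauss b w : ccont (fun t : R => gauss b (t%:C + w)).
Proof.
apply: (@cderive_ccont _ _ (fun t : R => gauss b (w + t%:C * 1) * (pi%:C * 'i * (- (b * (2 * (w + t%:C * 1))))) * 1)) => t.
rewrite (_ : (fun t => gauss b (t%:C + w)) = (fun t => gauss b (w + t%:C * 1))).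
  exact: (@hol_gauss setT b w 1 t).
by apply/funext => s; rewrite mulr1 addrC.
Qed.

Lemma gauss_quad b (beta c : R[i]) z : b != 0 ->
  epii (- (b * z ^+ 2 + 2 * beta * z)) = epii (beta ^+ 2 / b) * gauss b (z + beta / b).
Proof. by move=> b0; rewrite /gauss -epiiD; congr epii; field. Qed.

Lemma Im_lt0_neq0 b : complex.Im b < 0 -> b != 0.
Proof. by apply: contraTneq => ->; rewrite Im_0 ltxx. Qed.

Lemma gauss_integral_quad b (beta c k : R[i]) : complex.Im b < 0 ->
  cintegral (fun t => k * epii (- (b * (t%:C + c) ^+ 2 + 2 * beta * (t%:C + c)))) =
  k * (kappa b * epii (beta ^+ 2 / b)).
Proof.
move=> b0; have bn0 := Im_lt0_neq0 b0.
have E t : k * epii (- (b * (t%:C + c) ^+ 2 + 2 * beta * (t%:C + c))) =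
  k * epii (beta ^+ 2 / b) * gauss b (t%:C + (c + beta / b)).
  by rewrite gauss_quad// mulrA addrA.
under eq_fun do rewrite E.
have [M dM] := gauss_decay (c + beta / b) b0.
rewrite cintegralZ; last exact: cintegrable_decay (@ccont_gauss b _) dM.
by rewrite gauss_integral_shift// -mulrA [epii _ * _]mulrC.
Qed.

Lemma integral_gauss_real (a : R) : 0 < a ->
  mu.-integrable setT (EFin \o (fun t => expR (- (pi * a * t ^+ 2)))) /\
  (\int[mu]_t expR (- (pi * a * t ^+ 2)))%R = (Num.sqrt a)^-1.
Proof.
(* The standard deviation for which the normal density is a multiple of e^{-pi a t^2}. *)
move=> a0; pose s : R := (Num.sqrt (2 * pi * a))^-1.
have pn : (pi : R) != 0 by rewrite gt_eqF// pi_gt0.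
have an : a != 0 by rewrite gt_eqF.
have p0 : 0 < 2 * pi * a by rewrite !mulr_gt0 ?pi_gt0.
have s0 : s != 0 by rewrite invr_eq0 gt_eqF// sqrtr_gt0.
have s2 : s ^+ 2 = (2 * pi * a)^-1 by rewrite exprVn sqr_sqrtr// ltW.
have E (t : R) : normal_pdf 0 s t = normal_peak s * expR (- (pi * a * t ^+ 2)).
  rewrite normal_pdfE// /normal_fun subr0; congr (_ * expR _).
  rewrite s2; have aux (q : R) : q != 0 -> - t ^+ 2 / ((2 * q * a)^-1 *+ 2) = - (q * a * t ^+ 2).
    by move=> qn; rewrite -mulr_natr; field; rewrite qn an.
  exact: aux.
have peak : normal_peak s = Num.sqrt a.
  rewrite /normal_peak s2 (_ : _ *+ 2 = a^-1) ?sqrtrV ?invrK// ?(ltW a0)//.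
  have aux (q : R) : q != 0 -> (2 * q * a)^-1 * q *+ 2 = a^-1.
    by move=> qn; rewrite -mulr_natr; field; rewrite qn an.
  exact: aux.
have pk0 : normal_peak s != 0 by rewrite peak gt_eqF// sqrtr_gt0.
have i0 := @integrable_normal_pdf R 0 s.
have i1 : mu.-integrable setT (EFin \o (fun t => expR (- (pi * a * t ^+ 2)))).
  have := integrableZl measurableT (normal_peak s)^-1 i0.
  move/(eq_integrable measurableT); apply => x _ /=.
  by rewrite E -EFinM mulKf.
split=> //; have := @integral_normal_pdf R 0 s.
under eq_integral do rewrite E.
move=> h; have : (\int[mu]_t (normal_peak s * expR (- (pi * a * t ^+ 2))))%R = 1 by rewrite /Rintegral h.
by rewrite RintegralZl// peak => /(congr1 (fun x => (Num.sqrt a)^-1 * x)); rewrite mulKf ?mulr1// gt_eqF// sqrtr_gt0.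
Qed.

Lemma kappa_bound b : complex.Im b < 0 -> normc (kappa b) <= 2 / Num.sqrt (- complex.Im b).
Proof.
move=> b0; have a0 : 0 < - complex.Im b by rewrite oppr_gt0.
have [i1 e1] := integral_gauss_real a0.
have [M dM] := gauss_decay 0 b0; have ci := cintegrable_decay (@ccont_gauss b 0) dM.
have -> : kappa b = cint setT (fun t => gauss b (t%:C + 0)).
  by rewrite -cintegralE; congr cintegral; apply/funext => t; rewrite addr0.
rewrite -e1; apply: cint_normc_le => // t _.
rewrite /gauss normc_epii addr0 expr2 !ReImE; rewrite le_eqVlt; apply/orP; left; apply/eqP; congr expR; ring.
Qed.

Section ThetaFactor.
Variable sigma : R.
Hypothesis sigma0 : 0 < sigma.

Lemma Im_sigma_inv tau : 0 < complex.Im tau ->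
  complex.Im (sigma%:C / tau) = - (sigma * complex.Im tau / normc tau ^+ 2).
Proof.
move=> t0; rewrite !ReImE Im_inv normc_sqr !expr2; ring.
Qed.

Lemma Im_gt0_neq0 tau : 0 < complex.Im tau -> tau != 0.
Proof. by apply: contraTneq => ->; rewrite Im_0 ltxx. Qed.

Lemma Im_sigma_inv_lt0 tau : 0 < complex.Im tau -> complex.Im (sigma%:C / tau) < 0.
Proof.
move=> t0; rewrite Im_sigma_inv// oppr_lt0 divr_gt0 ?mulr_gt0// normc_gt0;
  exact: Im_gt0_neq0.
Qed.

(* Integration by parts, as the vanishing of the integral of [(u gauss u)']. *)
Lemma gauss_second_moment b : complex.Im b < 0 ->
  cintegral (fun u : R => u%:C ^+ 2 * gauss b u%:C) = kappa b / (2 * pi%:C * 'i * b).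
Proof.
move=> b0; have bn0 := Im_lt0_neq0 b0.
have [K1 K10 H1] := gauss_bound 1 2 b0.
have [K2 K20 H2] := gauss_bound 1 3 b0.
pose F z := z * gauss b z.
pose c := 2 * pi%:C * 'i * b.
have cn0 : c != 0.
  rewrite /c !mulf_neq0//; last by rewrite -normc_gt0 normc_i ltr01.
    by rewrite real_complex_eq0 gt_eqF// pi_gt0.
pose dF z := gauss b z - c * (z ^+ 2 * gauss b z).
have hF : hol setT F dF.
  apply: (hol_eq (holM (@hol_id R setT) (@hol_gauss setT b))) => // z _.
  by rewrite /dF /c; ring.
have p1 (t : R) : 0 <= 1 + t ^+ 2 by rewrite addr_ge0// sqr_ge0.
have q1 (t : R) : 1 <= 1 + t ^+ 2 by rewrite lerDl sqr_ge0.
have N1 (y : R) : -1 < y < 1 -> `|y| <= 1.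
  by move=> /andP[h1 h2]; rewrite ler_norml !ltW.
have dec1 (y : R) : -1 < y < 1 -> decays (2 * K1) (line F y).
  move=> /N1 h; apply: decaysP => t; have := H1 (t +i* y) h; rewrite Re_cplx => HH.
  rewrite /line /F (Normc.normcM (t +i* y)).
  have hz := @normc_le_oneDsqr (t +i* y) 1 h; rewrite Re_cplx in hz.
  apply: (@le_trans _ _ (2 * ((1 + t ^+ 2) ^+ 2 * normc (gauss b (t +i* y))))); last by rewrite ler_wpM2l.
  move: (normc (gauss b _)) (normc_ge0 (gauss b (t +i* y))) (p1 t) hz => g g0.
  move: (1 + t ^+ 2) (normc (t +i* y)) => T Z T0 hz.
  have -> : 2 * (T ^+ 2 * g) = T * (((1 + 1) * T) * g) by ring.
  by rewrite ler_wpM2l// ler_wpM2r.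
have dec2 (y : R) : -1 < y < 1 -> decays (K1 + normc c * (4 * K2)) (line dF y).
  move=> /N1 h; apply: decaysP => t; have := H1 (t +i* y) h; rewrite Re_cplx => HH1.
  have := H2 (t +i* y) h; rewrite Re_cplx => HH2.
  have hz := @normc_le_oneDsqr (t +i* y) 1 h; rewrite Re_cplx in hz.
  rewrite /line /dF; apply: (le_trans (ler_wpM2l (p1 t) (normcB _ _))); rewrite mulrDr; apply: lerD.
    by apply: le_trans HH1; rewrite ler_wpM2r ?normc_ge0// [leRHS]expr2 ler_peMl.
  rewrite (Normc.normcM c) (Normc.normcM (_ ^+ 2)) normcX mulrCA ler_wpM2l ?normc_ge0//.
  apply: (@le_trans _ _ (4 * ((1 + t ^+ 2) ^+ 3 * normc (gauss b (t +i* y))))); last by rewrite ler_wpM2l.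
  move: (normc (gauss b _)) (normc_ge0 (gauss b (t +i* y))) (p1 t) (normc_ge0 (t +i* y)) hz => g g0.
  move: (1 + t ^+ 2) (normc (t +i* y)) => T Z T0 Z0 hz.
  have -> : 4 * (T ^+ 3 * g) = T * (((1 + 1) * T) ^+ 2 * g) by ring.
  by rewrite ler_wpM2l// ler_wpM2r// ler_sqr ?nnegrE// ?mulr_ge0//; lra.
pose M := 2 * K1 + (K1 + normc c * (4 * K2)).
have M1 : 2 * K1 <= M by rewrite lerDl addr_ge0// !mulr_ge0 ?normc_ge0.
have M2 : K1 + normc c * (4 * K2) <= M by rewrite lerDr mulr_ge0.
have dm (a d : R) (f : R -> R[i]) : a <= d -> decays a f -> decays d f.
  by move=> ad df t; apply: (le_trans (df t)); rewrite ler_wpM2r ?invr_ge0.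
have hdF := holD (@hol_gauss setT b) (holZ (-1) (holZ c (holM (holX 2 (@hol_id R setT)) (@hol_gauss setT b)))).
have cdF (y : R) : ccont (line dF y).
  have := ccont_line_hol y hdF; congr ccont; apply/funext => t.
  by rewrite /line /dF mulN1r.
have [i0 _] := cintegral_shift (hol_sub (@subsetT _ (strip (-1) 1)) hF)
  (fun y hy => dm _ _ _ M1 (dec1 y hy)) (fun y hy => dm _ _ _ M2 (dec2 y hy)) (fun y _ => cdF y).
have z0 : -1 < (0 : R) < 1 by rewrite ltrN10 ltr01.
have {i0} := i0 0 z0.
have [M' dM'] := gauss_decay 0 b0.
have ci1 : cintegrable setT (fun t : R => gauss b t%:C).
  have := cintegrable_decay (@ccont_gauss b 0) dM'.
  by under [X in cintegrable _ X]eq_fun do rewrite addr0.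
have ci2 : cintegrable setT (fun t : R => t%:C ^+ 2 * gauss b t%:C).
  apply: (@cintegrable_decay _ K1).
    have := ccont_line_hol 0 (holM (holX 2 (@hol_id R setT)) (@hol_gauss setT b)).
    by congr ccont; apply/funext => t; rewrite /line complexr0.
  apply: decaysP => t; have := H1 t%:C; rewrite Re_real Im_real normr0 => /(_ ler01).
  apply: le_trans; rewrite (Normc.normcM (_ ^+ 2)) normcX normc_real real_normK ?num_real//.
  rewrite mulrA ler_wpM2r ?normc_ge0// [leRHS]expr2 ler_wpM2l// lerDr.
  by [].
rewrite (_ : line dF 0 = (fun t => gauss b t%:C + (- c) * (t%:C ^+ 2 * gauss b t%:C))); last first.
  by apply/funext => t; rewrite /line /dF complexr0 mulNr.
rewrite cintegralD//; last exact: cintegrableZ.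
rewrite cintegralZ// mulNr => /eqP; rewrite subr_eq0 => /eqP h.
by rewrite /kappa h -/c mulrC mulKf.
Qed.

Definition upper : set R[i] := [set z | 0 < complex.Im z].

Lemma normc_gauss_real b (u : R) : normc (gauss b u%:C) = expR (- (pi * (- complex.Im b) * u ^+ 2)).
Proof. by rewrite /gauss normc_epii expr2 !ReImE; congr expR; ring. Qed.

(** Differentiating e^{-pi i sigma u^2/tau} in tau brings down pi i sigma u^2/tau^2. The second
    moment with b = sigma/tau is kappa tau/(2 pi i sigma), so kappa/(2 tau) remains. *)
Lemma hol_kappa : hol upper (fun tau => kappa (sigma%:C / tau))
  (fun tau => kappa (sigma%:C / tau) / (2 * tau)).
Proof.
move=> tau v x; rewrite /upper /=; set tau0 := tau + x%:C * v => t0.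
(* For |th - x| <= [d] the point moves by at most half its height [al]. Adding 1 to [normc v] covers
   the direction v = 0. *)
pose al := complex.Im tau0; pose d := (al / 2) / (1 + normc v).
have v1 : 0 < 1 + normc v by rewrite ltr_pwDl// normc_ge0.
have d0 : 0 < d by rewrite !divr_gt0.
have tn0 := Im_gt0_neq0 t0.
have nearb (th : R) : x - d < th < x + d ->
   al / 2 <= complex.Im (tau + th%:C * v) /\ normc (tau + th%:C * v) <= normc tau0 + al / 2.
  move=> /andP[h1 h2].
  have E : tau + th%:C * v = tau0 + (th - x)%:C * v by rewrite /tau0 realCD realCN; ring.
  have n1 : normc ((th - x)%:C * v) <= al / 2.
    rewrite Normc.normcM normc_real.
    have h : `|th - x| <= d by rewrite ler_norml; apply/andP; split; lra.
    apply: (le_trans (ler_wpM2r (normc_ge0 v) h)).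
    rewrite /d mulrAC ler_pdivrMr// ler_wpM2l ?divr_ge0 ?(ltW t0)// lerDr.
    by [].
  rewrite E; split; last by apply: (le_trans (le_normcD _ _)); rewrite lerD2l.
  rewrite Im_add -/al; have := le_trans (normc_Im _) n1; rewrite ler_norml => /andP[h3 h4]; lra.
have up th : x - d < th < x + d -> 0 < complex.Im (tau + th%:C * v).
  by move=> /nearb [h _]; apply: lt_le_trans h; rewrite divr_gt0.
(* A lower bound for -Im(sigma/tau) = sigma Im tau/|tau|^2 throughout the neighbourhood, which gives
   one Gaussian majorant for all its points. *)
pose a0 := sigma * (al / 2) / (normc tau0 + al / 2) ^+ 2.
have nt0 : 0 < normc tau0 + al / 2 by rewrite ltr_wpDl ?normc_ge0// divr_gt0.
have a00 : 0 < a0 by rewrite divr_gt0 ?mulr_gt0 ?exprn_gt0// divr_gt0.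
have ab th : x - d < th < x + d -> a0 <= - complex.Im (sigma%:C / (tau + th%:C * v)).
  move=> hth; have [h1 h2] := nearb th hth; have h3 := up th hth.
  rewrite Im_sigma_inv// opprK /a0.
  apply: ler_pM => //; rewrite ?mulr_ge0 ?invr_ge0 ?exprn_ge0 ?divr_ge0 ?(ltW t0) ?(ltW sigma0)//.
  - exact: ltW.
  - by rewrite ler_wpM2l// ltW.
  - rewrite lef_pV2 ?posrE ?exprn_gt0// ?normc_gt0 ?Im_gt0_neq0//.
    by rewrite ler_sqr ?nnegrE ?normc_ge0// ltW.
have [K K0 HK] := @poly_gauss_le (pi * a0) 2 (mulr_gt0 (pi_gt0 R) a00).
have gb th u : x - d < th < x + d ->
   (1 + u ^+ 2) ^+ 2 * normc (gauss (sigma%:C / (tau + th%:C * v)) u%:C) <= K.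
  move=> hth; apply: le_trans (HK u); rewrite ler_wpM2l ?sqr_ge0//.
  rewrite normc_gauss_real ler_expR lerN2 ler_wpM2r ?sqr_ge0// ler_wpM2l ?pi_ge0//.
  exact: ab.
have p1 (t : R) : 0 <= 1 + t ^+ 2 by rewrite addr_ge0// sqr_ge0.
have q1 (t : R) : 1 <= 1 + t ^+ 2 by rewrite lerDl sqr_ge0.
pose cc th := pi%:C * 'i * (sigma%:C * v / (tau + th%:C * v) ^+ 2).
pose C := pi * (sigma * normc v / (al / 2) ^+ 2).
have C0 : 0 <= C by rewrite mulr_ge0 ?pi_ge0// divr_ge0 ?sqr_ge0// mulr_ge0 ?normc_ge0// ltW.
have ccb th : x - d < th < x + d -> normc (cc th) <= C.
  move=> hth; have [h1 h2] := nearb th hth; have h3 := up th hth.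
  rewrite /cc (Normc.normcM (pi%:C * 'i)) (Normc.normcM pi%:C) normc_i mulr1 normc_real ger0_norm ?pi_ge0//.
  rewrite ler_wpM2l ?pi_ge0// (Normc.normcM (sigma%:C * v)) (Normc.normcM sigma%:C) Normc.normcV normcX.
  rewrite normc_real ger0_norm ?(ltW sigma0)// ler_wpM2l ?mulr_ge0 ?normc_ge0 ?(ltW sigma0)//.
  rewrite lef_pV2 ?posrE ?exprn_gt0// ?normc_gt0 ?Im_gt0_neq0// ?divr_gt0//.
  rewrite ler_sqr ?nnegrE ?normc_ge0 ?divr_ge0 ?(ltW t0)//.
  by apply: le_trans h1 _; apply: le_trans (normc_Im _); exact: ler_norm.
have M1 : K <= K + C * K by rewrite lerDl mulr_ge0.
have := @cderive_cintegral R (fun th u => gauss (sigma%:C / (tau + th%:C * v)) u%:C)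
  (fun th u => cc th * (u%:C ^+ 2 * gauss (sigma%:C / (tau + th%:C * v)) u%:C))
  (x - d) (x + d) x (K + C * K).
have xx : x - d < x < x + d by apply/andP; split; lra.
move=> H; have {}H := H xx.
have cg th : ccont (fun u : R => gauss (sigma%:C / (tau + th%:C * v)) u%:C).
  have := @ccont_gauss (sigma%:C / (tau + th%:C * v)) 0.
  by congr ccont; apply/funext => u; rewrite addr0.
have {}H := H (fun th _ => cg th).
have d1 th : x - d < th < x + d -> decays (K + C * K) (fun u : R => gauss (sigma%:C / (tau + th%:C * v)) u%:C).
  move=> hth; apply: decaysP => u; apply: le_trans M1; apply: le_trans (gb th u hth).
  by rewrite ler_wpM2r ?normc_ge0// [leRHS]expr2 ler_peMl.
have d2 th : x - d < th < x + d -> decays (K + C * K)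
    (fun u : R => cc th * (u%:C ^+ 2 * gauss (sigma%:C / (tau + th%:C * v)) u%:C)).
  move=> hth; apply: decaysP => u.
  rewrite (Normc.normcM (cc th)) (Normc.normcM (_ ^+ 2)) normcX normc_real real_normK ?num_real//.
  apply: (@le_trans _ _ (C * K)); last by rewrite lerDr.
  rewrite mulrCA; apply: ler_pM; [exact: normc_ge0| |exact: ccb|].
    exact: mulr_ge0 (p1 u) (mulr_ge0 (sqr_ge0 u) (normc_ge0 _)).
  apply: le_trans (gb th u hth).
  by rewrite mulrA ler_wpM2r ?normc_ge0// [leRHS]expr2 ler_wpM2l// lerDr.
have {}H := H d1 d2.
have hu (u : R) : hol upper (fun tau => gauss (sigma%:C / tau) u%:C)
   (fun tau => gauss (sigma%:C / tau) u%:C * (pi%:C * 'i * (- (sigma%:C * u%:C ^+ 2) * (- (1 / tau ^+ 2))))).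
  have hi := holV (fun z hz => Im_gt0_neq0 hz) (@hol_id R upper).
  apply: (hol_eq (hol_epii (holZ (- (sigma%:C * u%:C ^+ 2)) hi))) => [z|z _].
    by rewrite /gauss; congr epii; ring.
  by rewrite /gauss; congr (epii _ * _); ring.
apply: cderive_eq (H _) _.
  move=> th u hth; apply: (cderive_eq (hu u tau v th (up th hth))).
  by rewrite /cc; ring.
rewrite cintegralZ; last first.
  apply: (@cintegrable_decay _ K).
    have := ccont_line_hol 0 (holM (holX 2 (@hol_id R setT)) (@hol_gauss setT (sigma%:C / tau0))).
    by congr ccont; apply/funext => t; rewrite /line complexr0.
  apply: decaysP => u; apply: le_trans (gb x u xx).
  rewrite (Normc.normcM (_ ^+ 2)) normcX normc_real real_normK ?num_real//.
  by rewrite mulrA ler_wpM2r ?normc_ge0// [leRHS]expr2 ler_wpM2l// lerDr.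
rewrite gauss_second_moment; last exact: Im_sigma_inv_lt0.
have sn0 : sigma%:C != 0 :> R[i] by rewrite real_complex_eq0 gt_eqF.
have pn0 : pi%:C != 0 :> R[i] by rewrite real_complex_eq0 gt_eqF// pi_gt0.
have in0 : 'i != 0 :> R[i] by rewrite -normc_gt0 normc_i ltr01.
have aux (P J S T V K' : R[i]) : P != 0 -> J != 0 -> S != 0 -> T != 0 ->
    P * J * (S * V / T ^+ 2) * (K' / (2 * P * J * (S / T))) = K' / (2 * T) * V.
  by move=> P0 J0 S0 T0; field; rewrite P0 J0 S0 T0.
exact: aux.
Qed.

(** The true size is (|tau|/sigma)^(1/2). Taking absolute values inside the integral costs |tau|
    instead of its square root, hence |tau|^n in n variables; k >= n + 2 still absorbs this. *)
Lemma kappa_tau_bound tau : 0 < complex.Im tau ->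
  normc (kappa (sigma%:C / tau)) <= 2 / Num.sqrt (sigma * complex.Im tau) * normc tau.
Proof.
move=> t0; apply: (le_trans (kappa_bound (Im_sigma_inv_lt0 t0))).
rewrite Im_sigma_inv// opprK sqrtrM ?mulr_ge0 ?(ltW sigma0) ?(ltW t0)// sqrtrV ?exprn_ge0 ?normc_ge0//.
by rewrite sqrtr_sqr ger0_norm ?normc_ge0// invfM invrK mulrA.
Qed.

End ThetaFactor.

End Gaussian.

(** * Theta inversion in several variables *)

Section GaussianSums.
Variable R : realType.
Local Notation esumT f := (\esum_(t in [set: _]) (f t)%:E)%E.

(** With r = sqrt A, use -A s^2 <= 1 - 2 r |s| and sum the geometric series of ratio e^{-2r}, at
    most 1 + 1/(2r). The factor e comes from the constant 1, the factor 2 from the two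
    half-lines. *)
Definition gsum_bound (A : R) : R := 2 * (expR 1 * (1 + (2 * Num.sqrt A)^-1)).

Lemma gsum_bound_ge0 A : 0 <= gsum_bound A.
Proof. by rewrite !mulr_ge0 ?expR_ge0// addr_ge0// invr_ge0 mulr_ge0// sqrtr_ge0. Qed.

Lemma esum_gauss_int (A x : R) : 0 < A ->
  (\esum_(n in [set: int]) (expR (- (A * (x + n%:~R) ^+ 2)))%:E <= (gsum_bound A)%:E)%E.
Proof.
move=> A0; set r := Num.sqrt A; have r0 : 0 < r by rewrite sqrtr_gt0.
have rA : r ^+ 2 = A by rewrite sqr_sqrtr// ltW.
apply: (@le_trans _ _ (\esum_(n in [set: int]) (expR (1 - 2 * r * `|x + n%:~R|))%:E)%E).
  apply: le_esum => n _; rewrite lee_fin ler_expR -rA.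
  move: (x + n%:~R) => s; rewrite -(real_normK (num_real s)); move: `|s| => a.
  by have := sqr_ge0 (r * a - 1); lra.
apply: (@esum_int_shift_le R (fun s => expR (1 - 2 * r * `|s|))).
- by move=> s; exact: expR_ge0.
- by move=> s t st; rewrite ler_expR lerD2l lerN2 ler_wpM2l// mulr_ge0// ltW.
- apply: esum_nat_le => n; first exact: expR_ge0.
  pose q := expR (- (2 * r)); have q0 : 0 < q by exact: expR_gt0.
  have rr : 0 < 2 * r by rewrite mulr_gt0.
  have q1 : q < 1 by rewrite -expR0 ltr_expR oppr_lt0.
  under eq_bigr => i _.
    rewrite expRD normr_nat -mulNr expRM_natr -/q mulrC; over.
  rewrite -mulr_suml mulrC ler_wpM2l ?expR_ge0//.
  have : (\sum_(i < n) q ^+ i) * (1 - q) <= 1.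
    by have := subrX1 q n; have := exprn_gt0 n q0; rewrite mulrC; lra.
  have h : 1 <= (1 + (2 * r)^-1) * (1 - q).
    have : q * (1 + 2 * r) <= 1.
      by rewrite /q expRN -[leRHS](mulVf (lt0r_neq0 (expR_gt0 (2 * r)))) ler_wpM2l ?invr_ge0 ?expR_ge0// expR_ge1Dx.
    have -> : (1 + (2 * r)^-1) * (1 - q) = ((1 + 2 * r) - q * (1 + 2 * r)) / (2 * r).
      by field; rewrite gt_eqF.
    by rewrite ler_pdivlMr// mul1r; lra.
  move=> h2; rewrite -(ler_pM2r (_ : 0 < 1 - q)); first exact: le_trans h2 h.
  by rewrite subr_gt0.
Qed.

Lemma esum_gauss_lin_int (A rho x : R) : 0 < A ->
  (\esum_(n in [set: int]) (expR (- (A * (x + n%:~R) ^+ 2) + rho * (x + n%:~R)))%:E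
    <= (expR (rho ^+ 2 / (4 * A)) * gsum_bound A)%:E)%E.
Proof.
move=> A0; have An : A != 0 by rewrite gt_eqF.
have E (n : int) : expR (- (A * (x + n%:~R) ^+ 2) + rho * (x + n%:~R)) =
   expR (rho ^+ 2 / (4 * A)) * expR (- (A * ((x - rho / (2 * A)) + n%:~R) ^+ 2)).
  by rewrite -expRD; congr expR; field.
under eq_esum do rewrite E EFinM.
rewrite esumZ ?expR_ge0//.
by rewrite EFinM lee_wpmul2l ?lee_fin ?expR_ge0// esum_gauss_int.
Qed.

End GaussianSums.

Section Vectors.
Variable R : realType.

Definition consV (A : Type) n (a : A) (u : 'cV[A]_n) : 'cV[A]_n.+1 :=
  \col_(i < n.+1) (if unlift ord0 i is Some j then u j 0 else a).
Definition headV (A : Type) n (u : 'cV[A]_n.+1) : A := u ord0 0.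
Definition tailV (A : Type) n (u : 'cV[A]_n.+1) : 'cV[A]_n := \col_j u (lift ord0 j) 0.

Lemma headV_cons (A : Type) n (a : A) (u : 'cV[A]_n) : headV (consV a u) = a.
Proof. by rewrite /headV mxE unlift_none. Qed.
Lemma tailV_cons (A : Type) n (a : A) (u : 'cV[A]_n) : tailV (consV a u) = u.
Proof. by apply/colP => j; rewrite !mxE liftK. Qed.
Lemma consV_headtail (A : Type) n (u : 'cV[A]_n.+1) : consV (headV u) (tailV u) = u.
Proof.
apply/colP => i; rewrite mxE; case: unliftP => [j ->|->]; last by [].
by rewrite mxE.
Qed.

Lemma consV_bij (A : Type) n : bijective (fun p : A * 'cV[A]_n => consV p.1 p.2).
Proof.
exists (fun u => (headV u, tailV u)) => [[a u]|u] /=; last exact: consV_headtail.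
by rewrite headV_cons tailV_cons.
Qed.

Lemma headV_map (A B : Type) (f : A -> B) n (u : 'cV[A]_n.+1) : headV (map_mx f u) = f (headV u).
Proof. by rewrite /headV mxE. Qed.
Lemma tailV_map (A B : Type) (f : A -> B) n (u : 'cV[A]_n.+1) : tailV (map_mx f u) = map_mx f (tailV u).
Proof. by apply/colP => j; rewrite !mxE. Qed.
Lemma headVD (A : zmodType) n (u v : 'cV[A]_n.+1) : headV (u + v) = headV u + headV v.
Proof. by rewrite /headV mxE. Qed.
Lemma tailVD (A : zmodType) n (u v : 'cV[A]_n.+1) : tailV (u + v) = tailV u + tailV v.
Proof. by apply/colP => j; rewrite !mxE. Qed.

Lemma consV_col (A : pzRingType) n (a : A) (u : 'cV[A]_n) :
  col_mx (a%:M : 'cV[A]_1) u = consV a u :> 'cV[A]_n.+1.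
Proof.
apply/colP => i; rewrite !mxE; case: splitP => [j ij|j ij].
  rewrite (_ : i = ord0); last by apply: val_inj => /=; rewrite ij (ord1 j).
  by rewrite unlift_none !ord1 mxE eqxx mulr1n.
by rewrite (_ : i = lift ord0 j) ?liftK//; apply: val_inj.
Qed.

Definition dotv (A : pzRingType) n (u v : 'cV[A]_n) : A := \sum_j u j 0 * v j 0.

Lemma dotvS (A : pzRingType) n (u v : 'cV[A]_n.+1) :
  dotv u v = headV u * headV v + dotv (tailV u) (tailV v).
Proof.
by rewrite /dotv big_ord_recl; congr (_ + _); apply: eq_bigr => j _; rewrite !mxE.
Qed.

Lemma dotv0 (A : pzRingType) (u v : 'cV[A]_0) : dotv u v = 0.
Proof. by rewrite /dotv big_ord0. Qed.
Lemma dotvDr (A : pzRingType) n (u v w : 'cV[A]_n) : dotv u (v + w) = dotv u v + dotv u w.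
Proof. by rewrite /dotv -big_split; apply: eq_bigr => j _; rewrite mxE mulrDr. Qed.
Lemma dotvZr (A : comPzRingType) n (u v : 'cV[A]_n) c : dotv u (c *: v) = c * dotv u v.
Proof. by rewrite /dotv mulr_sumr; apply: eq_bigr => j _; rewrite mxE mulrCA. Qed.
Lemma dotvC (A : comPzRingType) n (u v : 'cV[A]_n) : dotv u v = dotv v u.
Proof. by apply: eq_bigr => j _; rewrite mulrC. Qed.

Lemma dotv_cvec n (u v : 'cV[R]_n) : dotv (cvec u) (cvec v) = (dotv u v)%:C.
Proof. by rewrite /dotv rmorph_sum; apply: eq_bigr => j _; rewrite !mxE rmorphM. Qed.
Lemma Im_dotv n (u : 'cV[R]_n) (z : 'cV[R[i]]_n) :
  complex.Im (dotv (cvec u) z) = dotv u (map_mx (@complex.Im R) z).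
Proof.
rewrite /dotv (big_morph (@complex.Im R) (@Im_add R) (erefl _)).
by apply: eq_bigr => j _; rewrite !mxE Im_mul Re_real Im_real mul0r addr0.
Qed.
End Vectors.

(** * Quadratic forms as iterated square completions *)

Section TriangularForms.
Variable R : realType.
Local Notation esumT f := (\esum_(t in [set: _]) (f t)%:E)%E.
Local Notation csm f := (csummable [set: _] f).
Local Notation csumT f := (csum [set: _] f).

(* Square completions: (s, w, D) encodes q(z1, z') = q_D(z' + z1 w) + s z1^2. *)
Fixpoint tri (n : nat) : Type :=
  if n is n'.+1 then (R * 'cV[R]_n' * tri n')%type else unit.

Fixpoint tri_pos (n : nat) : tri n -> Prop :=
  if n is n'.+1 return tri n -> Prop then fun D => 0 < D.1.1 /\ tri_pos D.2
  else fun=> True.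

Fixpoint qf (n : nat) : tri n -> 'cV[R[i]]_n -> R[i] :=
  if n is n'.+1 return tri n -> 'cV[R[i]]_n -> R[i] then
    fun D z => qf D.2 (tailV z + headV z *: cvec D.1.2) + (D.1.1)%:C * headV z ^+ 2
  else fun _ _ => 0.

(* The form with the inverse Gram matrix. *)
Fixpoint qd (n : nat) : tri n -> 'cV[R]_n -> R :=
  if n is n'.+1 return tri n -> 'cV[R]_n -> R then
    fun D mu => qd D.2 (tailV mu) + (headV mu - dotv D.1.2 (tailV mu)) ^+ 2 / D.1.1
  else fun _ _ => 0.

Variable m : R.
Hypothesis m0 : 0 < m.

(** A branch of (tau/(i m))^(n/2) divided by the square root of the product of the s, that is, of
    the determinant. As a product of one-variable integrals it needs no choice of branch. *)
Fixpoint gauss_factor (n : nat) : tri n -> R[i] -> R[i] :=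
  if n is n'.+1 return tri n -> R[i] -> R[i] then
    fun D tau => kappa ((m * D.1.1)%:C / tau) * gauss_factor D.2 tau
  else fun _ _ => 1.

Lemma hol_gauss_factor n (D : tri n) : tri_pos D ->
  hol (@upper R) (gauss_factor D) (fun tau => n%:R / (2 * tau) * gauss_factor D tau).
Proof.
elim: n D => [|n IH] D /=.
  by move=> _; apply: (hol_eq (@hol_cst R _ 1)) => // z _; rewrite !mul0r.
move=> [s0 /IH hD].
apply: (hol_eq (holM (hol_kappa (mulr_gt0 m0 s0)) hD)) => // z _.
by rewrite -natr1; ring.
Qed.

Lemma gauss_factor_bound n (D : tri n) (v0 : R) : tri_pos D -> 0 < v0 ->
  exists2 K : R, 0 <= K & forall tau, v0 <= complex.Im tau ->
    normc (gauss_factor D tau) <= K * normc tau ^+ n.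
Proof.
move=> + v00; elim: n D => [|n IH] D /=.
  by move=> _; exists 1 => // tau _; rewrite expr0 mulr1 expr0n expr1n addr0 sqrtr1.
move=> [s0 /IH [K K0 HK]].
have ms := mulr_gt0 m0 s0.
exists (2 / Num.sqrt (m * D.1.1 * v0) * K).
  by rewrite mulr_ge0// divr_ge0// sqrtr_ge0.
move=> tau v1; have t0 := lt_le_trans v00 v1.
rewrite Normc.normcM exprS [leRHS](_ : _ = (2 / Num.sqrt (m * D.1.1 * v0) * normc tau) * (K * normc tau ^+ n)); last by ring.
apply: ler_pM; rewrite ?normc_ge0 ?HK//.
apply: (le_trans (kappa_tau_bound ms t0)); rewrite ler_wpM2r ?normc_ge0// ler_wpM2l//.
rewrite lef_pV2 ?posrE ?sqrtr_gt0 ?mulr_gt0// ler_sqrt ?ler_wpM2l ?(ltW ms)//.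
by rewrite mulr_ge0 ?ltW.
Qed.

Lemma m_tau_Im n (D : tri n.+1) tau : tri_pos D -> 0 < complex.Im tau ->
  complex.Im ((m * D.1.1)%:C / tau) < 0.
Proof. by move=> [s0 _] t0; apply: Im_sigma_inv_lt0 => //; exact: mulr_gt0. Qed.

(** With the first coordinate t fixed, the others enter through the form of [D.2] at a shifted
    point. The arbitrary complex shift [c] in the induction hypothesis takes up that shift, and the
    inner value does not depend on it. *)
Lemma gauss_integral_n n (D : tri n) (tau : R[i]) (mu : 'cV[R]_n) (c : 'cV[R[i]]_n) (k : R[i]) :
  tri_pos D -> 0 < complex.Im tau ->
  cintegral_n (fun u : 'cV[R]_n => k * epii (- (m%:C / tau * qf D (cvec u + c)
     + 2 * dotv (cvec mu) (cvec u + c)))) =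
  k * (gauss_factor D tau * epii ((qd D mu)%:C * tau / m%:C)).
Proof.
move=> + t0; elim: n D mu c k => [|n IH] D mu c k /=.
  by move=> _; rewrite dotv0 !mulr0 addr0 oppr0 !mul0r epii0 !mulr1.
move=> pD; have [s0 pD'] := pD; have tn0 := Im_gt0_neq0 t0.
have mn0 : m%:C != 0 :> R[i] by rewrite real_complex_eq0 gt_eqF.
have sn0 : D.1.1%:C != 0 :> R[i] by rewrite real_complex_eq0 gt_eqF.
have bI := m_tau_Im pD t0.
set s := D.1.1 in sn0 bI *; set w := D.1.2; set D' := D.2.
(* The linear coefficient of the first coordinate once the tail has been shifted by t w. *)
pose be : R := headV mu - dotv w (tailV mu).
pose E1 (t : R) := epii (- ((m * s)%:C / tau * (t%:C + headV c) ^+ 2 + 2 * be%:C * (t%:C + headV c))).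
have E (t : R) : cintegral_n (fun u : 'cV[R]_n =>
    k * epii (- (m%:C / tau * (qf D' (tailV (cvec (col_mx (t%:M : 'cV[R]_1) u : 'cV[R]_n.+1) + c)
       + headV (cvec (col_mx (t%:M : 'cV[R]_1) u : 'cV[R]_n.+1) + c) *: cvec w)
       + s%:C * headV (cvec (col_mx (t%:M : 'cV[R]_1) u : 'cV[R]_n.+1) + c) ^+ 2)
     + 2 * dotv (cvec mu) (cvec (col_mx (t%:M : 'cV[R]_1) u : 'cV[R]_n.+1) + c)))) =
   k * (gauss_factor D' tau * epii ((qd D' (tailV mu))%:C * tau / m%:C)) * E1 t.
  transitivity (cintegral_n (fun u : 'cV[R]_n => (k * E1 t) * epii (- (m%:C / tau * qf D' (cvec u + (tailV c + (t%:C + headV c) *: cvec w))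
     + 2 * dotv (cvec (tailV mu)) (cvec u + (tailV c + (t%:C + headV c) *: cvec w)))))); last first.
    by rewrite IH//; ring.
  congr cintegral_n; apply/funext => u.
  rewrite consV_col headVD tailVD /cvec headV_map tailV_map headV_cons tailV_cons -/(cvec u) -/(cvec mu).
  rewrite addrA dotvS headVD tailVD /cvec !headV_map !tailV_map headV_cons tailV_cons.
  rewrite -/(cvec u) -/(cvec (tailV mu)) -/(cvec w) !dotvDr dotvZr !dotv_cvec.
  rewrite /E1 -[RHS]mulrA -epiiD; congr (_ * epii _).
  rewrite /be realCD realCN [dotv w _]dotvC realCM; field.
  exact: tn0.
under eq_fun do rewrite E.
rewrite gauss_integral_quad//.
have -> : (qd D' (tailV mu) + (headV mu - dotv w (tailV mu)) ^+ 2 / s)%:C * tau / m%:C =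
   (qd D' (tailV mu))%:C * tau / m%:C + be%:C ^+ 2 / ((m * s)%:C / tau).
  rewrite realCD realCM realCX realCV realCM -/be; field.
  by rewrite mn0 sn0 tn0.
by rewrite epiiD; ring.
Qed.

Lemma normc_gauss_tau (sigma : R) (tau z : R[i]) : 0 < complex.Im tau ->
  normc (epii (- (sigma%:C / tau * z ^+ 2))) =
  expR (pi * sigma * complex.Im z ^+ 2 / complex.Im tau) *
  expR (- (pi * sigma * complex.Im tau / normc tau ^+ 2 *
     (complex.Re z - complex.Im z * complex.Re tau / complex.Im tau) ^+ 2)).
Proof.
move=> t0; rewrite normc_epii -expRD; congr expR.
rewrite expr2 !(ReImE, Re_inv, Im_inv) normc_sqr !expr2.
have h : complex.Re tau * complex.Re tau + complex.Im tau * complex.Im tau != 0.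
  exact/ReIm2_neq0/Im_gt0_neq0.
have v0 : complex.Im tau != 0 by rewrite gt_eqF.
move: (complex.Re tau) (complex.Im tau) h v0 => t v h v0.
by field; rewrite h v0.
Qed.

(** At height v the Gaussian in n has width of order |tau|, so O(|tau|) integers contribute; the
    constant term of [gsum_bound] is absorbed by |tau| >= v. That [K] depends only on the imaginary
    parts permits the later sum over tau + a. *)
Lemma esum_gauss_tau (sigma : R) (v nu : R) : 0 < sigma -> 0 < v ->
  exists2 K : R, 0 <= K & forall tau z, complex.Im tau = v -> complex.Im z = nu ->
    (\esum_(n in [set: int]) (normc (epii (- (sigma%:C / tau * (z + n%:~R) ^+ 2))))%:E
      <= (K * normc tau)%:E)%E.
Proof.
move=> s0 v0.
pose q := Num.sqrt (pi * sigma * v).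
have q2 : 0 < pi * sigma * v by rewrite !mulr_gt0 ?pi_gt0.
have q0 : 0 < q by rewrite sqrtr_gt0.
pose e := expR (pi * sigma * nu ^+ 2 / v).
pose K := e * (2 * (expR 1 * (v^-1 + (2 * q)^-1))).
exists K; first by rewrite !mulr_ge0 ?expR_ge0// addr_ge0// invr_ge0 ?mulr_ge0 ?ltW.
move=> tau z tv zn; have t0 : 0 < complex.Im tau by rewrite tv.
have nt : 0 < normc tau by rewrite normc_gt0 Im_gt0_neq0.
pose A := pi * sigma * v / normc tau ^+ 2.
have A0 : 0 < A by rewrite divr_gt0// exprn_gt0.
have E (n : int) : (normc (epii (- (sigma%:C / tau * (z + n%:~R) ^+ 2))))%:E =
  (e%:E * (expR (- (A * ((complex.Re z - nu * complex.Re tau / v) + n%:~R) ^+ 2)))%:E)%E.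
  rewrite normc_gauss_tau// -EFinM !ReImE tv zn intrC !ReImE addr0; congr (_ * expR (- (_ * _ ^+ 2)))%:E.
  ring.
under eq_esum do rewrite E.
rewrite esumZ ?expR_ge0//.
apply: (le_trans (lee_wpmul2l _ (esum_gauss_int _ A0))); first by rewrite lee_fin expR_ge0.
rewrite -EFinM lee_fin [leRHS](_ : _ = e * (2 * (expR 1 * ((v^-1 + (2 * q)^-1) * normc tau)))); last by rewrite /K; ring.
rewrite ler_wpM2l ?expR_ge0// /gsum_bound ler_wpM2l// ler_wpM2l ?expR_ge0//.
have -> : Num.sqrt A = q / normc tau.
  by rewrite /A sqrtrM ?(ltW q2)// sqrtrV ?sqr_ge0// sqrtr_sqr ger0_norm ?normc_ge0.
rewrite [leRHS]mulrDl lerD//.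
  rewrite mulrC ler_pdivlMr// mul1r -tv; apply: le_trans (normc_Im _); exact: ler_norm.
rewrite le_eqVlt; apply/orP; left; apply/eqP; field.
by rewrite !gt_eqF.
Qed.

Lemma lat_cons (n : nat) (a : int) (u : 'cV[int]_n) :
  lat R[i] (consV a u) = consV (a%:~R) (lat R[i] u).
Proof. by rewrite -[LHS]consV_headtail /lat headV_map tailV_map headV_cons tailV_cons. Qed.

Lemma esum_qf_bound n (D : tri n) (v : R) (nu : 'cV[R]_n) : tri_pos D -> 0 < v ->
  exists2 K : R, 0 <= K & forall tau z, complex.Im tau = v ->
    map_mx (@complex.Im R) z = nu ->
    (\esum_(la in [set: 'cV[int]_n]) (normc (epii (- (m%:C / tau * qf D (z + lat R[i] la)))))%:E
      <= (K * normc tau ^+ n)%:E)%E.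
Proof.
move=> + v0; elim: n D nu => [|n IH] D nu.
  move=> _; exists 1 => // tau z tv zn; rewrite expr0 mulr1.
  have -> : [set: 'cV[int]_0] = [set 0].
    by apply/seteqP; split => // u _ /=; apply/colP; case.
  by rewrite esum_set1 ?lee_fin ?normc_ge0// mulr0 oppr0 epii0 Normc.normc1.
move=> [s0 pD].
have [K1 K10 H1] := esum_gauss_tau (headV nu) (mulr_gt0 m0 s0) v0.
have [K2 K20 H2] := IH D.2 (tailV nu + headV nu *: D.1.2) pD.
exists (K1 * K2) => [|tau z tv zn]; first exact: mulr_ge0.
have nu1 : complex.Im (headV z) = headV nu by rewrite -zn headV_map.
rewrite (esum_bij _ (@consV_bij int n)).
have E (a : int) (u : 'cV[int]_n) :
  normc (epii (- (m%:C / tau * qf D (z + lat R[i] (consV a u))))) =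
  normc (epii (- ((m * D.1.1)%:C / tau * (headV z + a%:~R) ^+ 2))) *
  normc (epii (- (m%:C / tau * qf D.2 ((tailV z + (headV z + a%:~R) *: cvec D.1.2) + lat R[i] u)))).
  rewrite -Normc.normcM -epiiD lat_cons /= headVD tailVD headV_cons tailV_cons.
  congr (normc (epii _)); rewrite realCM -[_ + _ + lat _ _]addrA [_ *: _ + lat _ _]addrC addrA.
  ring.
rewrite [leLHS](_ : _ = \esum_(p in [set: int * 'cV[int]_n])
   (normc (epii (- (m%:C / tau * qf D (z + lat R[i] (consV p.1 p.2))))))%:E)%E//.
apply: (le_trans (esum_pair_le (b := fun a : int =>
   normc (epii (- ((m * D.1.1)%:C / tau * (headV z + a%:~R) ^+ 2))) * (K2 * normc tau ^+ n)) _ _)).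
- by move=> p; exact: normc_ge0.
- move=> a; under eq_esum do rewrite /fst /snd E EFinM.
  rewrite esumZ ?normc_ge0//; last by move=> u; rewrite lee_fin normc_ge0.
  rewrite EFinM; apply: lee_wpmul2l; first by rewrite lee_fin normc_ge0.
  apply: H2 => //; rewrite -zn; apply/colP => j; rewrite !mxE !ReImE.
  by rewrite intrC !ReImE mulr0 add0r addr0 /headV !mxE mulrC.
under eq_esum do rewrite mulrC EFinM.
rewrite esumZ; [|by rewrite mulr_ge0 ?exprn_ge0 ?normc_ge0|by move=> a; rewrite lee_fin normc_ge0].
apply: (le_trans (lee_wpmul2l _ (H1 tau (headV z) tv nu1))).
  by rewrite lee_fin mulr_ge0 ?exprn_ge0 ?normc_ge0.
by rewrite -EFinM lee_fin exprS; lra.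
Qed.

Lemma latR_cons (n : nat) (a : int) (u : 'cV[int]_n) :
  lat R (consV a u) = consV (a%:~R) (lat R u).
Proof. by rewrite -[LHS]consV_headtail /lat headV_map tailV_map headV_cons tailV_cons. Qed.

Lemma esum_qd_bound n (D : tri n) (A : R) (rho : 'cV[R]_n) : tri_pos D -> 0 < A ->
  exists K : R, (\esum_(mu in [set: 'cV[int]_n])
    (expR (- (A * qd D (lat R mu)) + dotv rho (lat R mu)))%:E <= K%:E)%E.
Proof.
move=> + A0; elim: n D rho => [|n IH] D rho.
  move=> _; exists 1.
  have -> : [set: 'cV[int]_0] = [set 0].
    by apply/seteqP; split => // u _ /=; apply/colP; case.
  by rewrite esum_set1 ?lee_fin ?expR_ge0// dotv0 mulr0 oppr0 addr0 expR0.
move=> [s0 pD].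
have [K2 H2] := IH D.2 (tailV rho + headV rho *: D.1.2) pD.
have As : 0 < A / D.1.1 by rewrite divr_gt0.
pose K1 := expR (headV rho ^+ 2 / (4 * (A / D.1.1))) * gsum_bound (A / D.1.1).
have K10 : 0 <= K1 by rewrite mulr_ge0 ?expR_ge0 ?gsum_bound_ge0.
exists (K1 * K2).
(* Here the tail is the outer variable: in the inverse form the head appears in a Gaussian whose
   centre depends on the tail, and [esum_gauss_lin_int] is uniform in that centre. *)
have be : bijective (fun p : 'cV[int]_n * int => consV p.2 p.1).
  have [g h1 h2] := @consV_bij int n.
  exists (fun u => ((g u).2, (g u).1)) => [[u a]|u] /=.
    by rewrite (h1 (a, u)).
  exact: h2.
rewrite (esum_bij _ be).
have E (a : int) (u : 'cV[int]_n) :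
  expR (- (A * qd D (lat R (consV a u))) + dotv rho (lat R (consV a u))) =
  expR (- (A * qd D.2 (lat R u)) + dotv (tailV rho + headV rho *: D.1.2) (lat R u)) *
  expR (- (A / D.1.1 * (- dotv D.1.2 (lat R u) + a%:~R) ^+ 2) + headV rho * (- dotv D.1.2 (lat R u) + a%:~R)).
  rewrite -expRD latR_cons /= dotvS !headV_cons !tailV_cons; congr expR.
  rewrite [dotv (_ + _) _]dotvC dotvDr dotvZr !(dotvC (lat R u)); field.
  by rewrite gt_eqF.
rewrite [leLHS](_ : _ = \esum_(p in [set: 'cV[int]_n * int])
   (expR (- (A * qd D (lat R (consV p.2 p.1))) + dotv rho (lat R (consV p.2 p.1))))%:E)%E//.
apply: (le_trans (esum_pair_le (b := fun u : 'cV[int]_n =>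
   expR (- (A * qd D.2 (lat R u)) + dotv (tailV rho + headV rho *: D.1.2) (lat R u)) * K1) _ _)).
- by move=> p; exact: expR_ge0.
- move=> u; under eq_esum do rewrite /fst /snd E EFinM.
  rewrite esumZ ?expR_ge0//.
  rewrite EFinM; apply: lee_wpmul2l; first by rewrite lee_fin expR_ge0.
  exact: esum_gauss_lin_int.
under eq_esum do rewrite mulrC EFinM.
rewrite esumZ//.
by rewrite [X in (_ <= X)%E]EFinM; apply: lee_wpmul2l.
Qed.

End TriangularForms.

(** * Theta inversion by induction on the number of variables *)

Section ThetaInversion.
Variable R : realType.
Local Notation esumT f := (\esum_(t in [set: _]) (f t)%:E)%E.
Local Notation csm f := (csummable [set: _] f).
Local Notation csumT f := (csum [set: _] f).

Lemma decays_shift M (s : R) (f : R -> R[i]) : decays M f ->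
  decays (M * (2 * (1 + s ^+ 2))) (fun t => f (t + s)).
Proof.
move=> df t; have M0 : 0 <= M.
  by have := df 0; rewrite expr0n addr0 divr1; apply: le_trans; exact: normc_ge0.
apply: (le_trans (df (t + s))); rewrite -mulrA ler_wpM2l//.
have p1 (x : R) : 0 < 1 + x ^+ 2 by rewrite ltr_pwDl// sqr_ge0.
rewrite ler_pdivlMr// ler_pdivrMl//.
have := sqr_ge0 (t + 2 * s); have := sqr_ge0 (s * (t + s)); have := sqr_ge0 s; have := sqr_ge0 (t + s).
nra.
Qed.

Lemma decaysZ M c (f : R -> R[i]) : decays M f -> decays (normc c * M) (fun t => c * f t).
Proof. by move=> df t; rewrite Normc.normcM -mulrA ler_wpM2l ?normc_ge0. Qed.

(** Turns the weight 1 + |l| required by [poisson_summation] into two exponentials, which merely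
    alter the linear term of a Gaussian exponent. *)
Lemma oneDabs_le_exp (l : int) : 1 + `|l|%:~R <= expR l%:~R + expR (- l%:~R) :> R.
Proof.
have h (x : R) : 0 <= x -> 1 + x <= expR x + expR (- x).
  by move=> x0; apply: (le_trans (expR_ge1Dx x)); rewrite lerDl expR_ge0.
have -> : `|l|%:~R = `|l%:~R| :> R by rewrite intr_norm.
have [l0|l0] := leP 0 (l%:~R : R); first by rewrite ger0_norm// h.
rewrite ltr0_norm// [leRHS]addrC; have := h (- l%:~R); rewrite oppr_ge0 opprK; apply; exact: ltW.
Qed.

(** The one-variable inversion. The linear term with [be] is what the dual vector of the remaining
    coordinates contributes to the first one. *)
Lemma gauss_poisson (b z : R[i]) (be : R) : complex.Im b < 0 ->
  let c (l : int) := kappa b * epii ((l%:~R - be%:C) ^+ 2 / b) * epii (2 * l%:~R * z) in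
  [/\ csm (fun n : int => epii (- (b * (z + n%:~R) ^+ 2) + 2 * be%:C * (z + n%:~R))),
      csm c &
      csumT (fun n : int => epii (- (b * (z + n%:~R) ^+ 2) + 2 * be%:C * (z + n%:~R))) = csumT c].
Proof.
move=> b0 c; have bn0 := Im_lt0_neq0 b0.
pose w := z - be%:C / b; pose k0 := epii (be%:C ^+ 2 / b).
pose dg (t : R) := gauss b (w + t%:C * 1) * (pi%:C * 'i * (- (b * (2 * (w + t%:C * 1))))) * 1.
pose f (t : R) := k0 * gauss b (t%:C + w).
have fE (t : R) : f t = epii (- (b * (z + t%:C) ^+ 2) + 2 * be%:C * (z + t%:C)).
  by rewrite /f /k0 /gauss -epiiD /w; congr epii; field.
have der t : cderive f t (k0 * dg t).
  apply: cderiveZ; rewrite (_ : (fun t => gauss b (t%:C + w)) = (fun t => gauss b (w + t%:C * 1))).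
    exact: (@hol_gauss R setT b w 1 t).
  by apply/funext => s; rewrite mulr1 addrC.
pose y := complex.Im w; pose Y : R := `|y| + 1.
have Yy : - Y < y < Y by rewrite -ltr_norml /Y ltrDl.
have [M [d1 d2]] := gauss_line_decay Y b0.
have E1 (t : R) : t%:C + w = (t + complex.Re w) +i* y.
  by apply: complex_ext; rewrite !ReImE ?add0r.
pose M' := normc k0 * (M * (2 * (1 + complex.Re w ^+ 2))).
have dec1 : decays M' f.
  apply: decaysZ => t; rewrite E1; exact: (decays_shift (complex.Re w) (d1 y Yy)).
have dec2 : decays M' (fun t => k0 * dg t).
  apply: decaysZ => t; rewrite /dg !mulr1 [w + _]addrC E1.
  exact: (decays_shift (complex.Re w) (d2 y Yy)).
have fh l : fourier f l = c l.
  rewrite /fourier /c -[RHS]mulrC -(gauss_integral_quad _ z)//.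
  congr cintegral; apply/funext => t; rewrite fE -!epiiD; congr epii.
  by rewrite intrN; ring.
pose A := pi * complex.Im b^-1.
have A0 : 0 < A.
  rewrite mulr_gt0 ?pi_gt0// Im_inv oppr_gt0 pmulr_llt0// invr_gt0.
  by rewrite -!expr2 -normc_sqr exprn_gt0// normc_gt0.
have cb l : normc (c l) = normc (kappa b) * expR (- (A * (- be + l%:~R) ^+ 2) - 2 * pi * complex.Im z * l%:~R).
  rewrite /c (Normc.normcM (kappa b * _)) (Normc.normcM (kappa b)) -mulrA; congr (_ * _); rewrite !normc_epii -expRD; congr expR.
  rewrite intrC -realCN -realCD -realCX natrC -realCM /A !ReImE; ring.
have sum1 : csm (fun l : int => (1 + `|l|%:~R) * fourier f l).
  pose rho (e : R) := e - 2 * pi * complex.Im z.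
  pose g (e : R) (l : int) := normc (kappa b) * expR (rho e * be) *
     expR (- (A * (- be + l%:~R) ^+ 2) + rho e * (- be + l%:~R)).
  apply: (csummable_le (g := fun l => g 1 l + g (-1) l)).
    move=> l; rewrite fh Normc.normcM cb intrC -realCD normc_real ger0_norm ?addr_ge0 ?ler0z//.
    have gE e : g e l = expR (e * l%:~R) * (normc (kappa b) * expR (- (A * (- be + l%:~R) ^+ 2) - 2 * pi * complex.Im z * l%:~R)).
      rewrite /g -[LHS]mulrA -expRD [RHS]mulrCA -expRD; congr (_ * expR _); rewrite /rho; ring.
    rewrite !gE -mulrDl ler_wpM2r ?mulr_ge0 ?normc_ge0 ?expR_ge0// mul1r mulN1r.
    exact: oneDabs_le_exp.
  have gs e : (esumT (g e) < +oo)%E.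
    under eq_esum do rewrite /g EFinM.
    rewrite esumZ ?mulr_ge0 ?normc_ge0 ?expR_ge0//.
    apply: le_lt_trans (lee_wpmul2l _ (esum_gauss_lin_int _ _ A0)) _.
      by rewrite lee_fin mulr_ge0 ?normc_ge0 ?expR_ge0.
    by rewrite -EFinM ltry.
  under eq_esum do rewrite EFinD.
  rewrite esumD; [by rewrite lte_add_pinfty|move=> l _..];
    by rewrite lee_fin !mulr_ge0 ?normc_ge0 ?expR_ge0.
have [p1 p2 p3] := poisson_summation der dec1 dec2 sum1.
have fn (n : int) : f n%:~R = epii (- (b * (z + n%:~R) ^+ 2) + 2 * be%:C * (z + n%:~R)).
  by rewrite fE -intrC.
split.
- by apply: csummable_norm_le p1 => n; rewrite fn.
- by apply: csummable_norm_le p2 => l; rewrite fh.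
- rewrite (_ : (fun n : int => epii _) = (fun n : int => f n%:~R)).
    by rewrite p3; congr csum; apply/funext => l.
  by apply/funext => n; rewrite fn.
Qed.

Variable m : R.
Hypothesis m0 : 0 < m.

Definition theta_dual n (D : tri R n) (tau : R[i]) (z : 'cV[R[i]]_n) (mu : 'cV[int]_n) : R[i] :=
  gauss_factor m D tau * epii ((qd D (lat R mu))%:C * tau / m%:C) * epii (2 * dotv (lat R[i] mu) z).

Lemma lat_cvec n (mu : 'cV[int]_n) : lat R[i] mu = cvec (lat R mu).
Proof. by apply/colP => j; rewrite !mxE intrC. Qed.

Lemma theta_dual_summable n (D : tri R n) tau z : tri_pos D -> 0 < complex.Im tau ->
  csm (theta_dual D tau z).
Proof.
move=> pD t0.
have A0 : 0 < pi * complex.Im tau / m by rewrite divr_gt0 ?mulr_gt0 ?pi_gt0.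
have [K HK] := esum_qd_bound (map_mx (fun x => - (2 * pi * complex.Im x)) z) pD A0.
apply: (csummable_le (g := fun mu => normc (gauss_factor m D tau) *
   expR (- (pi * complex.Im tau / m * qd D (lat R mu)) + dotv (map_mx (fun x => - (2 * pi * complex.Im x)) z) (lat R mu)))).
  move=> mu; rewrite /theta_dual (Normc.normcM (gauss_factor m D tau * _)) (Normc.normcM (gauss_factor m D tau)) -mulrA !normc_epii -expRD.
  rewrite ler_wpM2l ?normc_ge0// le_eqVlt; apply/orP; left; apply/eqP; congr expR.
  rewrite lat_cvec natrC [complex.Im (2%:C * _)]Im_mul Re_cplx Im_cplx mul0r addr0 Im_dotv.
  rewrite -realCV -mulrA Im_mul Re_real Im_real Im_mul Re_real Im_real; congr (_ + _); first by ring.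
  rewrite [dotv _ (lat R mu)]dotvC /dotv !mulr_sumr -sumrN; apply: eq_bigr => j _.
  by rewrite !mxE; ring.
under eq_esum do rewrite EFinM.
rewrite esumZ ?normc_ge0//.
apply: le_lt_trans (lee_wpmul2l _ HK) _; first by rewrite lee_fin normc_ge0.
by rewrite -EFinM ltry.
Qed.

Lemma theta_primal_summable n (D : tri R n) tau z : tri_pos D -> 0 < complex.Im tau ->
  csm (fun la : 'cV[int]_n => epii (- (m%:C / tau * qf D (z + lat R[i] la)))).
Proof.
move=> pD t0; apply/csummableE.
have [K _ HK] := esum_qf_bound m0 (map_mx (@complex.Im R) z) pD t0.
by apply: le_lt_trans (HK tau z (erefl _) (erefl _)) _; rewrite ltry.
Qed.

(** Invert in the tail for each fixed head, exchange the two sums, then apply [gauss_poisson] to the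
    head for each dual vector of the tail. *)
Lemma theta_inversion n (D : tri R n) tau z : tri_pos D -> 0 < complex.Im tau ->
  csumT (fun la : 'cV[int]_n => epii (- (m%:C / tau * qf D (z + lat R[i] la)))) =
  csumT (theta_dual D tau z).
Proof.
move=> + t0; elim: n D z => [|n IH] D z pD.
  have E (f : 'cV[int]_0 -> R[i]) : csumT f = f 0.
    have ub : bijective (fun _ : unit => 0 : 'cV[int]_0).
      by exists (fun=> tt) => [[]|u] //; apply/colP; case.
    rewrite (csum_bij _ ub) csum_fin (big_pred1 tt)// => -[]//.
  by rewrite !E /theta_dual /= dotv0 !mulr0 oppr0 !mul0r epii0 !mulr1.
have [s0 pD'] := pD; have bI := m_tau_Im m0 pD t0.
set b := (m * D.1.1)%:C / tau in bI.
have tn0 := Im_gt0_neq0 t0.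
have mn0 : m%:C != 0 :> R[i] by rewrite real_complex_eq0 gt_eqF.
have sn0 : D.1.1%:C != 0 :> R[i] by rewrite real_complex_eq0 gt_eqF.
have sP := theta_primal_summable z pD t0; have sQ := theta_dual_summable z pD t0.
pose X (a : int) := epii (- (b * (headV z + a%:~R) ^+ 2)).
pose be (u : 'cV[int]_n) : R := dotv (lat R u) D.1.2.
pose cc (u : 'cV[int]_n) := theta_dual D.2 tau (tailV z) u.
have EP (p : int * 'cV[int]_n) : epii (- (m%:C / tau * qf D (z + lat R[i] (consV p.1 p.2)))) =
   X p.1 * epii (- (m%:C / tau * qf D.2 ((tailV z + (headV z + (p.1)%:~R) *: cvec D.1.2) + lat R[i] p.2))).
  rewrite /X -epiiD lat_cons /= headVD tailVD headV_cons tailV_cons; congr epii.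
  rewrite /b realCM -[_ + _ + lat _ _]addrA [_ *: _ + lat _ _]addrC addrA; ring.
have EQ (p : 'cV[int]_n * int) : theta_dual D tau z (consV p.2 p.1) =
   cc p.1 * (kappa b * epii (((p.2)%:~R - (be p.1)%:C) ^+ 2 / b) * epii (2 * (p.2)%:~R * headV z)).
  rewrite /cc /theta_dual latR_cons lat_cons /= dotvS !headV_cons !tailV_cons -/b.
  have -> : (qd D.2 (lat R p.1) + ((p.2)%:~R - dotv D.1.2 (lat R p.1)) ^+ 2 / D.1.1)%:C * tau / m%:C =
     (qd D.2 (lat R p.1))%:C * tau / m%:C + ((p.2)%:~R - (be p.1)%:C) ^+ 2 / b.
    rewrite /b /be [dotv D.1.2 _]dotvC realCM intrC -realCN -realCD; move: (_ - _) => x.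
    rewrite realCD realCM realCV realCX; field.
    by rewrite mn0 sn0 tn0.
  by rewrite mulrDr !epiiD [2 * (p.2)%:~R * _]mulrAC -[2 * _ * _]mulrA [headV z * _]mulrC; ring.
have sP' : csm (fun p : int * 'cV[int]_n => X p.1 *
    epii (- (m%:C / tau * qf D.2 ((tailV z + (headV z + (p.1)%:~R) *: cvec D.1.2) + lat R[i] p.2)))).
  have := (csummable_bij _ (@consV_bij int n)).1 sP.
  by apply: csummable_norm_le => p; rewrite EP.
have be' : bijective (fun p : 'cV[int]_n * int => consV p.2 p.1).
  have [g h1 h2] := @consV_bij int n.
  exists (fun u => ((g u).2, (g u).1)) => [[u a]|u] /=; first by rewrite (h1 (a, u)).
  exact: h2.
have sQ' : csm (fun p : 'cV[int]_n * int => cc p.1 *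
    (kappa b * epii (((p.2)%:~R - (be p.1)%:C) ^+ 2 / b) * epii (2 * (p.2)%:~R * headV z))).
  have := (csummable_bij _ be').1 sQ.
  by apply: csummable_norm_le => p; rewrite EQ.
rewrite (csum_bij _ (@consV_bij int n)) (csum_bij _ be').
under eq_fun do rewrite EP.
under [in RHS]eq_fun do rewrite EQ.
rewrite (csum_pair sP') (csum_pair sQ') /fst /snd.
have gp u := gauss_poisson (headV z) (be u) bI.
(* Displacing the tail by a multiple of w multiplies the dual term by a character, whose frequency
   becomes the linear term of the one-variable sum. *)
have dE (a : int) (u : 'cV[int]_n) : theta_dual D.2 tau (tailV z + (headV z + a%:~R) *: cvec D.1.2) u =
   cc u * epii (2 * (be u)%:C * (headV z + a%:~R)).
  rewrite /cc /theta_dual dotvDr dotvZr mulrDr epiiD mulrA lat_cvec dotv_cvec -/(be u).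
  by congr (_ * epii _); ring.
pose Z (p : int * 'cV[int]_n) := X p.1 * (cc p.2 * epii (2 * (be p.2)%:C * (headV z + (p.1)%:~R))).
(* The modulus of the character e^{2 pi i be (z_1 + a)} does not depend on a, since [be] and a are
   real. So [Z] is dominated by a product of a family in a and a family in u. *)
have sZ : csm Z.
  have sX : csm X.
    have [h _ _] := gauss_poisson (headV z) 0 bI.
    by apply: csummable_norm_le h => a; rewrite /X mulr0 mul0r addr0.
  have sc := theta_dual_summable (tailV z + headV z *: cvec D.1.2) pD' t0.
  apply: csummable_norm_le (csummable_mul sX sc) => -[a u]; rewrite /Z /fst /snd.
  have := dE 0 u; rewrite addr0 => ->.
  rewrite (Normc.normcM (X a)) (Normc.normcM (cc u)) (Normc.normcM (X a)) (Normc.normcM (cc u)).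
  rewrite !ler_wpM2l ?normc_ge0// !normc_epii ler_expR lerN2 ler_wpM2l ?pi_ge0//.
  by rewrite intrC natrC -realCM !ReImE; lra.
transitivity (csumT (fun a : int => csumT (fun u : 'cV[int]_n => Z (a, u)))).
  congr csum; apply/funext => a.
  rewrite csumZ; last exact: theta_primal_summable.
  rewrite IH// -csumZ; last exact: theta_dual_summable.
  by congr csum; apply/funext => u; rewrite dE.
rewrite (csum_exchange sZ); congr csum; apply/funext => u.
have [h1 h2 h3] := gp u.
rewrite csumZ// -h3 -csumZ//; congr csum; apply/funext => a; rewrite /Z /fst /snd /X epiiD; ring.
Qed.

End ThetaInversion.

(** * Poisson summation in tau and z *)

Section DoublePoisson.
Variable R : realType.
Local Notation esumT f := (\esum_(t in [set: _]) (f t)%:E)%E.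
Local Notation csm f := (csummable [set: _] f).
Local Notation csumT f := (csum [set: _] f).

Lemma normc_inv (x : R[i]) : normc x^-1 = (normc x)^-1.
Proof.
have [->|x0] := eqVneq x 0; first by rewrite !invr0 Normc.normc0 invr0.
have nx : normc x != 0 by rewrite normc_eq0.
by apply: (mulfI nx); rewrite -Normc.normcM !mulfV// Normc.normc1.
Qed.

(** Combine (1 + x)(1 + x^2) <= (1 + x)^3, 1 + x <= (1 + 3/d)(1 + d x/3) and (1 + d x/3)^3 <= e^{d
    x}. *)
Lemma oneD_exp_le (d x : R) : 0 < d -> 0 <= x ->
  (1 + x) * expR (- (d * x)) <= (1 + 3 / d) ^+ 3 / (1 + x ^+ 2).
Proof.
move=> d0 x0.
have d3 : 0 <= 3 / d by rewrite divr_ge0// ltW.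
have dx : 0 <= d * x / 3 by rewrite divr_ge0// mulr_ge0// ltW.
have p1 : 0 < 1 + x ^+ 2 by rewrite ltr_pwDl// sqr_ge0.
rewrite ler_pdivlMr// expRN mulrAC ler_pdivrMr ?expR_gt0//.
have h1 : 1 + x <= (1 + 3 / d) * (1 + d * x / 3).
  have -> : (1 + 3 / d) * (1 + d * x / 3) = 1 + x + 3 / d + d * x / 3 by field; rewrite gt_eqF.
  by lra.
have h2 : (1 + d * x / 3) ^+ 3 <= expR (d * x).
  rewrite [in leRHS](_ : d * x = (d * x / 3) * 3%:R); last by field.
  by rewrite expRM_natr lerXn2r ?nnegrE ?expR_ge0 ?expR_ge1Dx// addr_ge0.
apply: (@le_trans _ _ ((1 + x) ^+ 3)).
  by rewrite exprS ler_wpM2l ?addr_ge0//; nra.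
apply: (le_trans (lerXn2r 3 _ _ h1)); rewrite ?nnegrE.
- by rewrite addr_ge0.
- by rewrite mulr_ge0 ?addr_ge0.
- by rewrite exprMn ler_wpM2l ?exprn_ge0 ?addr_ge0.
Qed.

Lemma esum_int_exp (d : R) : 0 < d -> exists2 B : R, 0 <= B &
  (\esum_(l in [set: int]) ((1 + `|l|%:~R) * expR (- (d * `|l|%:~R)))%:E <= B%:E)%E.
Proof.
move=> d0; pose c := (1 + 3 / d) ^+ 3.
have c0 : 0 <= c by rewrite exprn_ge0// addr_ge0// divr_ge0// ltW.
exists (c * 6); first by rewrite mulr_ge0.
apply: (@le_trans _ _ (\esum_(l in [set: int]) (c%:E * (1 + (0 + l%:~R) ^+ 2)^-1%:E))%E).
  apply: le_esum => l _; rewrite -EFinM lee_fin add0r.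
  have -> : (l%:~R : R) ^+ 2 = (`|l|%:~R) ^+ 2 by rewrite intr_norm real_normK ?num_real.
  by apply: oneD_exp_le; rewrite // ler0z.
rewrite esumZ//; last by move=> l; rewrite lee_fin invr_ge0 addr_ge0 ?sqr_ge0.
rewrite [X in (_ <= X)%E]EFinM lee_wpmul2l ?lee_fin//.
exact: esum_int_inv_oneDsqr.
Qed.

Lemma dotvr0 (A : pzRingType) d (u : 'cV[A]_d) : dotv u 0 = 0.
Proof. by rewrite /dotv big1// => j _; rewrite [X in _ * X]mxE mulr0. Qed.

Variables (m : R) (n : nat) (D : tri R n) (k : nat).
Hypotheses (m0 : 0 < m) (pD : tri_pos D) (kn : (n + 2 <= k)%N).

Lemma qd_ge0 mu : 0 <= qd D mu.
Proof.
move: pD mu; elim: n D => [|n' IH] D' //= [s0 pD'] mu.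
by rewrite addr_ge0 ?IH// divr_ge0 ?sqr_ge0 ?ltW.
Qed.

(** Here k >= n + 2 makes the integrand decay: of the surplus power of |tau|, two factors become
    1/(1 + Re(tau)^2) through 1 <= |tau|^2/v0^2, and the rest is bounded by a power of v0. *)
Lemma tau_pow_bound (v0 : R) : 0 < v0 -> exists2 C : R, 0 <= C &
  forall tau : R[i], v0 <= complex.Im tau ->
    normc tau ^- k * normc tau ^+ n <= C / (1 + complex.Re tau ^+ 2).
Proof.
move=> v00; exists (v0 ^- (k - (n + 2)) * (1 + v0 ^- 2)).
  by rewrite mulr_ge0 ?addr_ge0 ?invr_ge0 ?exprn_ge0// ltW.
move=> tau vt; have t0 := lt_le_trans v00 vt.
have nt : v0 <= normc tau by apply: (le_trans vt); apply: le_trans (normc_Im _); exact: ler_norm.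
have nt0 := lt_le_trans v00 nt; have ntn : normc tau != 0 by rewrite gt_eqF.
have p1 : 0 < 1 + complex.Re tau ^+ 2 by rewrite ltr_pwDl// sqr_ge0.
have -> : normc tau ^- k * normc tau ^+ n = normc tau ^- (k - (n + 2)) * normc tau ^- 2.
  rewrite -{1}(subnK kn) !exprD.
  have := expf_neq0 (k - (n + 2)) ntn; have := expf_neq0 n ntn.
  move: (_ ^+ (k - (n + 2))) (_ ^+ n) => X Y X0 Y0; field; by rewrite ntn X0 Y0.
rewrite -mulrA; apply: ler_pM; rewrite ?invr_ge0 ?exprn_ge0 ?normc_ge0//.
  by rewrite lef_pV2 ?posrE ?exprn_gt0// lerXn2r ?nnegrE ?normc_ge0// ltW.
rewrite ler_pdivlMr// ler_pdivrMl ?exprn_gt0// mulrDr mulr1 normc_sqr addrC lerD//.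
  by rewrite lerDl sqr_ge0.
rewrite -normc_sqr -(ler_pM2r (exprn_gt0 2 v00)) -mulrA mulVf ?mulr1 ?mul1r; last by rewrite expf_eq0/= gt_eqF.
by rewrite lerXn2r ?nnegrE ?normc_ge0// ltW.
Qed.

(** The coefficient of e^{2 pi i mu.z} produced by Poisson summation in z, as a function of tau. *)
Definition fmu (mu : 'cV[R]_n) (tau : R[i]) : R[i] :=
  tau ^- k * (gauss_factor m D tau * epii ((qd D mu)%:C * tau / m%:C)).

(** The logarithmic derivative of [fmu]: the Gaussian factor gives n/(2 tau), the power gives
    -k/tau, the exponential a constant. *)
Definition log_fmu (mu : 'cV[R]_n) (tau : R[i]) : R[i] :=
  (n%:R / 2 - k%:R) / tau + pi%:C * 'i * ((qd D mu)%:C / m%:C).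

Lemma hol_fmu mu : hol (@upper R) (fmu mu) (fun tau => log_fmu mu tau * fmu mu tau).
Proof.
have u0 (z : R[i]) : upper z -> z ^+ k != 0 by move=> z0; rewrite expf_neq0// Im_gt0_neq0.
have h1 := holV u0 (holX k (@hol_id R (@upper R))).
have h2 := hol_gauss_factor m0 pD.
have h3 := hol_epii (holZ ((qd D mu)%:C / m%:C) (@hol_id R (@upper R))).
apply: (hol_eq (holM h1 (holM h2 h3))) => z.
  by rewrite /fmu; congr (_ * (_ * epii _)); rewrite mulrAC.
move=> z0; have zn := Im_gt0_neq0 z0; rewrite /fmu /log_fmu [_ * z / _]mulrAC mulr1.
have -> : - (k%:R * z ^+ k.-1 / z ^+ k ^+ 2) = - (k%:R / z) * z ^- k.
  have -> : z ^+ k = z ^+ k.-1 * z.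
    by rewrite -exprSr prednK//; apply: leq_trans kn; rewrite addn2.
  have := expf_neq0 k.-1 zn; move: (z ^+ k.-1) => Z Z0; field; by rewrite zn Z0.
have := expf_neq0 k zn; rewrite mulr1; move: (z ^+ k) (gauss_factor m D z) (epii ((qd D mu)%:C / m%:C * z)) (pi%:C * 'i * ((qd D mu)%:C / m%:C)) => Z G E Q Z0.
by field; rewrite zn Z0.
Qed.

Lemma fmu_bound (v0 : R) : 0 < v0 -> exists2 K : R, 0 <= K &
  forall mu tau, v0 <= complex.Im tau ->
    normc (fmu mu tau) <= K / (1 + complex.Re tau ^+ 2) *
      expR (- (pi * complex.Im tau / m * qd D mu)).
Proof.
move=> v00; have [C C0 HC] := tau_pow_bound v00.
have [K K0 HK] := gauss_factor_bound m0 pD v00.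
exists (C * K) => [|mu tau vt]; first exact: mulr_ge0.
rewrite /fmu (Normc.normcM (tau ^- k)) (Normc.normcM (gauss_factor _ _ _)) mulrA normc_epii.
have -> : - (pi * complex.Im ((qd D mu)%:C * tau / m%:C)) = - (pi * complex.Im tau / m * qd D mu).
  by rewrite -realCV -mulrA Im_mul Re_real Im_real Im_mul Re_real Im_real; ring.
rewrite ler_wpM2r ?expR_ge0// normc_inv normcX.
apply: (@le_trans _ _ (normc tau ^- k * (K * normc tau ^+ n))).
  by rewrite ler_wpM2l ?invr_ge0 ?exprn_ge0 ?normc_ge0 ?HK.
rewrite [leLHS]mulrCA [leRHS](_ : _ = K * (C / (1 + complex.Re tau ^+ 2))); last by ring.
by rewrite ler_wpM2l ?HC.
Qed.

Definition fmul (l : int) mu (tau : R[i]) := fmu mu tau * epii (- (2 * l%:~R * tau)).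

Lemma hol_fmul l mu : hol (@upper R) (fmul l mu)
  (fun tau => (log_fmu mu tau - pi%:C * 'i * (2 * l%:~R)) * fmul l mu tau).
Proof.
have h := hol_epii (holZ (- (2 * l%:~R)) (@hol_id R (@upper R))).
apply: (hol_eq (holM (hol_fmu mu) h)) => z; first by rewrite /fmul mulNr.
by move=> _; rewrite /fmul mulNr; ring.
Qed.

Lemma normc_epiil l (tau : R[i]) : normc (epii (- (2 * l%:~R * tau))) = expR (2 * pi * l%:~R * complex.Im tau).
Proof.
rewrite normc_epii; congr expR; rewrite Im_opp natrC intrC -realCM Im_mul Re_real Im_real; ring.
Qed.

Lemma fmul_bound (v0 : R) : 0 < v0 -> exists2 K : R, 0 <= K &
  forall l mu tau, v0 <= complex.Im tau ->
    normc (fmul l mu tau) <= K / (1 + complex.Re tau ^+ 2) *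
      expR (- (pi * complex.Im tau / m * qd D mu) + 2 * pi * l%:~R * complex.Im tau).
Proof.
move=> v00; have [K K0 HK] := fmu_bound v00; exists K => // l mu tau vt.
by rewrite /fmul (Normc.normcM (fmu _ _)) normc_epiil expRD mulrA ler_wpM2r ?expR_ge0// HK.
Qed.

Lemma log_fmu_bound l mu (v0 : R) : 0 < v0 -> exists2 K : R, 0 <= K &
  forall tau, v0 <= complex.Im tau -> normc (log_fmu mu tau - pi%:C * 'i * (2 * l%:~R)) <= K.
Proof.
move=> v00; set c := n%:R / 2 - k%:R : R[i]; set d := pi%:C * 'i * ((qd D mu)%:C / m%:C) - pi%:C * 'i * (2 * l%:~R).
exists (normc c / v0 + normc d) => [|tau vt]; first by rewrite addr_ge0 ?divr_ge0 ?normc_ge0 ?ltW.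
rewrite /log_fmu -/c -addrA -/d; apply: (le_trans (le_normcD _ _)).
rewrite lerD2r (Normc.normcM c) normc_inv ler_wpM2l ?normc_ge0//.
have nt : v0 <= normc tau by apply: (le_trans vt); apply: le_trans (normc_Im _); exact: ler_norm.
by rewrite lef_pV2 ?posrE// (lt_le_trans v00).
Qed.

Lemma upper_line (y : R) : 0 < y -> forall t : R, upper (t +i* y).
Proof. by []. Qed.

(* The coefficient gamma(l, h) for h = 2 S^-1 mu. *)
Definition gam (y : R) (l : int) mu : R[i] := cintegral (line (fmul l mu) y).

Lemma ccont_fmul l mu y : 0 < y -> ccont (line (fmul l mu) y).
Proof. by move=> y0; apply: hol_ccont (hol_fmul l mu) _; exact: upper_line. Qed.

(** Only continuity of the first derivative on horizontal lines is wanted, so the second derivative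
    is left unnamed. *)
Lemma hol_dfmul l mu : exists ddF, hol (@upper R)
  (fun tau => (log_fmu mu tau - pi%:C * 'i * (2 * l%:~R)) * fmul l mu tau) ddF.
Proof.
have u0 (z : R[i]) : upper z -> z != 0 by exact: Im_gt0_neq0.
have h1 := holD (holD (holZ (n%:R / 2 - k%:R) (holV u0 (@hol_id R (@upper R))))
  (@hol_cst R (@upper R) (pi%:C * 'i * ((qd D mu)%:C / m%:C))))
  (@hol_cst R (@upper R) (- (pi%:C * 'i * (2 * l%:~R)))).
by eexists; exact: (holM h1 (hol_fmul l mu)).
Qed.

Lemma gam_indep (y1 y2 : R) l mu : 0 < y1 -> 0 < y2 -> gam y1 l mu = gam y2 l mu.
Proof.
move=> y10 y20; wlog y12 : y1 y2 y10 y20 / y1 <= y2.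
  by move=> H; have [/H->//|/ltW/H->//] := leP y1 y2.
pose a := y1 / 2; pose b := y2 + 1.
have a0 : 0 < a by rewrite divr_gt0.
have [K K0 HK] := fmul_bound a0; have [C C0 HC] := log_fmu_bound l mu a0.
have sub : strip a b `<=` @upper R by move=> z /= /andP[az _]; exact: lt_trans az.
(* Since [qd] is nonnegative, only the factor e^{2 pi l y} can exceed 1, and on the strip it is at
   most [E]. *)
pose E := expR (2 * pi * `|l%:~R| * b).
have E0 : 0 <= E := expR_ge0 _.
have M1 (y t : R) : a < y < b -> normc (fmul l mu (t +i* y)) <= K * E / (1 + t ^+ 2).
  move=> /andP[ay yb]; apply: (le_trans (HK l mu (t +i* y) (ltW ay))).
  rewrite Re_cplx Im_cplx [leRHS]mulrAC ler_wpM2l ?divr_ge0 ?addr_ge0 ?sqr_ge0//.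
  rewrite ler_expR -[leRHS]add0r lerD//.
    rewrite oppr_le0 mulr_ge0 ?qd_ge0// divr_ge0 ?(ltW m0)// mulr_ge0 ?pi_ge0//.
    by rewrite ltW// (lt_trans a0).
  have p2 : 0 <= 2 * pi :> R by rewrite mulr_ge0 ?pi_ge0.
  rewrite -!(mulrA (2 * pi)) ler_wpM2l// (le_trans (ler_norm _))// normrM ler_wpM2l//.
  by rewrite ger0_norm ?ltW// (lt_trans a0).
have [ddF hdd] := hol_dfmul l mu.
apply: (proj2 (@cintegral_shift R (fmul l mu) _ a b (K * E + C * (K * E))
  (hol_sub sub (hol_fmul l mu)) _ _ _)).
- move=> y aby t; apply: (le_trans (M1 y t aby)).
  rewrite ler_wpM2r ?invr_ge0 ?addr_ge0 ?sqr_ge0// lerDl mulr_ge0// mulr_ge0//.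
- move=> y aby t; have /andP[ay _] := aby.
  rewrite /line (Normc.normcM (_ - _)).
  apply: (le_trans (ler_pM (normc_ge0 _) (normc_ge0 _) (HC (t +i* y) (ltW ay)) (M1 y t aby))).
  rewrite [leLHS]mulrA ler_wpM2r ?invr_ge0 ?addr_ge0 ?sqr_ge0// lerDr mulr_ge0// mulr_ge0.
- move=> y /andP[ay _]; apply: hol_ccont hdd _; apply: upper_line; exact: lt_trans ay.
- by rewrite /a /b; lra.
- by rewrite /a /b; lra.
Qed.

Lemma gam_bound (y : R) : 0 < y -> exists2 C : R, 0 <= C & forall l mu,
  normc (gam y l mu) <= C * expR (- (pi * y / m * qd D mu) + 2 * pi * l%:~R * y).
Proof.
move=> y0; have [K K0 HK] := fmul_bound y0; exists (2 * pi * K).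
  by rewrite !mulr_ge0 ?pi_ge0.
move=> l mu; set E := expR _.
have dec : decays (K * E) (line (fmul l mu) y).
  by move=> t; rewrite [leRHS]mulrAC; have := HK l mu (t +i* y) (lexx y).
apply: (le_trans (cintegral_decay_le (ccont_fmul l mu y0) dec)).
by rewrite le_eqVlt; apply/orP; left; apply/eqP; ring.
Qed.

Lemma gam_decay (y v : R) : 0 < y -> 0 < v -> exists2 C : R, 0 <= C & forall l mu,
  normc (gam y l mu) * expR (- (2 * pi * l%:~R * v)) <=
  C * expR (- (pi * v * `|l|%:~R)) * expR (- (pi * (v / 2) / m * qd D mu)).
Proof.
(* Evaluating at height v/2 for l >= 0 and at 3v/2 for l < 0 leaves the factor e^{-pi v |l|} in both
   cases. Both heights are at least v/2, which gives the common Gaussian factor in mu. *)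
move=> y0 v0; pose y1 := v / 2; pose y2 := v + v / 2.
have y10 : 0 < y1 by rewrite divr_gt0.
have y20 : 0 < y2 by rewrite addr_gt0.
have [C1 C10 H1] := gam_bound y10; have [C2 C20 H2] := gam_bound y20.
have q0 mu : 0 <= pi * v / m * qd D mu.
  by rewrite mulr_ge0 ?qd_ge0// divr_ge0 ?(ltW m0)// mulr_ge0 ?pi_ge0// ltW.
exists (C1 + C2) => [|l mu]; first exact: addr_ge0.
have key (z C : R) : 0 <= C -> C <= C1 + C2 -> 0 < z -> v / 2 <= z ->
    normc (gam z l mu) <= C * expR (- (pi * z / m * qd D mu) + 2 * pi * l%:~R * z) ->
    2 * pi * l%:~R * (z - v) = - (pi * v * `|l|%:~R) ->
    normc (gam y l mu) * expR (- (2 * pi * l%:~R * v)) <=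
    (C1 + C2) * expR (- (pi * v * `|l|%:~R)) * expR (- (pi * (v / 2) / m * qd D mu)).
  move=> C0 CC z0 vz H E; rewrite (gam_indep l mu y0 z0).
  apply: (le_trans (ler_wpM2r (expR_ge0 _) H)); rewrite -[leLHS]mulrA -expRD -[leRHS]mulrA -expRD.
  apply: ler_pM; rewrite ?expR_ge0// ler_expR -E.
  have : pi * (v / 2) / m * qd D mu <= pi * z / m * qd D mu.
    by rewrite ler_wpM2r ?qd_ge0// ler_wpM2r ?invr_ge0 ?(ltW m0)// ler_wpM2l ?pi_ge0.
  by lra.
have [l0|l0] := leP 0 l.
  apply: (key y1 C1) => //; first by rewrite lerDl.
  by rewrite ger0_norm// /y1; field.
apply: (key y2 C2) => //; first by rewrite lerDr.
  by rewrite /y2; lra.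
by rewrite ltr0_norm// intrN /y2; field.
Qed.

Definition jterm (y : R) (tau : R[i]) (z : 'cV[R[i]]_n) (p : int * 'cV[int]_n) : R[i] :=
  gam y p.1 (lat R p.2) * epii (2 * p.1%:~R * tau) * epii (2 * dotv (lat R[i] p.2) z).

Lemma normc_epii_lin (l : int) (tau : R[i]) : normc (epii (2 * l%:~R * tau)) =
  expR (- (2 * pi * l%:~R * complex.Im tau)).
Proof. by rewrite normc_epii; congr expR; rewrite natrC intrC -realCM Im_mul Re_real Im_real; ring. Qed.

Lemma normc_epii_dot (mu : 'cV[int]_n) (z : 'cV[R[i]]_n) : normc (epii (2 * dotv (lat R[i] mu) z)) =
  expR (dotv (map_mx (fun x => - (2 * pi * complex.Im x)) z) (lat R mu)).
Proof.
rewrite normc_epii; congr expR; rewrite natrC Im_mul Re_real Im_real mul0r addr0 lat_cvec Im_dotv.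
rewrite [RHS]dotvC /dotv !mulr_sumr -sumrN; apply: eq_bigr => j _.
by rewrite !mxE; ring.
Qed.

Lemma jterm_summable_strong y tau z : 0 < y -> 0 < complex.Im tau ->
  csm (fun p => (1 + `|p.1|%:~R) * jterm y tau z p).
Proof.
move=> y0 t0; set v := complex.Im tau in t0.
have [C C0 HC] := gam_decay y0 t0.
have A0 : 0 < pi * (v / 2) / m by rewrite divr_gt0// mulr_gt0 ?pi_gt0// divr_gt0.
pose rho := map_mx (fun x => - (2 * pi * complex.Im x)) z.
have [K2 H2] := esum_qd_bound rho pD A0.
have [B B0 HB] := esum_int_exp (mulr_gt0 (pi_gt0 R) t0).
pose g1 (l : int) : R := (1 + `|l|%:~R) * expR (- (pi * v * `|l|%:~R)).
pose g2 (mu : 'cV[int]_n) : R := expR (- (pi * (v / 2) / m * qd D (lat R mu)) + dotv rho (lat R mu)).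
have g10 l : 0 <= g1 l by rewrite mulr_ge0 ?expR_ge0// addr_ge0// ler0z.
have K20 : 0 <= K2.
  by rewrite -lee_fin (le_trans _ H2)//; apply: esum_ge0 => mu _; rewrite lee_fin expR_ge0.
apply: (csummable_le (g := fun p => C * (g1 p.1 * g2 p.2))).
  move=> [l mu]; rewrite /fst /snd /jterm (Normc.normcM (1 + _)) (Normc.normcM (gam _ _ _ * _)) (Normc.normcM (gam _ _ _)).
  rewrite normc_epii_lin normc_epii_dot -/rho -/v intrC -realCD normc_real ger0_norm; last by rewrite addr_ge0// ler0z.
  rewrite /g1 /g2 expRD; have := HC l (lat R mu); set X := _ * expR _ => h.
  rewrite [leRHS](_ : _ = (1 + `|l|%:~R) * ((C * expR (- (pi * v * `|l|%:~R)) * expR (- (pi * (v / 2) / m * qd D (lat R mu)))) * expR (dotv rho (lat R mu)))); last by ring.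
  by rewrite ler_wpM2l ?addr_ge0 ?ler0z// ler_wpM2r ?expR_ge0.
apply: (@le_lt_trans _ _ (\esum_(l in [set: int]) ((C * K2)%:E * (g1 l)%:E))%E).
  apply: (@le_trans _ _ (esumT (fun l : int => (C * K2) * g1 l))); last by under eq_esum do rewrite EFinM.
  apply: esum_pair_le => [p|l]; first by rewrite !mulr_ge0 ?expR_ge0.
  under eq_esum do rewrite /fst /snd mulrA EFinM.
  rewrite esumZ ?mulr_ge0//; last by move=> mu; rewrite lee_fin expR_ge0.
  by rewrite [X in (_ <= X)%E](_ : _ = ((C * g1 l)%:E * K2%:E)%E) ?lee_wpmul2l ?lee_fin ?mulr_ge0// -EFinM mulrAC.
rewrite esumZ ?mulr_ge0//.
apply: (le_lt_trans (lee_wpmul2l _ HB)); first by rewrite lee_fin mulr_ge0.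
by rewrite -EFinM ltry.
Qed.

Lemma jterm_summable y tau z : 0 < y -> 0 < complex.Im tau -> csm (jterm y tau z).
Proof.
move=> y0 t0; apply: csummable_norm_le (jterm_summable_strong z y0 t0) => p.
rewrite (Normc.normcM (1 + _)) intrC -realCD normc_real ler_peMl ?normc_ge0//.
by rewrite ger0_norm ?addr_ge0 ?ler0z// lerDl ler0z.
Qed.

Definition jkernel (tau : R[i]) (z : 'cV[R[i]]_n) : R[i] :=
  tau ^- k * epii (- (m%:C / tau * qf D z)).

(** The bound sees only imaginary parts, so one [B] serves all the real translates by d/c and
    lambda/c, uniformly in c. *)
Lemma jkernel_esum_bound (v : R) (nu : 'cV[R]_n) : 0 < v -> exists2 B : R, 0 <= B &
  forall tau z, complex.Im tau = v -> map_mx (@complex.Im R) z = nu ->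
  (\esum_(p in [set: int * 'cV[int]_n])
     (normc (jkernel (tau + p.1%:~R) (z + lat R[i] p.2)))%:E <= B%:E)%E.
Proof.
move=> v0; have [K K0 HK] := esum_qf_bound m0 nu pD v0.
have [C C0 HC] := tau_pow_bound v0.
exists (K * C * 6) => [|tau z tv zn]; first by rewrite !mulr_ge0.
pose h (a : int) : R := (K * C) * (1 + (complex.Re tau + a%:~R) ^+ 2)^-1.
have h0 (a : int) : 0 <= (1 + (complex.Re tau + a%:~R) ^+ 2)^-1 by rewrite invr_ge0 addr_ge0 ?sqr_ge0.
apply: (@le_trans _ _ (esumT h)).
  apply: esum_pair_le => [p|a]; first exact: normc_ge0.
  have Ia : complex.Im (tau + a%:~R) = v by rewrite intrC Im_add Im_real addr0.
  have Ra : complex.Re (tau + a%:~R) = complex.Re tau + a%:~R by rewrite intrC Re_add Re_real.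
  under eq_esum do rewrite /fst /snd /jkernel (Normc.normcM (_ ^- k)) EFinM.
  rewrite esumZ ?normc_ge0//; last by move=> la; rewrite lee_fin normc_ge0.
  apply: (le_trans (lee_wpmul2l _ (HK _ z Ia zn))); first by rewrite lee_fin normc_ge0.
  rewrite -EFinM lee_fin normc_inv normcX mulrCA /h -mulrA ler_wpM2l//.
  by have := HC (tau + a%:~R); rewrite Ia Ra; apply.
rewrite /h; under eq_esum do rewrite EFinM.
rewrite esumZ ?mulr_ge0//.
by rewrite [X in (_ <= X)%E]EFinM lee_wpmul2l ?lee_fin ?mulr_ge0// esum_int_inv_oneDsqr.
Qed.

Lemma jkernel_poisson_mu (y : R) (tau : R[i]) (mu : 'cV[int]_n) : 0 < y -> 0 < complex.Im tau ->
  csumT (fun a : int => fmu (lat R mu) (tau + a%:~R)) =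
  csumT (fun l : int => gam y l (lat R mu) * epii (2 * l%:~R * tau)).
Proof.
move=> y0 t0; set v := complex.Im tau in t0; set r := complex.Re tau.
pose f (t : R) := fmu (lat R mu) (tau + t%:C * 1).
pose df (t : R) := log_fmu (lat R mu) (tau + t%:C * 1) * fmu (lat R mu) (tau + t%:C * 1) * 1.
have E (t : R) : tau + t%:C * 1 = (t + r) +i* v.
  by rewrite mulr1 addrC; apply: complex_ext; rewrite !ReImE ?add0r.
have der t : cderive f t (df t) by apply: hol_fmu; rewrite E.
have [K K0 HK] := fmul_bound t0; have [C C0 HC] := log_fmu_bound 0 (lat R mu) t0.
have f0 (w : R[i]) : fmul 0 (lat R mu) w = fmu (lat R mu) w by rewrite /fmul mulr0 mul0r oppr0 epii0 mulr1.
pose Q := K * expR (- (pi * v / m * qd D (lat R mu))).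
have Q0 : 0 <= Q by rewrite mulr_ge0 ?expR_ge0.
have d1 : decays Q (line (fmu (lat R mu)) v).
  move=> t; have := HK 0 (lat R mu) (t +i* v) (lexx _).
  by rewrite f0 Re_cplx Im_cplx mulr0 mul0r addr0 [_ / _ * _]mulrAC.
have d2 : decays (C * Q) (fun t => log_fmu (lat R mu) (t +i* v) * fmu (lat R mu) (t +i* v)).
  move=> t; rewrite (Normc.normcM (log_fmu _ _)).
  have := HC (t +i* v) (lexx _); rewrite !mulr0 subr0 => h.
  by rewrite -mulrA; apply: ler_pM; rewrite ?normc_ge0//; exact: d1.
pose S : R := 2 * (1 + r ^+ 2).
have S0 : 0 <= S by rewrite mulr_ge0// addr_ge0// sqr_ge0.
have dec1 : decays (Q * S + C * Q * S) f.
  move=> t; rewrite /f E; apply: (le_trans (decays_shift r d1 t)).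
  by rewrite ler_wpM2r ?invr_ge0 ?addr_ge0 ?sqr_ge0// lerDl mulr_ge0// mulr_ge0.
have dec2 : decays (Q * S + C * Q * S) df.
  move=> t; rewrite /df mulr1 E; apply: (le_trans (decays_shift r d2 t)).
  by rewrite ler_wpM2r ?invr_ge0 ?addr_ge0 ?sqr_ge0// lerDr mulr_ge0// mulr_ge0.
have fh l : fourier f l = gam y l (lat R mu) * epii (2 * l%:~R * tau).
  rewrite (gam_indep _ _ y0 t0) /gam mulrC.
  have dm : decays (K * expR (- (pi * v / m * qd D (lat R mu)) + 2 * pi * l%:~R * v)) (line (fmul l (lat R mu)) v).
    by move=> t; rewrite [leRHS]mulrAC; exact: (HK l (lat R mu) (t +i* v) (lexx v)).
  have cc := ccont_fmul l (lat R mu) t0.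
  rewrite (cintegral_translate r cc dm) -cintegralZ; last first.
    exact: (cintegrable_decay (ccont_shift r cc) (decays_shift r dm)).
  rewrite /fourier; congr cintegral; apply/funext => t.
  rewrite /f E /line /fmul [RHS]mulrCA -epiiD -E; congr (_ * epii _).
  by rewrite intrN; ring.
(* This is one row of [jterm_summable_strong] at z = 0, where the character in z is 1. *)
have sum1 : csm (fun l : int => (1 + `|l|%:~R) * fourier f l).
  have := csummable_row (csummable_swap (jterm_summable_strong (0 : 'cV[R[i]]_n) y0 t0)) mu.
  apply: csummable_norm_le => l; rewrite /jterm /fst /snd fh.
  by rewrite dotvr0 mulr0 epii0 mulr1.
have [_ _ p3] := poisson_summation der dec1 dec2 sum1.
transitivity (csumT (fun a : int => f a%:~R)); first by congr csum; apply/funext => a; rewrite /f mulr1 -intrC.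
by rewrite p3; congr csum; apply/funext => l.
Qed.

Lemma jkernel_poisson (y : R) (tau : R[i]) (z : 'cV[R[i]]_n) : 0 < y -> 0 < complex.Im tau ->
  csumT (fun p : int * 'cV[int]_n => jkernel (tau + p.1%:~R) (z + lat R[i] p.2)) =
  csumT (jterm y tau z).
Proof.
move=> y0 t0; set v := complex.Im tau in t0.
have sK : csm (fun p : int * 'cV[int]_n => jkernel (tau + p.1%:~R) (z + lat R[i] p.2)).
  have [B _ HB] := jkernel_esum_bound (map_mx (@complex.Im R) z) t0.
  by apply/csummableE; rewrite (le_lt_trans (HB tau z _ _)) ?ltry.
have Ia (a : int) : complex.Im (tau + a%:~R) = v by rewrite intrC Im_add Im_real addr0.
have Ia0 (a : int) : 0 < complex.Im (tau + a%:~R) by rewrite Ia.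
(* The family between the two Poisson summations: already transformed in z, not yet in tau. Its
   summability brings the sum over mu outside. *)
pose W (p : int * 'cV[int]_n) := fmu (lat R p.2) (tau + p.1%:~R) * epii (2 * dotv (lat R[i] p.2) z).
have sW : csm W.
  have [K K0 HK] := fmu_bound t0.
  have A0 : 0 < pi * v / m by rewrite divr_gt0// mulr_gt0 ?pi_gt0.
  pose rho := map_mx (fun x => - (2 * pi * complex.Im x)) z.
  have [K2 H2] := esum_qd_bound rho pD A0.
  pose g1 (a : int) : R := (1 + (complex.Re tau + a%:~R) ^+ 2)^-1.
  pose g2 (mu : 'cV[int]_n) : R := expR (- (pi * v / m * qd D (lat R mu)) + dotv rho (lat R mu)).
  have s1 : csm (fun a : int => (g1 a)%:C).
    apply: (csummable_le (g := g1)); last first.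
      by apply: (le_lt_trans (esum_int_inv_oneDsqr _)); rewrite ltry.
    by move=> a; rewrite normc_real ger0_norm// invr_ge0 addr_ge0 ?sqr_ge0.
  have s2 : csm (fun mu => (g2 mu)%:C).
    apply: (csummable_le (g := g2)); last by rewrite (le_lt_trans H2)// ltry.
    by move=> mu; rewrite normc_real ger0_norm// expR_ge0.
  have := csummableZ K%:C (csummable_mul s1 s2); apply: csummable_norm_le => -[a mu].
  rewrite /W /fst /snd (Normc.normcM (fmu _ _)) normc_epii_dot -/rho -!realCM normc_real.
  rewrite ger0_norm; last by rewrite !mulr_ge0 ?expR_ge0// invr_ge0 addr_ge0 ?sqr_ge0.
  rewrite /g2 expRD !mulrA ler_wpM2r ?expR_ge0//.
  have := HK (lat R mu) (tau + a%:~R); rewrite Ia /g1 => /(_ (lexx _)).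
  by rewrite intrC Re_add Re_real.
rewrite (csum_pair sK) /fst /snd.
transitivity (csumT (fun a : int => csumT (fun mu => W (a, mu)))).
  congr csum; apply/funext => a; rewrite /jkernel csumZ; last exact: theta_primal_summable.
  rewrite theta_inversion// -csumZ; last exact: theta_dual_summable.
  by congr csum; apply/funext => mu; rewrite /theta_dual /W /fmu /fst /snd mulrA.
rewrite (csum_exchange sW); have sJ := jterm_summable z y0 t0.
rewrite (csum_pair sJ) (csum_exchange sJ); congr csum; apply/funext => mu; rewrite /W /jterm /fst /snd.
have sj : csm (fun l : int => gam y l (lat R mu) * epii (2 * l%:~R * tau)).
  have := csummable_row (csummable_swap (jterm_summable (0 : 'cV[R[i]]_n) y0 t0)) mu.
  apply: csummable_norm_le => l; rewrite /jterm /fst /snd.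
  by rewrite dotvr0 mulr0 epii0 mulr1.
have sf : csm (fun a : int => fmu (lat R mu) (tau + a%:~R)).
  have := csummable_row (csummable_swap sW) mu.
  move=> /(csummableZ (epii (- (2 * dotv (lat R[i] mu) z)))); apply: csummable_norm_le => a.
  by rewrite /W /fst /snd mulrCA -epiiD addNr epii0 mulr1.
under eq_fun do rewrite mulrC.
rewrite csumZ// (jkernel_poisson_mu mu y0 t0) -csumZ//; congr csum; apply/funext => l.
by rewrite mulrC.
Qed.

End DoublePoisson.

(** * Positive definite forms *)

Section PositiveForms.
Variable R : realType.

Definition mform (A : comPzRingType) n (M : 'M[A]_n) (x y : 'cV[A]_n) : A :=
  (x^T *m M *m y) ord0 ord0.

Lemma mformDl (A : comPzRingType) n (M : 'M[A]_n) x x' y :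
  mform M (x + x') y = mform M x y + mform M x' y.
Proof. by rewrite /mform linearD /= !mulmxDl mxE. Qed.
Lemma mformDr (A : comPzRingType) n (M : 'M[A]_n) x y y' :
  mform M x (y + y') = mform M x y + mform M x y'.
Proof. by rewrite /mform mulmxDr mxE. Qed.
Lemma mformZl (A : comPzRingType) n (M : 'M[A]_n) a x y : mform M (a *: x) y = a * mform M x y.
Proof. by rewrite /mform linearZ /= -!scalemxAl mxE. Qed.
Lemma mformZr (A : comPzRingType) n (M : 'M[A]_n) a x y : mform M x (a *: y) = a * mform M x y.
Proof. by rewrite /mform -scalemxAr mxE. Qed.
Lemma mformC (A : comPzRingType) n (M : 'M[A]_n) x y : M^T = M -> mform M x y = mform M y x.
Proof.
move=> sM; transitivity ((y^T *m M *m x)^T ord0 ord0); last by rewrite mxE.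
by rewrite !trmx_mul trmxK sM mulmxA.
Qed.
Lemma mform_dotv (A : comPzRingType) n (M : 'M[A]_n) x y : mform M x y = dotv x (M *m y).
Proof. by rewrite /mform -mulmxA mxE /dotv; apply: eq_bigr => j _; rewrite mxE. Qed.

Lemma mform_map n (M : 'M[R]_n) (x y : 'cV[R]_n) :
  mform (map_mx (fun t => t%:C) M) (cvec x) (cvec y) = (mform M x y)%:C.
Proof. by rewrite /mform /cvec map_trmx -!map_mxM mxE. Qed.

Definition tailM (A : Type) n (M : 'M[A]_n.+1) : 'M[A]_n := \matrix_(i, j) M (lift ord0 i) (lift ord0 j).

Lemma mform_tail (A : comPzRingType) n (M : 'M[A]_n.+1) (u v : 'cV[A]_n) :
  mform M (consV 0 u) (consV 0 v) = mform (tailM M) u v.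
Proof.
rewrite !mform_dotv dotvS headV_cons mul0r add0r tailV_cons; congr (dotv u _).
apply/colP => i; rewrite !mxE big_ord_recl -[consV 0 v ord0 0]/(headV _) headV_cons mulr0 add0r.
by apply: eq_bigr => j _; rewrite !mxE liftK.
Qed.

Definition posdef n (M : 'M[R]_n) := M^T = M /\ forall x : 'cV[R]_n, x != 0 -> 0 < mform M x x.

Lemma posdef_unit n (M : 'M[R]_n) : posdef M -> M \in unitmx.
Proof.
move=> [sM pM]; rewrite -row_free_unit -kermx_eq0; apply/rowV0P => u /sub_kermxP uM.
apply/eqP/negP => /negP u0; have := pM u^T.
rewrite -(inj_eq trmx_inj) trmxK trmx0 => /(_ u0).
by rewrite /mform trmxK uM mul0mx mxE ltxx.
Qed.

Lemma posdef_tail n (M : 'M[R]_n.+1) : posdef M -> posdef (tailM M).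
Proof.
move=> [sM pM]; split; first by apply/matrixP => i j; rewrite !mxE -{2}sM mxE.
move=> x x0; rewrite -mform_tail; apply: pM; apply/eqP => h.
by move/eqP: x0; apply; rewrite -(tailV_cons 0 x) h; apply/colP => j; rewrite !mxE.
Qed.

(** Schur complement: with w the solution of M' w = b, where M' is the lower right block and b the
    rest of the first column, the vector W = (1, -w) is M-orthogonal to all vectors (0, v), and s =
    W^T M W > 0. Writing z as z_1 W plus such a vector splits the form. *)
Lemma posdef_tri n (M : 'M[R]_n) : posdef M -> exists2 D : tri R n, tri_pos D &
  forall z : 'cV[R[i]]_n, mform (map_mx (fun t => t%:C) M) z z = qf D z.
Proof.
elim: n M => [|n IH] M pM.
  by exists tt => // z; rewrite mform_dotv dotv0.
have pT := posdef_tail pM; have [D' pD' HD'] := IH _ pT.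
have uT := posdef_unit pT; have [sM M0] := pM.
pose b : 'cV[R]_n := \col_i M (lift ord0 i) ord0.
pose w := invmx (tailM M) *m b; pose W := consV 1 (- w); pose s := headV (M *m W).
have MW : M *m W = consV s 0.
  rewrite -[LHS]consV_headtail -/s; congr consV; apply/colP => i; rewrite !mxE big_ord_recl.
  rewrite -[W ord0 0]/(headV W) headV_cons mulr1.
  have := congr1 (fun v : 'cV[R]_n => v i 0) (mulKVmx uT b); rewrite -/w !mxE => <-.
  rewrite -big_split big1//= => j _; rewrite /W !mxE liftK !mxE mulrN addrN //.
have sW : mform M W W = s by rewrite mform_dotv MW dotvS !headV_cons !tailV_cons mul1r dotvr0 addr0.
have s0 : 0 < s.
  rewrite -sW; apply: M0; apply/eqP => h.
  by have := headV_cons 1 (- w); rewrite -/W h /headV mxE => /eqP; rewrite eq_sym oner_eq0.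
exists (s, w, D') => // z.
pose Mc := map_mx (fun t : R => t%:C) M.
have cW : cvec W = consV 1 (- cvec w).
  by rewrite -[LHS]consV_headtail /cvec headV_map tailV_map headV_cons tailV_cons map_mxN.
pose v := tailV z + headV z *: cvec w.
have zE : z = headV z *: cvec W + consV 0 v.
  rewrite cW -{1}[z]consV_headtail -[RHS]consV_headtail headVD tailVD headV_cons tailV_cons; congr consV.
    by rewrite addr0 /headV mxE -[consV _ _ _ _]/(headV _) headV_cons mulr1.
  by apply/colP => j; rewrite /v /tailV !mxE liftK !mxE; ring.
have McW : Mc *m cvec W = consV s%:C 0.
  rewrite /Mc /cvec -map_mxM MW -[LHS]consV_headtail headV_map tailV_map headV_cons tailV_cons.
  by rewrite map_mx0.
have sMc : Mc^T = Mc by rewrite /Mc map_trmx sM.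
have X : mform Mc (consV 0 v) (cvec W) = 0.
  by rewrite mform_dotv McW dotvS !headV_cons !tailV_cons mul0r dotvr0 addr0.
have X2 : mform Mc (cvec W) (cvec W) = s%:C by rewrite mform_map sW.
rewrite zE -/Mc -zE [in LHS]zE !mformDl !mformDr !mformZl !mformZr X (mformC _ _ sMc) X X2 mform_tail.
rewrite (_ : tailM Mc = map_mx (fun t => t%:C) (tailM M)); last by apply/matrixP => i j; rewrite !mxE.
by rewrite HD' /= -/v; ring.
Qed.

Section Lattice.
Variables (N : nat) (S : 'M[int]_N).
Hypothesis hS : even_posdef R S.

Let SR : 'M[R]_N := map_mx intr S.

Lemma blin_mform (A : comPzRingType) (x y : 'cV[A]_N) : blin S x y = mform (map_mx intr S) x y.
Proof. by []. Qed.

Lemma posdef_S : posdef SR.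
Proof. by case: hS => sS _ pS; split => //; rewrite /SR map_trmx sS. Qed.

Lemma S_tri : exists2 D : tri R N, tri_pos D & forall z : 'cV[R[i]]_N, blin S z z = qf D z.
Proof.
have [D pD HD] := posdef_tri posdef_S; exists D => // z.
have E : map_mx (fun t => t%:C) SR = map_mx intr S :> 'M[R[i]]_N.
  by apply/matrixP => i j; rewrite !mxE -intrC.
by rewrite -HD E.
Qed.

Definition hvec (mu : 'cV[int]_N) : 'cV[R]_N := 2 *: (invmx SR *m lat R mu).

Lemma SR_unit : SR \in unitmx. Proof. exact/posdef_unit/posdef_S. Qed.

Lemma blin_hvec (mu : 'cV[int]_N) (x : 'cV[R]_N) : blin S (hvec mu) x = 2 * dotv (lat R mu) x.
Proof.
rewrite blin_mform /hvec mformZl mformC; last by case: posdef_S.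
by rewrite mform_dotv mulKVmx ?SR_unit// dotvC.
Qed.

Lemma blin_hvec_cvec (mu : 'cV[int]_N) (z : 'cV[R[i]]_N) :
  blin S (cvec (hvec mu)) z = 2 * dotv (lat R[i] mu) z.
Proof.
rewrite blin_mform mformC; last by have [] := hS => sS _ _; rewrite map_trmx sS.
rewrite mform_dotv dotvC.
have -> : map_mx intr S *m cvec (hvec mu) = cvec (SR *m hvec mu).
  rewrite /cvec map_mxM; congr (_ *m _); apply/matrixP => i j; by rewrite !mxE intrC.
rewrite /hvec -scalemxAr mulKVmx ?SR_unit//.
have -> : cvec (2 *: lat R mu) = 2 *: lat R[i] mu.
  by apply/colP => j; rewrite !mxE realCM -intrC -natrC.
by rewrite dotvC dotvZr dotvC.
Qed.

Lemma twice_dualP (h : 'cV[R]_N) : twice_dual S h <-> exists mu, h = hvec mu.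
Proof.
split=> [th|[mu ->] x]; last first.
  rewrite blin_mform mformZl -blin_mform blin_hvec mulrA mulVf ?mul1r ?pnatr_eq0//.
  by rewrite /dotv; apply: rpred_sum => j _; rewrite !mxE rpredM ?intr_int.
pose mu : 'cV[int]_N := \col_j Num.floor (blin S (2^-1 *: h) (lat R (delta_mx j 0))).
exists mu.
have E : SR *m (2^-1 *: h) = lat R mu.
  apply/colP => j; rewrite [RHS]mxE [X in X%:~R]mxE.
  have /floorK -> : blin S (2^-1 *: h) (lat R (delta_mx j 0)) \is a Num.int by exact: th.
  rewrite blin_mform mformC; last by case: posdef_S.
  rewrite mform_dotv /dotv (bigD1 j)//= big1 => [|i ij]; rewrite !mxE.
    by rewrite !eqxx mul1r addr0.
  by rewrite (negbTE ij) mul0r.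
by rewrite /hvec -E mulKmx ?SR_unit// scalerA divff ?scale1r ?pnatr_eq0.
Qed.

Lemma hvec_inj : injective hvec.
Proof.
move=> mu mu' /scalerI; rewrite pnatr_eq0 => /(_ isT) h; apply/colP => j.
have := can_inj (mulKmx (_ : invmx SR \in unitmx)) h.
rewrite unitmx_inv SR_unit => /(_ isT) /colP /(_ j); rewrite !mxE; exact: intr_inj.
Qed.

Lemma fourier_index_bij :
  set_bij [set: int * 'cV[int]_N] (@fourier_index R N S) (fun p => (p.1, hvec p.2)).
Proof.
split=> [[l mu] _|[l mu] [l' mu'] _ _ [-> /hvec_inj ->]//|[l h] /twice_dualP [mu /= ->]].
  by apply/twice_dualP; exists mu.
by exists (l, mu).
Qed.

Variables (k m : nat) (D : tri R N).
Hypotheses (m0 : (0 < m)%N) (pD : tri_pos D) (SD : forall z : 'cV[R[i]]_N, blin S z z = qf D z).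

(** The line Im z = nu enters [gauss_integral_n] only as the shift i nu, which its value does not
    contain; so gamma is independent of nu. *)
Lemma gamma_gam (y : R) nu l mu : 0 < y ->
  gamma S k m y nu l (hvec mu) = gam m%:R D k y l (lat R mu).
Proof.
move=> y0; rewrite /gamma /gam; congr cintegral; apply/funext => t; rewrite /line /fmul /fmu.
have t0 : 0 < complex.Im (t +i* y) by [].
have mR : 0 < m%:R :> R by rewrite ltr0n.
have := gauss_integral_n mR (lat R mu) ('i *: cvec nu) 1 pD t0.
rewrite mul1r => <-.
rewrite mulrAC; congr (_ * _ * _); congr cintegral_n; apply/funext => u; rewrite mul1r.
congr epii; rewrite blin_hvec_cvec SD lat_cvec natrC; congr (- (_ + _)); ring.
Qed.

End Lattice.
End PositiveForms.

(** * Cosets of the Jacobi group *)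

Section TwoByTwo.

Definition mx2 (a b c d : int) : 'M[int]_2 :=
  \matrix_(i, j) (if i == 0 then (if j == 0 then a else b) else (if j == 0 then c else d)).

Lemma mx2E a b c d :
  [/\ mx2 a b c d 0 0 = a, mx2 a b c d 0 1 = b, mx2 a b c d 1 0 = c & mx2 a b c d 1 1 = d].
Proof. by split; rewrite mxE. Qed.

Lemma mx2_ext (A B : 'M[int]_2) : A 0 0 = B 0 0 -> A 0 1 = B 0 1 -> A 1 0 = B 1 0 ->
  A 1 1 = B 1 1 -> A = B.
Proof.
move=> e00 e01 e10 e11; apply/matrixP => i j.
have c2 (x : 'I_2) : x = 0 \/ x = 1.
  by case: x => [[|[|]]//] p; [left|right]; apply: val_inj.
by case: (c2 i) => ->; case: (c2 j) => ->.
Qed.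

Lemma mul2E (A B : 'M[int]_2) i j : (A *m B) i j = A i 0 * B 0 j + A i 1 * B 1 j.
Proof.
rewrite mxE !big_ord_recl big_ord0 addr0; congr (_ + A i _ * B _ j); exact: val_inj.
Qed.

Lemma det2E (A : 'M[int]_2) : \det A = A 0 0 * A 1 1 - A 0 1 * A 1 0.
Proof.
rewrite (expand_det_row _ ord0) !big_ord_recl big_ord0 addr0 /cofactor !det_mx11 !mxE /=.
rewrite expr0 expr1 mul1r mulN1r mulrN; congr (A _ _ * A _ _ - A _ _ * A _ _); exact: val_inj.
Qed.

Lemma mul1_int (a d : int) : a * d = 1 -> d = 1 \/ d = -1.
Proof.
by move=> /intUnitRing.unitzPl /orP[/eqP->|/eqP->]; [left|right].
Qed.

(** Two matrices of SL(2, Z) whose bottom rows agree up to the sign s differ by an upper triangular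
    left factor; the witness is s (a b' - a' b), s times the upper right entry of g' g^-1. *)
Lemma sl2_unipotent (a b c d a' b' s : int) : s * s = 1 -> a * d - b * c = 1 ->
  a' * (s * d) - b' * (s * c) = 1 ->
  exists n, s * a + s * n * c = a' /\ s * b + s * n * d = b'.
Proof.
move=> ss E E'; exists ((s * b' - b) * a - (s * a' - a) * b).
have E2 : a' * d - b' * c = s.
  have -> : a' * d - b' * c = (1 - s * s) * (a' * d - b' * c) + s * (a' * (s * d) - b' * (s * c)) by ring.
  by rewrite ss subrr mul0r add0r E' mulr1.
split.
  rewrite (_ : _ + _ = s * a * (1 - s * (a' * d - b' * c)) + s * s * (a' * (a * d - b * c))); last by ring.
  by rewrite E E2 ss subrr mulr0 add0r mulr1 mul1r.
rewrite (_ : _ + _ = s * b * (1 - s * (a' * d - b' * c)) + s * s * (b' * (a * d - b * c))); last by ring.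
by rewrite E E2 ss subrr mulr0 add0r mulr1 mul1r.
Qed.

(** If d x - c y is preserved, (x' - x, y' - y) is a multiple of (c, d). The multiplier is a (y' -
    y) - b (x' - x), because a d - b c = 1. *)
Lemma sl2_translation (a b c d x y x' y' s : int) : s * s = 1 -> a * d - b * c = 1 ->
  s * d * x' - s * c * y' = s * (d * x - c * y) ->
  c * (a * (y' - y) - b * (x' - x)) + x = x' /\ d * (a * (y' - y) - b * (x' - x)) + y = y'.
Proof.
move=> ss E V; have {}V : d * (x' - x) = c * (y' - y).
  apply/eqP; rewrite -subr_eq0 (_ : _ - _ = (1 - s * s) * (d * (x' - x) - c * (y' - y)) +
    s * ((s * d * x' - s * c * y') - s * (d * x - c * y))); last by ring.
  by rewrite ss V !subrr mul0r mulr0 addr0.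
split.
  rewrite (_ : _ + _ = a * (c * (y' - y)) - b * c * (x' - x) + x); last by ring.
  rewrite -V (_ : _ - _ = (a * d - b * c) * (x' - x)); last by ring.
  by rewrite E mul1r subrK.
rewrite (_ : _ + _ = a * d * (y' - y) - b * (d * (x' - x)) + y); last by ring.
rewrite V (_ : _ - _ = (a * d - b * c) * (y' - y)); last by ring.
by rewrite E mul1r subrK.
Qed.

End TwoByTwo.

Section Cosets.
Variables (R : realType) (N : nat) (S : 'M[int]_N).
Hypothesis hS : even_posdef R S.

Lemma mform_lat (A : comPzRingType) (x y : 'cV[int]_N) :
  blin S (lat A x) (lat A y) = (mform S x y)%:~R.
Proof. by rewrite blin_mform /mform /lat map_trmx -!map_mxM mxE. Qed.

Lemma S_sym : S^T = S. Proof. by case: hS. Qed.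

Lemma mform_even_diag n (M : 'M[int]_n) (x : 'cV[int]_n) : M^T = M ->
  (forall i, (2 %| M i i)%Z) -> (2 %| mform M x x)%Z.
Proof.
elim: n M x => [|n IH] M x sM eM; first by rewrite mform_dotv dotv0.
have E : x = headV x *: consV 1 0 + consV 0 (tailV x).
  rewrite -{1}[x]consV_headtail -[RHS]consV_headtail headVD tailVD headV_cons tailV_cons; congr consV.
    by rewrite addr0 /headV mxE -[consV _ _ _ _]/(headV _) headV_cons mulr1.
  by apply/colP => j; rewrite !mxE liftK !mxE mulr0 add0r.
have E0 : mform M (consV 1 0) (consV 1 0) = M 0 0.
  rewrite mform_dotv dotvS !headV_cons !tailV_cons mul1r dotvC dotvr0 addr0 /headV mxE big_ord_recl.
  rewrite -[consV _ _ ord0 _]/(headV _) headV_cons mulr1 big1 ?addr0// => j _.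
  by rewrite [X in _ * X]mxE liftK mxE mulr0.
rewrite E !mformDl !mformDr !mformZl !mformZr E0 (mformC (consV 1 0) (consV 0 _))// mform_tail.
set X := mform M _ _; set Y := mform (tailM M) _ _.
have -> : headV x * (headV x * M 0 0) + headV x * X + (headV x * X + Y) =
  headV x * (headV x * M 0 0) + 2 * (headV x * X) + Y by ring.
apply: rpredD; first by apply: rpredD; [do 2!apply: dvdz_mull|apply: dvdz_mulr].
apply: IH.
  by apply/matrixP => i j; rewrite !mxE -{2}sM mxE.
by move=> i; rewrite mxE eM.
Qed.

Lemma mformS_even (x : 'cV[int]_N) : exists q, mform S x x = 2 * q.
Proof.
have [sS eS _] := hS; have /dvdzP[q ->] := mform_even_diag x sS eS.
by exists q; rewrite mulrC.
Qed.

Variables (k m : nat).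
Hypotheses (m0 : (0 < m)%N) (keven : ~~ odd k) (k0 : (0 < k)%N).

Lemma exprN_even (A : pzRingType) (x : A) : (- x) ^+ k = x ^+ k.
Proof. by rewrite exprNn -signr_odd (negbTE keven) expr0 mul1r. Qed.

(* Together with (c, d), and up to a common sign, a complete invariant of the coset of g. *)
Definition lam (g : jelt N) : 'cV[int]_N := g.1 1 1 *: g.2.1 - g.1 1 0 *: g.2.2.

Variable (D : tri R N).
Hypotheses (pD : tri_pos D) (SD : forall z : 'cV[R[i]]_N, blin S z z = qf D z).

Lemma blinC (x y : 'cV[R[i]]_N) : blin S x y = blin S y x.
Proof. by rewrite !blin_mform mformC// map_trmx S_sym. Qed.

Definition blinE := (@mformDl R[i] N, @mformDr R[i] N, @mformZl R[i] N, @mformZr R[i] N).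

Lemma Im_ct_d (c d : int) (tau : R[i]) : complex.Im (c%:~R * tau + d%:~R) = c%:~R * complex.Im tau.
Proof. by rewrite !intrC Im_add Im_mul Re_real !Im_real mul0r !addr0. Qed.

Lemma ct_d_neq0 (c d : int) (tau : R[i]) : c != 0 -> 0 < complex.Im tau -> c%:~R * tau + d%:~R != 0.
Proof.
move=> c0 t0; apply/negP => /eqP /(congr1 (@complex.Im R)); rewrite Im_ct_d Im_0 => /eqP.
by rewrite mulf_eq0 intr_eq0 (negbTE c0) gt_eqF.
Qed.

Lemma slash_c (g : jelt N) (tau : R[i]) (z : 'cV[R[i]]_N) : g.1 1 0 != 0 -> 0 < complex.Im tau ->
  slash S k m g (@one_jfun R N) tau z =
  epii (m%:R * ((g.1 1 1)%:~R * blin S (lat R[i] g.2.1) (lat R[i] g.2.1) / (g.1 1 0)%:~R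
     - 2 * blin S (lat R[i] g.2.1) (lat R[i] g.2.2)))
  * ((g.1 1 0)%:~R ^- k * jkernel m%:R D k (tau + (g.1 1 1)%:~R / (g.1 1 0)%:~R)
       (z - (g.1 1 0)%:~R^-1 *: lat R[i] (lam g))).
Proof.
move=> c0 t0; have J0 := ct_d_neq0 (g.1 1 1) c0 t0.
rewrite /slash /slash_heis /slash_SL /one_jfun /jkernel mulr1.
have cn : (g.1 1 0)%:~R != 0 :> R[i] by rewrite intr_eq0.
set x := lat R[i] g.2.1; set y := lat R[i] g.2.2.
have -> : lat R[i] (lam g) = (g.1 1 1)%:~R *: x - (g.1 1 0)%:~R *: y.
  by apply/colP => j; rewrite !mxE rmorphB !rmorphM.
move: ((g.1 1 0)%:~R : R[i]) ((g.1 1 1)%:~R : R[i]) cn J0 => c d c0' J0.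
have -> : (tau + d / c) ^- k = c ^+ k * (c * tau + d) ^- k.
  by rewrite (_ : tau + d / c = (c * tau + d) / c) ?expr_div_n ?invf_div//; field.
rewrite -[c ^+ k / _ * _]mulrA mulKf ?expf_neq0// [LHS]mulrCA [RHS]mulrCA.
rewrite -!epiiD; congr (_ * epii _).
rewrite natrC -SD.
have -> : z - c^-1 *: (d *: x - c *: y) = z + (- (d / c)) *: x + y.
  by apply/colP => j; rewrite !mxE; field.
rewrite !blin_mform !blinE -!blin_mform (blinC y x) (blinC x z) (blinC y z).
move: (blin S x x) (blin S x y) (blin S z x) (blin S z y) (blin S z z) (blin S y y) (m%:R%:C) => a1 a2 a3 a4 a5 a6 M.
have -> : tau + d / c = (c * tau + d) / c by field.
have -> : tau = ((c * tau + d) - d) / c by field.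
move: (c * tau + d) J0 => J J0.
by field; rewrite subrK c0' J0.
Qed.

Lemma slash_0 (g : jelt N) (tau : R[i]) (z : 'cV[R[i]]_N) : g.1 1 0 = 0 ->
  slash S k m g (@one_jfun R N) tau z = (g.1 1 1)%:~R ^- k *
  epii (m%:R * (blin S (lat R[i] g.2.1) (lat R[i] g.2.1) * tau + 2 * blin S (lat R[i] g.2.1) z)).
Proof.
move=> c0; rewrite /slash /slash_heis /slash_SL /one_jfun mulr1 c0 !mul0r !add0r mulr0 oppr0 epii0 mulr1.
by rewrite mulrC.
Qed.

Lemma jacobi_infP (h : jelt N) :
  jacobi_inf R S k m h <-> [/\ \det h.1 = 1, h.1 1 0 = 0 & h.2.1 = 0].
Proof.
split=> [[dh sh]|[dh c0 x0]]; last first.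
  split=> // tau z t0; rewrite slash_0// x0.
  have -> : lat R[i] 0 = 0 :> 'cV_N by apply/colP => j; rewrite !mxE.
  have z0 (v : 'cV[R[i]]_N) : blin S 0 v = 0 by rewrite blin_mform /mform trmx0 !mul0mx mxE.
  rewrite !z0 mul0r mulr0 addr0 mulr0 epii0 mulr1.
  move: dh; rewrite det2E c0 mulr0 subr0 => /mul1_int [->|->].
    by rewrite expr1n invr1.
  by rewrite intrN exprN_even expr1n invr1.
have c0 : h.1 1 0 = 0.
  apply/eqP/negP => /negP c0.
  pose c : R := (h.1 1 0)%:~R; pose d : R := (h.1 1 1)%:~R.
  have cn : c != 0 by rewrite intr_eq0.
  (* Here c tau + d has modulus 2, and z = lambda/c makes the exponential in z trivial, so the
     slashed function has modulus 2^-k rather than 1. *)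
  pose tau : R[i] := (- (d / c)) +i* (2 / `|c|).
  have t0 : 0 < complex.Im tau by rewrite Im_cplx divr_gt0// normr_gt0.
  have := sh tau ((h.1 1 0)%:~R^-1 *: lat R[i] (lam h)) t0.
  rewrite slash_c// subrr.
  have -> : tau + (h.1 1 1)%:~R / (h.1 1 0)%:~R = 0 +i* (2 / `|c|).
    rewrite !intrC -realCV -realCM; apply: complex_ext; rewrite !ReImE ?addr0//.
    by rewrite -/c -/d addrC subrr.
  rewrite /jkernel -SD (_ : blin S 0 0 = 0); last by rewrite blin_mform /mform mulmx0 mxE.
  rewrite mulr0 oppr0 epii0 mulr1 !mform_lat => /(congr1 (@Normc.normc R)).
  rewrite Normc.normc1 (Normc.normcM (epii _)) normc_epii (Normc.normcM (_ ^- k)).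
  have nc : normc ((h.1 1 0)%:~R : R[i]) = `|c| by rewrite intrC normc_real.
  rewrite !normc_inv !normcX nc.
  have -> : normc (0 +i* (2 / `|c|)) = 2 / `|c|.
    by rewrite /normc expr0n add0r sqrtr_sqr ger0_norm// divr_ge0.
  set e := expR _; have -> : e = 1.
    rewrite /e (_ : m%:R * _ = (m%:R * (d * (mform S h.2.1 h.2.1)%:~R / c - 2 * (mform S h.2.1 h.2.2)%:~R))%:C).
      by rewrite Im_real mulr0 oppr0 expR0.
    by rewrite realCM realCD realCN !realCM realCV -!natrC -!intrC.
  rewrite mul1r -invfM -exprMn mulrCA mulfV ?normr_eq0// mulr1 => /eqP; rewrite invr_eq1.
  by rewrite gt_eqF// exprn_egt1 ?ltr1n// -lt0n.
split=> //; apply/eqP/negP => /negP x0.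
(* At tau = i, z = 0 the modulus is e^{-pi m (x,x)}, which is below 1 unless x = 0. *)
have := sh (0 +i* 1) 0 ltr01 => /(congr1 (@Normc.normc R)); rewrite slash_0//.
rewrite Normc.normc1 (Normc.normcM (_ ^- k)) normc_epii normc_inv normcX.
have -> : normc ((h.1 1 1)%:~R : R[i]) = 1.
  move: dh; rewrite /jacobi_group /= det2E c0 mulr0 subr0 => /mul1_int [->|->].
    by rewrite Normc.normc1.
  by rewrite intrN normcN Normc.normc1.
rewrite expr1n invr1 mul1r (_ : blin S _ 0 = 0); last by rewrite blin_mform /mform mulmx0 mxE.
rewrite mulr0 addr0 mform_lat mulrA intrC natrC -realCM Im_mul Im_real Re_real Re_cplx Im_cplx mul0r addr0 mulr1.
have q0 : 0 < (mform S h.2.1 h.2.1)%:~R :> R.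
  rewrite -(mform_lat R); case: hS => _ _; apply; apply/negP => /eqP/colP e.
  move/eqP: x0; apply; apply/colP => j; have := e j.
  by rewrite !mxE => /eqP; rewrite intr_eq0 => /eqP.
have p0 : 0 < pi * (m%:R * (mform S h.2.1 h.2.1)%:~R) :> R by rewrite !mulr_gt0 ?pi_gt0 ?ltr0n.
move=> /eqP; rewrite -[X in _ == X]expR0 => /eqP /expR_inj /eqP; rewrite oppr_eq0 gt_eqF//.
Qed.

Definition same_inv (g g' : jelt N) (s : int) :=
  [/\ g'.1 1 0 = s * g.1 1 0, g'.1 1 1 = s * g.1 1 1 & lam g' = s *: lam g].

Lemma same_inv_shift (g g' : jelt N) s : jacobi_group g -> s * s = 1 -> same_inv g g' s ->
  exists yh, g'.2.1 = g.1 1 0 *: yh + g.2.1 /\ g'.2.2 = g.1 1 1 *: yh + g.2.2.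
Proof.
rewrite /jacobi_group /= det2E => E ss [e1 e2 e3].
pose yh := g.1 0 0 *: (g'.2.2 - g.2.2) - g.1 0 1 *: (g'.2.1 - g.2.1).
have V j := congr1 (fun v : 'cV[int]_N => v j 0) e3.
have X j : g.1 1 0 * yh j 0 + g.2.1 j 0 = g'.2.1 j 0 /\ g.1 1 1 * yh j 0 + g.2.2 j 0 = g'.2.2 j 0.
  by rewrite /yh !mxE; apply: (sl2_translation ss E); have := V j; rewrite /lam e1 e2 !mxE.
by exists yh; split; apply/colP => j; rewrite mxE [X in X + _]mxE; case: (X j).
Qed.

Lemma jcosetP (g : jelt N) : jacobi_group g -> jcoset R S k m g =
  [set g' | jacobi_group g' /\ exists2 s : int, s = 1 \/ s = -1 & same_inv g g' s].
Proof.
move=> dg; apply/seteqP; split=> [g' [h /jacobi_infP [dh c0 x0] <-]|g' [dg' [s s1 [e1 e2 e3]]]].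
  have hs : h.1 1 1 = 1 \/ h.1 1 1 = -1.
    by move: dh; rewrite det2E c0 mulr0 subr0; exact: mul1_int.
  split; first by rewrite /jacobi_group /= det_mulmx dh dg mul1r.
  exists (h.1 1 1) => //; rewrite /same_inv /lam /= !mul2E c0 !mul0r !add0r; split => //.
  by rewrite x0 !scaler0 !add0r; apply/colP => j; rewrite !mxE; ring.
move: (dg) (dg'); rewrite /jacobi_group /= !det2E e1 e2 => E E'.
have ss : s * s = 1 by case: s1 => ->.
have [n [n1 n2]] := sl2_unipotent ss E E'.
have [yh [y1 y2]] := same_inv_shift dg ss (And3 e1 e2 e3).
exists (mx2 s (s * n) 0 s, (0, yh)).
  apply/jacobi_infP; split => //=; last by have [] := mx2E s (s * n) 0 s.
  by rewrite det2E; have [-> -> -> ->] := mx2E s (s * n) 0 s; rewrite mulr0 subr0.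
rewrite /jmul /=; have [m1 m2 m3 m4] := mx2E s (s * n) 0 s.
rewrite [RHS]surjective_pairing [g'.2]surjective_pairing; congr (_, (_, _)).
- by apply: mx2_ext; rewrite mul2E ?m1 ?m2 ?m3 ?m4 ?n1 ?n2 ?mul0r ?add0r.
- by rewrite scaler0 add0r y1.
- by rewrite scaler0 add0r y2.
Qed.

Lemma jcoset_same (g g' : jelt N) s : jacobi_group g -> jacobi_group g' -> s = 1 \/ s = -1 ->
  same_inv g g' s -> jcoset R S k m g = jcoset R S k m g'.
Proof.
move=> dg dg' s1 [e1 e2 e3]; rewrite !jcosetP//.
have ss : s * s = 1 by case: s1 => ->.
have st (t : int) : t = 1 \/ t = -1 -> t * s = 1 \/ t * s = -1.
  by move=> [->|->]; case: s1 => ->; [left|right|right|left].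
apply/seteqP; split => h [dh [t t1 [h1 h2 h3]]]; split => //; exists (t * s) => //; try exact: st.
  by split; rewrite ?h1 ?h2 ?h3 ?e1 ?e2 ?e3 ?scalerA -!mulrA ?(mulrA s s) ?ss ?mul1r ?mulr1.
by split; rewrite ?h1 ?h2 ?h3 ?e1 ?e2 ?e3 ?scalerA ?mulrA.
Qed.

(** [eis_term] takes whichever coset element [xget] yields; this makes the choice harmless. The two
    phases differ by an even integer because (yh, yh) is even, and the sign disappears because k is
    even. *)
Lemma slash_same (g g' : jelt N) s (tau : R[i]) (z : 'cV[R[i]]_N) :
  jacobi_group g -> s = 1 \/ s = -1 -> same_inv g g' s -> 0 < complex.Im tau ->
  slash S k m g' (@one_jfun R N) tau z = slash S k m g (@one_jfun R N) tau z.
Proof.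
move=> dg s1 si t0; have ss : s * s = 1 by case: s1 => ->.
have [yh [y1 y2]] := same_inv_shift dg ss si; have [e1 e2 e3] := si.
have sk (x : int) : (s * x)%:~R ^+ k = x%:~R ^+ k :> R[i].
  by case: s1 => ->; rewrite ?mul1r// mulN1r intrN exprN_even.
have [c0|c0] := eqVneq (g.1 1 0) 0.
  have c0' : g'.1 1 0 = 0 by rewrite e1 c0 mulr0.
  by rewrite (slash_0 tau z c0') (slash_0 tau z c0) e2 sk y1 c0 scale0r add0r.
have sn0 : s != 0 by case: s1 => ->.
have c0' : g'.1 1 0 != 0 by rewrite e1 mulf_neq0.
have cn : (g.1 1 0)%:~R != 0 :> R[i] by rewrite intr_eq0.
have sn : s%:~R != 0 :> R[i] by rewrite intr_eq0.
rewrite (slash_c z c0' t0) (slash_c z c0 t0) e1 sk e2 e3.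
have -> : lat R[i] (s *: lam g) = s%:~R *: lat R[i] (lam g).
  by apply/colP => j; rewrite !mxE intrM.
rewrite scalerA !intrM.
have -> : (s%:~R * (g.1 1 0)%:~R)^-1 * s%:~R = (g.1 1 0)%:~R^-1 :> R[i] by field; rewrite sn cn.
have -> : s%:~R * (g.1 1 1)%:~R / (s%:~R * (g.1 1 0)%:~R) = (g.1 1 1)%:~R / (g.1 1 0)%:~R :> R[i].
  by field; rewrite sn cn.
set K := _ ^- k * _; congr (_ * K); have [q Q] := mformS_even yh.
have yy : blin S (lat R[i] yh) (lat R[i] yh) = 2 * q%:~R by rewrite mform_lat Q intrM.
have yg : blin S (lat R[i] yh) (lat R[i] g.2.2) = (mform S yh g.2.2)%:~R by rewrite mform_lat.
have latD (c : int) (u v : 'cV[int]_N) : lat R[i] (c *: u + v) = c%:~R *: lat R[i] u + lat R[i] v.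
  by apply/colP => j; rewrite !mxE intrD intrM.
rewrite y1 y2 !latD.
set c := (g.1 1 0)%:~R in cn *; set d := (g.1 1 1)%:~R.
rewrite -[RHS]mulr1 -[X in _ = _ * X](epii_even R (- (m%:Z * (g.1 1 0 * g.1 1 1 * q + g.1 1 0 * mform S yh g.2.2)))) -epiiD.
congr epii; rewrite intrN !(intrM, intrD) -/c -/d -pmulrn.
rewrite !blin_mform !blinE -!blin_mform (blinC (lat R[i] g.2.1) (lat R[i] yh)) yy yg.
move: (blin S _ _) (blin S _ _) (blin S _ _) (_%:~R : R[i]) => a1 a2 a3 a4.
by field; rewrite sn cn.
Qed.

(** With u c + v d = 1, the matrix has upper row (v, -u), and x = v lambda, y = -u lambda satisfy d
    x - c y = lambda. *)
Definition jrep (c d : int) (la : 'cV[int]_N) : jelt N :=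
  let uv := egcdz c d in (mx2 uv.2 (- uv.1) c d, (uv.2 *: la, (- uv.1) *: la)).

Lemma jrep_spec c d la : coprimez c d ->
  [/\ jacobi_group (jrep c d la), (jrep c d la).1 1 0 = c, (jrep c d la).1 1 1 = d & lam (jrep c d la) = la].
Proof.
move=> cd; rewrite /jrep /lam /jacobi_group /= det2E; case: (egcdzP c d) => u v /= E _.
have {}E : u * c + v * d = 1 by rewrite E; apply/eqP.
have [-> -> -> ->] := mx2E v (- u) c d; split => //; first by rewrite mulNr opprK addrC.
apply/colP => j; rewrite !mxE -[RHS]mul1r -E; ring.
Qed.

(** One triple from each pair of opposite triples (c, d, lambda): c > 0, or c = 0 and d = 1. This
    accounts for the factor 1/2 in the explicit series. *)
Definition jindex : set (nat * (int * 'cV[int]_N)) :=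
  [set p | coprimez p.1%:Z p.2.1 && ((p.1 == 0%N) ==> (p.2.1 == 1))].

Definition jcoset_of (p : nat * (int * 'cV[int]_N)) := jcoset R S k m (jrep p.1 p.2.1 p.2.2).

Lemma jindex_bij : set_bij jindex (jcosets R S k m) jcoset_of.
Proof.
split=> [[c [d la]] /andP[/= cd _]|[c [d la]] [c' [d' la']] /set_mem/andP[/= cd c0] /set_mem/andP[/= cd' c0']|C [g dg <-]].
- by have [h _ _ _] := jrep_spec la cd; exists (jrep c d la).
- have [h1 h2 h3 h4] := jrep_spec la cd; have [h1' h2' h3' h4'] := jrep_spec la' cd'.
  rewrite /jcoset_of /= => E.
  have : jcoset R S k m (jrep c' d' la') (jrep c d la).
    rewrite -E jcosetP//; split => //; exists 1; first by left.
    by split; rewrite ?mul1r ?scale1r.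
  rewrite jcosetP// => -[_ [s s1 [e1 e2 e3]]]; move: e1 e2 e3; rewrite h2 h3 h4 h2' h3' h4'.
  case: s1 => ->; rewrite ?mul1r ?scale1r ?mulN1r; first by move=> [->] -> ->.
  move=> cc dd _; have c00 : c = 0%N by lia.
  have c00' : c' = 0%N by lia.
  by move: c0 c0'; rewrite c00 c00' /= => /eqP d1 /eqP d1'; move: dd; rewrite d1 d1'.
- have cop : coprimez (g.1 1 0) (g.1 1 1).
    apply/coprimezP; exists (- g.1 0 1, g.1 0 0) => /=; move: dg; rewrite /jacobi_group /= det2E => <-; ring.
  have [s s1 [n [en dn]]] : exists2 s : int, s = 1 \/ s = -1 & exists n : nat, s * g.1 1 0 = n /\ ((n == 0%N) ==> (s * g.1 1 1 == 1)).
    have [c0|c0|c0] := ltgtP (g.1 1 0) 0.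
    - exists (-1); first by right.
      exists (absz (g.1 1 0)); move: (g.1 1 0) (g.1 1 1) c0 => c d c0.
      by split; [lia|apply/implyP => /eqP; lia].
    - exists 1; first by left.
      exists (absz (g.1 1 0)); move: (g.1 1 0) (g.1 1 1) c0 => c d c0.
      by split; [lia|apply/implyP => /eqP; lia].
    - have d1 : g.1 1 1 = 1 \/ g.1 1 1 = -1.
        by move: dg; rewrite /jacobi_group /= det2E c0 mulr0 subr0; exact: mul1_int.
      exists (g.1 1 1) => //; exists 0%N; rewrite c0 mulr0; split => //=.
      by case: d1 => ->.
  have cop' : coprimez n (s * g.1 1 1).
    by rewrite -en; case: s1 => ->; rewrite ?mul1r ?mulN1r ?coprimeNz ?coprimezN.
  have [h1 h2 h3 h4] := jrep_spec (s *: lam g) cop'.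
  exists (n, (s * g.1 1 1, s *: lam g)); first by apply/andP.
  rewrite /jcoset_of /=; symmetry; apply: (jcoset_same dg h1 s1).
  by split; rewrite ?h2 ?h3 ?h4.
Qed.

Lemma eis_term_jcoset (tau : R[i]) z p : jindex p -> 0 < complex.Im tau ->
  eis_term S k m tau z (jcoset_of p) = slash S k m (jrep p.1 p.2.1 p.2.2) (@one_jfun R N) tau z.
Proof.
move=> /andP[cd _] t0; have [h1 h2 h3 h4] := jrep_spec p.2.2 cd.
rewrite /eis_term /jcoset_of; set g := jrep _ _ _ in h1 h2 h3 h4 *.
have : jcoset R S k m g (xget (jone N) (jcoset R S k m g)).
  apply: xgetPex; exists g; rewrite jcosetP//; split => //; exists 1; first by left.
  by split; rewrite ?mul1r ?scale1r.
rewrite {1}(jcosetP h1) => -[_ [s s1 si]]; have H := slash_same z h1 s1 si t0; exact H.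
Qed.

Lemma eis_term_theta (tau : R[i]) z la : 0 < complex.Im tau ->
  eis_term S k m tau z (jcoset_of (0%N, (1, la))) =
  epii (m%:R * (blin S (lat R[i] la) (lat R[i] la) * tau + 2 * blin S (lat R[i] la) z)).
Proof.
move=> t0; rewrite eis_term_jcoset//=.
have [h1 h2 h3 h4] := jrep_spec la (isT : coprimez 0 1).
have x1 : (jrep 0 1 la).2.1 = la by rewrite -[RHS]h4 /lam h2 h3 scale1r scale0r subr0.
by rewrite (slash_0 tau z h2) h3 x1 expr1n invr1 mul1r.
Qed.

(** For the representative [jrep], the relation v d = 1 - u c collapses the phase, modulo even
    integers, to m v (lambda, lambda)/c, with v an inverse of d mod c. *)
Lemma eis_term_c (tau : R[i]) z (c : nat) (d : int) la : 0 < complex.Im tau -> coprimez c.+1 d ->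
  eis_term S k m tau z (jcoset_of (c.+1, (d, la))) =
  c.+1%:R ^- k * (epii (m%:R * ((egcdz c.+1 d).2%:~R * (mform S la la)%:~R) / c.+1%:R) *
  jkernel m%:R D k (tau + d%:~R / c.+1%:R) (z - c.+1%:R^-1 *: lat R[i] la)).
Proof.
move=> t0 cd; rewrite eis_term_jcoset//=; last by rewrite /jindex /= cd.
have [h1 h2 h3 h4] := jrep_spec la cd.
have c0 : (jrep c.+1 d la).1 1 0 != 0 by rewrite h2.
rewrite (slash_c z c0 t0) h2 h3 h4 -!pmulrn [LHS]mulrCA; congr (_ * (_ * _)).
rewrite !mform_lat /jrep /=; case: (egcdzP c.+1 d) => u v /= E _.
have {}E : u * c.+1 + v * d = 1 by rewrite E; apply/eqP.
have [q Q] := mformS_even la.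
have cn : c.+1%:R != 0 :> R[i] by rewrite pnatr_eq0.
have {}E : v%:~R * d%:~R = 1 - u%:~R * c.+1%:R :> R[i].
  have := congr1 (fun t : int => t%:~R : R[i]) E; rewrite intrD !intrM mulr1z -pmulrn => E1.
  by rewrite -[X in _ = X - _]E1 addrAC subrr add0r.
rewrite -[RHS]mulr1 -[X in _ = _ * X](epii_even R (m%:Z * (u * v * q))) -epiiD; congr epii.
rewrite !mformZl !mformZr Q !(intrM, intrN) -!pmulrn.
rewrite (_ : d%:~R * (v%:~R * (v%:~R * (2 * q%:~R))) = v%:~R * (v%:~R * d%:~R) * (2 * q%:~R)); last by ring.
by rewrite E; field.
Qed.

End Cosets.

(** * The singular series *)

Section ResidueSums.
Variable R : realType.
Local Notation esumT f := (\esum_(t in [set: _]) (f t)%:E)%E.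
Local Notation csm f := (csummable [set: _] f).
Local Notation csumT f := (csum [set: _] f).

Definition chi (n : nat) (r : int) : R[i] := epii (2 * (r%:~R / n%:R)).

Lemma chiD n r s : chi n (r + s) = chi n r * chi n s.
Proof. by rewrite /chi -epiiD intrD; congr epii; ring. Qed.

Lemma chi_mul n r : (0 < n)%N -> chi n (n%:Z * r) = 1.
Proof.
move=> n0; have nn : n%:R != 0 :> R[i] by rewrite pnatr_eq0 -lt0n.
by rewrite /chi intrM -pmulrn mulrAC mulfV// mul1r epii_even.
Qed.

Lemma chi_scale j n r : (0 < j)%N -> chi (j * n) (j%:Z * r) = chi n r.
Proof.
move=> j0; have jn : j%:R != 0 :> R[i] by rewrite pnatr_eq0 -lt0n.
rewrite /chi natrM intrM -pmulrn; congr (epii (2 * _)).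
have [->|n0] := eqVneq (n%:R : R[i]) 0; first by rewrite mulr0 !invr0 !mulr0.
by field; rewrite jn n0.
Qed.

Lemma normc_chi n r : normc (chi n r) = 1.
Proof.
rewrite /chi normc_epii intrC natrC (natrC R n) -realCV -!realCM Im_real.
by rewrite mulr0 oppr0 expR0.
Qed.

Lemma chi_eq1 n r : (0 < n)%N -> (chi n r == 1) = (n%:Z %| r)%Z.
Proof.
move=> n0; apply/idP/idP => [|/dvdzP[q ->]]; last by rewrite mulrC chi_mul.
have nz : n%:Z != 0 by rewrite eqz_nat -lt0n.
rewrite (divz_eq r n) chiD [_ * n%:Z]mulrC chi_mul// mul1r.
have r1 := modz_ge0 r nz; have r2 : (r %% n < n)%Z by rewrite ltz_pmod// ltz_nat.
case: (r %% n)%Z r1 r2 => // q _ qn /eqP h.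
have [->|q0] := posnP q; first by rewrite addr0 dvdz_mulr.
(* The square root e^{pi i q/n} of the character value would be 1 or -1, hence real, whereas sin(pi
   q/n) > 0 for 0 < q < n. *)
exfalso; pose u : R[i] := epii ((q%:R / n%:R)%:C).
have u2 : u ^+ 2 = 1.
  rewrite -h /chi expr2 /u -epiiD; congr epii; rewrite -pmulrn realCM realCV -!natrC.
  by rewrite [2 * _]mulr_natl mulr2n.
have : u = 1 \/ u = -1.
  by move/eqP: u2; rewrite sqrf_eq1 => /orP[/eqP|/eqP]; [left|right].
have Iu : complex.Im u = sin (pi * (q%:R / n%:R)).
  have E0 (t : R) : pi%:C * 'i * t%:C = 0 +i* (pi * t) by apply: complex_ext; rewrite !ReImE; ring.
  by rewrite /u /epii E0 /cexp Im_mul !ReImE expR0 mul1r mul0r addr0.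
have Iu0 : complex.Im u = 0 -> False.
  rewrite Iu => /eqP; rewrite gt_eqF// sin_gt0_pi// mulr_gt0 ?pi_gt0 ?divr_gt0 ?ltr0n//=.
  by rewrite gtr_pMr ?pi_gt0// ltr_pdivrMr ?ltr0n// mul1r ltr_nat.
by case=> e; apply: Iu0; rewrite e ?Im_opp ?Im_1 ?oppr0.
Qed.

Lemma sum_chi n r : (0 < n)%N ->
  \sum_(e < n) chi n ((e : nat)%:Z * r) = if (n%:Z %| r)%Z then n%:R else 0.
Proof.
move=> n0; have E (e : nat) : chi n (e%:Z * r) = chi n r ^+ e.
  elim: e => [|e IH]; first by rewrite mul0r /chi mul0r mulr0 epii0 expr0.
  by rewrite exprS -IH -chiD; congr chi; rewrite intS mulrDl mul1r.
under eq_bigr do rewrite E.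
rewrite -chi_eq1//; case: eqVneq => [->|c1].
  by under eq_bigr do rewrite expr1n; rewrite sumr_const card_ord.
have := subrX1 (chi n r) n; rewrite -E chi_mul// subrr => /esym/eqP.
by rewrite mulf_eq0 subr_eq0 (negbTE c1) => /eqP.
Qed.

Definition vz N n (x : 'cV['I_n]_N) : 'cV[int]_N := map_mx (fun j : 'I_n => (j : nat)%:Z) x.

Definition vperiodic N (n : nat) (P : 'cV[int]_N -> R[i]) :=
  forall x u : 'cV[int]_N, P (x + n%:Z *: u) = P x.

Lemma sum_vz0 n (P : 'cV[int]_0 -> R[i]) : \sum_(x : 'cV['I_n]_0) P (vz x) = P 0.
Proof.
have E (x : 'cV['I_n]_0) : vz x = 0 by apply/colP; case.
under eq_bigr do rewrite E.
by rewrite sumr_const card_mx mul0n expn0.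
Qed.

Lemma sum_vzS N n (P : 'cV[int]_N.+1 -> R[i]) : \sum_(x : 'cV['I_n]_N.+1) P (vz x) =
  \sum_(a < n) \sum_(u : 'cV['I_n]_N) P (consV (a : nat)%:Z (vz u)).
Proof.
rewrite pair_bigA (reindex (fun p : 'I_n * 'cV['I_n]_N => consV p.1 p.2)) /=; last first.
  by apply: onW_bij; exact: consV_bij.
apply: eq_bigr => -[a u] _ /=; congr P.
by rewrite -[LHS]consV_headtail /vz headV_map tailV_map headV_cons tailV_cons.
Qed.

Lemma sum_periodic1 (phi : int -> R[i]) n j : (forall a b, phi (a + n%:Z * b) = phi a) ->
  \sum_(a < j * n) phi (a : nat)%:Z = j%:R * \sum_(a < n) phi (a : nat)%:Z.
Proof.
move=> pp; elim: j => [|j IH]; first by rewrite mul0n big_ord0 mul0r.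
rewrite mulSn big_split_ord /= -natr1 mulrDl mul1r addrC; congr (_ + _).
rewrite -IH; apply: eq_bigr => a _; rewrite PoszD addrC.
by rewrite -{1}[n%:Z]mulr1 pp.
Qed.

Lemma sum_periodic N n j (P : 'cV[int]_N -> R[i]) : vperiodic n P ->
  \sum_(x : 'cV['I_(j * n)]_N) P (vz x) = j%:R ^+ N * \sum_(x : 'cV['I_n]_N) P (vz x).
Proof.
elim: N P => [|N IH] P pP; first by rewrite !sum_vz0 expr0 mul1r.
have consD (a b : int) (u v : 'cV[int]_N) : consV a u + n%:Z *: consV b v = consV (a + n%:Z * b) (u + n%:Z *: v).
  by apply/colP => i; rewrite !mxE; case: unliftP => [t _|_] //; rewrite !mxE.
rewrite !sum_vzS exprSr -mulrA.
transitivity (\sum_(a < j * n) (fun b : int => j%:R ^+ N * \sum_(u : 'cV['I_n]_N) P (consV b (vz u))) (a : nat)%:Z).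
  apply: eq_bigr => a _; apply: (IH (fun u => P (consV (a : nat)%:Z u))) => x u.
  by rewrite -[in RHS](pP _ (consV 0 u)) consD mulr0 addr0.
rewrite (@sum_periodic1 (fun b : int => j%:R ^+ N * \sum_(u : 'cV['I_n]_N) P (consV b (vz u)))).
  by rewrite -mulr_sumr mulrCA.
move=> a b; congr (_ * _); apply: eq_bigr => u _.
by rewrite -[in RHS](pP _ (consV b 0)) consD scaler0 addr0.
Qed.

Lemma sum_unit_scale N n (d : nat) (P : 'cV[int]_N -> R[i]) : coprime n.+1 d -> vperiodic n.+1 P ->
  \sum_(x : 'cV['I_n.+1]_N) P (vz x) = \sum_(x : 'cV['I_n.+1]_N) P (d%:Z *: vz x).
Proof.
move=> cd pP; pose h (x : 'cV['I_n.+1]_N) := map_mx (fun j : 'I_n.+1 => inZp (d * j) : 'I_n.+1) x.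
have hi : injective h.
  move=> x x' /colP e; apply/colP => i; have := e i; rewrite !mxE => /(congr1 val) /= /eqP.
  rewrite -eqz_nat -!modz_nat eqz_mod_dvd !PoszM -mulrBr Gauss_dvdzr ?coprimezE// -eqz_mod_dvd.
  by rewrite !modz_nat eqz_nat !modn_small ?ltn_ord// => /eqP; exact: val_inj.
rewrite (reindex_inj hi); apply: eq_bigr => x _.
rewrite -[LHS](pP _ (map_mx (fun j : 'I_n.+1 => (d * j %/ n.+1)%N%:Z) x)); congr P.
apply/colP => i; rewrite !mxE /= -!PoszM -PoszD; congr Posz.
by rewrite addnC mulnC -divn_eq.
Qed.

Variables (N : nat) (Q : 'cV[int]_N -> int).
Hypothesis Qper : forall (n : nat) x u, (n%:Z %| Q (x + n%:Z *: u) - Q x)%Z.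

Lemma chi_periodic n (e : int) : (0 < n)%N -> vperiodic n (fun x => chi n (e * Q x)).
Proof.
move=> n0 x u; rewrite -[Q (x + _)](subrK (Q x)) mulrDr chiD.
have /dvdzP[q ->] := Qper n x u.
by rewrite mulrA [_ * n%:Z]mulrC chi_mul// mul1r.
Qed.

(* The normalization makes gsumK e n depend on the fraction e / n only. *)
Definition gsumK (e : int) (n : nat) : R[i] := n%:R ^- N * \sum_(x : 'cV['I_n]_N) chi n (e * Q (vz x)).

Lemma gsumK_scale j e n : (0 < j)%N -> (0 < n)%N -> gsumK (j%:Z * e) (j * n) = gsumK e n.
Proof.
move=> j0 n0; rewrite /gsumK; under eq_bigr do rewrite -mulrA chi_scale//.
rewrite (sum_periodic j (chi_periodic e n0)) natrM exprMn invfM mulrCA !mulrA mulfV ?mul1r//.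
by rewrite expf_neq0// pnatr_eq0 -lt0n.
Qed.

Lemma normc_gsumK e n : (0 < n)%N -> normc (gsumK e n) <= 1.
Proof.
move=> n0; have nn : 0 < (n%:R : R) ^+ N by rewrite exprn_gt0// ltr0n.
rewrite /gsumK (Normc.normcM (_ ^- N)) normc_inv normcX natrC normc_real ger0_norm ?ler0n//.
rewrite ler_pdivrMl// mulr1; apply: (le_trans (normc_sum xpredT (fun x : 'cV['I_n]_N => chi n (e * Q (vz x))))).
under eq_bigr do rewrite normc_chi.
by rewrite sumr_const card_mx card_ord muln1 natrX.
Qed.

Definition zerosN (n : nat) : nat := #|[pred x : 'cV['I_n]_N | (n%:Z %| Q (vz x))%Z]|.

Lemma sum_gsumK n : (0 < n)%N -> \sum_(e < n) gsumK (e : nat)%:Z n = n%:R ^- N * (n%:R * (zerosN n)%:R).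
Proof.
move=> n0; rewrite /gsumK -mulr_sumr exchange_big /=; congr (_ * _).
under eq_bigr do rewrite sum_chi//.
by rewrite -big_mkcond /= sumr_const mulr_natr.
Qed.

Lemma csum_ltn (n : nat) (f : nat -> R[i]) :
  csumT (fun e : nat => if (e < n)%N then f e else 0) = \sum_(e < n) f e.
Proof.
rewrite -csum_fin -(csum_reindex f (Q := [set e | (e < n)%N]) (e := fun e : 'I_n => (e : nat))).
  rewrite [RHS]csum_mkcond; congr csum; apply/funext => e.
  by congr (if _ then _ else _); apply/idP/idP => [h|/set_mem//]; apply/mem_set.
split=> [e _ /=|e e' _ _ /val_inj//|e /= en]; first exact: ltn_ord.
by exists (Ordinal en).
Qed.

Lemma esum_ltn (n : nat) (r : R) : 0 <= r ->
  (\esum_(e in [set: nat]) (if (e < n)%N then r else 0)%:E = (n%:R * r)%:E)%E.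
Proof.
move=> r0; transitivity (\esum_(e in [set e : nat | (e < n)%N]) r%:E)%E.
  rewrite [RHS]esum_mkcond; apply: eq_esum => e _.
  have -> : (e \in [set e : nat | (e < n)%N]) = (e < n)%N.
    by apply/idP/idP => [/set_mem//|h]; apply/mem_set.
  by case: ifP.
rewrite (@reindex_esum _ _ _ [set: 'I_n] [set e : nat | (e < n)%N] (fun e : 'I_n => (e : nat)) (fun=> r%:E)).
  by rewrite esum_fin// sumr_const card_ord mulr_natl.
split=> [e _ /=|e e' _ _ /val_inj//|e /= en]; first exact: ltn_ord.
by exists (Ordinal en).
Qed.

Variable s : nat.
Hypothesis s3 : (3 <= s)%N.

Lemma esum_inv_sqr : (\esum_(n in [set: nat]) ((n.+1%:R : R) ^- 2)%:E < +oo)%E.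
Proof.
apply: (@le_lt_trans _ _ (\esum_(n in [set: nat]) ((1 + (n%:R : R) ^+ 2)^-1)%:E)%E).
  apply: le_esum => n _; rewrite lee_fin lef_pV2 ?posrE ?exprn_gt0 ?ltr_pwDl ?sqr_ge0//.
  by rewrite -natr1; have := ler0n R n; nra.
by apply: (le_lt_trans (esum_inv_oneDsqr R)); rewrite ltry.
Qed.

(** The place where s >= 3 is used: the n fractions of denominator n, each of weight n^-s, together
    weigh at most n^-2. *)
Lemma inv_pow_le (n : nat) : n.+1%:R * (n.+1%:R : R) ^- s <= n.+1%:R ^- 2.
Proof.
rewrite -(subnK s3) exprD; set x := n.+1%:R; have x1 : 1 <= x by rewrite ler1n.
have x0 : 0 < x by rewrite ltr0n.
have -> : x * (x ^+ (s - 3) * x ^+ 3)^-1 = (x ^+ (s - 3))^-1 * x ^- 2.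
  have := expf_neq0 (s - 3) (lt0r_neq0 x0); move: (x ^+ (s - 3)) => X X0.
  by field; rewrite X0 gt_eqF.
have X1 : (x ^+ (s - 3))^-1 <= 1 by rewrite invf_le1 ?exprn_ege1// exprn_gt0.
by rewrite ler_piMl// invr_ge0 exprn_ge0// ltW.
Qed.

(** The pair stands for the fraction [p.2 / p.1.+1]. Extension by 0 to all pairs turns the
    triangular index set into a product. *)
Definition farey (p : nat * nat) : R[i] := if (p.2 < p.1.+1)%N then p.1.+1%:R ^- s * gsumK p.2%:Z p.1.+1 else 0.

Lemma normc_invpow (n : nat) : normc (n.+1%:R ^- s : R[i]) = n.+1%:R ^- s.
Proof. by rewrite normc_inv normcX natrC normc_real ger0_norm. Qed.

Lemma farey_summable : csm farey.
Proof.
apply: (csummable_pair_le (b := fun n => n.+1%:R ^- 2)) esum_inv_sqr => n.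
pose g (e : nat) : R := if (e < n.+1)%N then n.+1%:R ^- s else 0.
have g0 e : 0 <= g e by rewrite /g; case: ifP => // _; rewrite invr_ge0 exprn_ge0.
apply: (@le_trans _ _ (esumT g)).
  apply: le_esum => e _; rewrite lee_fin /farey /g /=; case: ifP => // _; last by rewrite Normc.normc0.
  rewrite (Normc.normcM (_ ^- s)) normc_invpow -[leRHS]mulr1 ler_wpM2l ?invr_ge0 ?exprn_ge0//.
  exact: normc_gsumK.
rewrite esum_ltn ?invr_ge0 ?exprn_ge0// lee_fin; exact: inv_pow_le.
Qed.

Lemma sum_farey n : csumT (fun e : nat => farey (n, e)) =
  ((zerosN n.+1)%:R / (n.+1%:R : R) ^+ (s + N).-1)%:C.
Proof.
rewrite /farey /= csum_ltn -mulr_sumr sum_gsumK// realCM realCV realCX -!natrC.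
rewrite -[in RHS](prednK (_ : 0 < s)%N) ?addSn /=; last exact: leq_trans s3.
have n0 : n.+1%:R != 0 :> R[i] by rewrite pnatr_eq0.
rewrite -{1}(prednK (_ : 0 < s)%N); last exact: leq_trans s3.
rewrite exprS exprD; have := expf_neq0 N n0; have := expf_neq0 s.-1 n0.
move: (n.+1%:R ^+ N) (n.+1%:R ^+ s.-1) => X Y X0 Y0; field.
by rewrite X0 Y0 addrC natr1 n0.
Qed.

Definition farey_reduced (p : nat * nat) : R[i] :=
  if (p.2 < p.1.+1)%N && coprime p.1.+1 p.2 then p.1.+1%:R ^- s * gsumK p.2%:Z p.1.+1 else 0.

Lemma farey_reduced_summable : csm farey_reduced.
Proof.
apply: csummable_norm_le farey_summable => p; rewrite /farey /farey_reduced.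
by case: (p.2 < p.1.+1)%N => //=; case: coprime => //; rewrite Normc.normc0 normc_ge0.
Qed.

Lemma zeta_csum : csm (fun j : nat => (((j.+1%:R : R) ^- s)%:C)) /\
  (zeta R s)%:C = csumT (fun j : nat => (((j.+1%:R : R) ^- s)%:C)).
Proof.
have z0 (j : nat) : 0 <= (j.+1%:R : R) ^- s by rewrite invr_ge0 exprn_ge0.
have sz : csm (fun j : nat => (((j.+1%:R : R) ^- s)%:C)).
  apply: (csummable_le (g := fun j : nat => (j.+1%:R : R) ^- 2)) esum_inv_sqr => j.
  rewrite normc_real ger0_norm//; apply: le_trans (inv_pow_le j).
  by rewrite ler_peMl// ler1n.
by split=> //; rewrite csum_nat_series.
Qed.

Lemma zeta_neq0 : (zeta R s)%:C != 0.
Proof.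
have [sz ->] := zeta_csum.
have z0 (j : nat) : 0 <= (j.+1%:R : R) ^- s by rewrite invr_ge0 exprn_ge0.
rewrite csum_real// real_complex_eq0 gt_eqF//.
have fn : (\esum_(j in [set: nat]) ((j.+1%:R : R) ^- s)%:E < +oo)%E.
  move/csummableE: sz; apply: le_lt_trans; apply: le_esum => j _.
  by rewrite lee_fin normc_real ler_norm.
rewrite -lte_fin fineK; last by rewrite esum_fin_num.
apply: (@lt_le_trans _ _ 1%:E); first by rewrite lte_fin.
apply: esum_ge; exists [set 0%N]; first by split => //; exact: finite_set1.
by rewrite fsbig_set1 expr1n invr1.
Qed.

(** Expands the reduced fraction d/c by the factor j, where j and c are stored as predecessors;
    hence the outer [.-1]. Zero is counted once, as 0/1, because [coprime c.+1 0] forces c = 0. *)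
Definition farey_map (p : nat * (nat * nat)) : nat * nat := ((p.1.+1 * p.2.1.+1).-1, p.1.+1 * p.2.2)%N.

Lemma farey_bij : set_bij [set p : nat * (nat * nat) | (p.2.2 < p.2.1.+1)%N && coprime p.2.1.+1 p.2.2]
  [set p : nat * nat | (p.2 < p.1.+1)%N] farey_map.
Proof.
have pK (j c : nat) : (j.+1 * c.+1).-1.+1 = (j.+1 * c.+1)%N by rewrite prednK// muln_gt0.
split=> [[j [c d]] /= /andP[dc _]|[j [c d]] [j' [c' d']] /set_mem/= /andP[_ cd] /set_mem /= /andP[_ cd'] E|[n e] /= en].
- by rewrite pK ltn_pmul2l.
- have e1 : (j.+1 * c.+1)%N = (j'.+1 * c'.+1)%N by have := congr1 (fun p => p.1.+1) E; rewrite /farey_map /fst /snd !pK.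
  have e2 : (j.+1 * d)%N = (j'.+1 * d')%N by exact: (congr1 snd E).
  have jj : j = j'.
    have := congr2 gcdn e1 e2; rewrite -!muln_gcdr (eqP cd) (eqP cd') !muln1.
    by move=> [].
  move: e1 e2; rewrite jj => /eqP; rewrite eqn_pmul2l// => /eqP [->] /eqP; rewrite eqn_pmul2l// => /eqP ->.
  by [].
- pose g := gcdn n.+1 e; have g0 : (0 < g)%N by rewrite gcdn_gt0.
  have /dvdnP[c Ec] := dvdn_gcdl n.+1 e; have /dvdnP[d Ed] := dvdn_gcdr n.+1 e.
  rewrite -/g in Ec Ed; have c0 : (0 < c)%N by case: c Ec => //.
  exists (g.-1, (c.-1, d)); rewrite /farey_map /mkset /fst /snd ?prednK//.
    apply/andP; split; first by rewrite -(ltn_pmul2r g0) -Ec -Ed.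
    rewrite /coprime -(eqn_pmul2r g0) muln_gcdl -Ec -Ed mul1n//.
  by rewrite (mulnC g c) -Ec (mulnC g d) -Ed.
Qed.

(* Sorting the fractions e / n, 0 <= e < n, by their lowest terms. *)
Theorem singular_series :
  csm (fun n : nat => ((zerosN n.+1)%:R / (n.+1%:R : R) ^+ (s + N).-1)%:C) /\
  (limn (series (fun n : nat => (zerosN n.+1)%:R / (n.+1%:R : R) ^+ (s + N).-1)))%:C =
  (zeta R s)%:C * csumT farey_reduced.
Proof.
have sn : csm (fun n : nat => ((zerosN n.+1)%:R / (n.+1%:R : R) ^+ (s + N).-1)%:C).
  have := csummable_csum_row farey_summable.
  by rewrite (_ : (fun n => _) = (fun n : nat => ((zerosN n.+1)%:R / (n.+1%:R : R) ^+ (s + N).-1)%:C))//;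
    apply/funext => n; rewrite sum_farey.
split=> //; rewrite -csum_nat_series//.
have [sz ->] := zeta_csum; rewrite -(csum_mul sz farey_reduced_summable).
transitivity (csumT farey).
  by rewrite (csum_pair farey_summable); congr csum; apply/funext => n; rewrite sum_farey.
transitivity (csum [set p : nat * nat | (p.2 < p.1.+1)%N] farey).
  rewrite [RHS]csum_mkcond; congr csum; apply/funext => p; rewrite /farey.
  have -> : (p \in [set p : nat * nat | (p.2 < p.1.+1)%N]) = (p.2 < p.1.+1)%N.
    by apply/idP/idP => [/set_mem//|h]; apply/mem_set.
  by case: ifP.
rewrite (csum_reindex _ farey_bij) csum_mkcond; congr csum; apply/funext => -[j [c d]] /=.
rewrite /farey_reduced /=; case: ifPn => [/set_mem /= h|h]; last first.
  case: ifPn => [h'|_]; last by rewrite mulr0.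
  by move/negP: h; case; apply/mem_set.
rewrite h /farey /farey_map /fst /snd prednK ?muln_gt0// ltn_pmul2l//; case/andP: h => -> _.
rewrite PoszM gsumK_scale// natrM exprMn invfM realCV realCX -natrC; ring.
Qed.

End ResidueSums.

(** * The Fourier expansion *)

Section ModularSplitting.
Variable N : nat.

Definition residueI c (d : int) : 'I_c.+1 := inZp (absz (d %% c.+1%:Z)%Z).

Lemma residueIE c d : (residueI c d : nat)%:Z = (d %% c.+1%:Z)%Z.
Proof.
have h0 : (0 <= d %% c.+1%:Z)%Z by rewrite modz_ge0.
have h1 : (d %% c.+1%:Z < c.+1%:Z)%Z by rewrite ltz_pmod.
rewrite /residueI /=; case: (d %% c.+1%:Z)%Z h0 h1 => // q _ h1.
by rewrite modn_small.
Qed.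

(** The minus sign in the second component is there because the kernel is evaluated at z - lambda/c:
    the multiple of c becomes the translation by + [p.2.2]. *)
Definition split_mod c (p : ('I_c.+1 * 'cV['I_c.+1]_N) * (int * 'cV[int]_N)) : int * 'cV[int]_N :=
  ((p.1.1 : nat)%:Z + c.+1%:Z * p.2.1, vz p.1.2 - c.+1%:Z *: p.2.2).

Lemma split_mod_bij c : bijective (@split_mod c).
Proof.
pose g (q : int * 'cV[int]_N) : ('I_c.+1 * 'cV['I_c.+1]_N) * (int * 'cV[int]_N) :=
  ((residueI c q.1, map_mx (residueI c) q.2),
   ((q.1 %/ c.+1%:Z)%Z, map_mx (fun t => - (t %/ c.+1%:Z)%Z) q.2)).
have m1 (i : 'I_c.+1) (a : int) : residueI c ((i : nat)%:Z + c.+1%:Z * a) = i.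
  apply: val_inj; apply/eqP; rewrite -eqz_nat residueIE addrC mulrC modzMDl modz_small//.
  by rewrite ltz_nat ltn_ord.
have m2 (i : 'I_c.+1) (a : int) : (((i : nat)%:Z + c.+1%:Z * a) %/ c.+1%:Z)%Z = a.
  by rewrite addrC mulrC divzMDl// divz_small ?addr0// ltz_nat ltn_ord.
exists g => [[[i x] [a u]]|[d la]]; rewrite /g /split_mod /=.
  rewrite m1 m2; congr (_, _, (_, _)); apply/colP => j; rewrite !mxE -mulrN.
    by rewrite m1.
  by rewrite m2 opprK.
congr (_, _); first by rewrite residueIE addrC mulrC -divz_eq.
by apply/colP => j; rewrite !mxE residueIE mulrN opprK addrC mulrC -divz_eq.
Qed.

End ModularSplitting.

Section FiniteExchange.
Variable R : realType.
Local Notation csm f := (csummable [set: _] f).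
Local Notation csumT f := (csum [set: _] f).

Lemma csum_bigsum (I : finType) (T : choiceType) (f : I -> T -> R[i]) : (forall i, csm (f i)) ->
  \sum_i csumT (f i) = csumT (fun t => \sum_i f i t).
Proof.
move=> sf; suff H (r : seq I) : csm (fun t => \sum_(i <- r) f i t) /\
  \sum_(i <- r) csumT (f i) = csumT (fun t => \sum_(i <- r) f i t) by have [] := H (index_enum I).
elim: r => [|i r [H1 H2]].
  by under eq_fun do rewrite big_nil; rewrite big_nil csum0; split => //; exact: csummable0.
under eq_fun do rewrite big_cons; rewrite big_cons H2; split; first exact: csummableD.
by rewrite csumD.
Qed.
End FiniteExchange.

(** * Resummation of the terms with c > 0 *)

Section EisensteinFourier.
Variables (R : realType) (N : nat) (S : 'M[int]_N).
Local Notation esumT f := (\esum_(t in [set: _]) (f t)%:E)%E.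
Local Notation csm f := (csummable [set: _] f).
Local Notation csumT f := (csum [set: _] f).
Hypothesis hS : even_posdef R S.
Variables (k m : nat).
Hypotheses (m0 : (0 < m)%N) (keven : ~~ odd k) (kN : (2 + N < k)%N).

(** The integer form of Q_{l,h} for h = 2 S^-1 mu; the division by 2 is exact because the lattice is
    even. *)
Definition Qz (l : int) (mu x : 'cV[int]_N) : int := m%:Z * (mform S x x %/ 2)%Z - dotv mu x + l.

Lemma Qz2 l mu x : 2 * Qz l mu x = m%:Z * mform S x x - 2 * dotv mu x + 2 * l.
Proof.
have [q E] := mformS_even hS x; rewrite /Qz E.
have -> : (2 * q %/ 2)%Z = q by rewrite mulKz.
ring.
Qed.

Lemma Qz_per l mu (n : nat) x u : (n%:Z %| Qz l mu (x + n%:Z *: u) - Qz l mu x)%Z.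
Proof.
have [q E] := mformS_even hS u.
suff -> : Qz l mu (x + n%:Z *: u) - Qz l mu x =
   (m%:Z * mform S x u + m%:Z * n%:Z * q - dotv mu u) * n%:Z by exact: dvdz_mull.
apply: (mulfI (_ : 2 != 0 :> int)) => //.
rewrite mulrBr !Qz2 !mformDl !mformDr !mformZl !mformZr (mformC u x) ?(S_sym hS)// E dotvDr dotvZr.
ring.
Qed.

Lemma Qlh_Qz l mu x : Qlh S m l (hvec R S mu) x = (Qz l mu x)%:~R :> R.
Proof.
apply: (mulfI (_ : 2 != 0 :> R)); first by rewrite pnatr_eq0.
have -> : 2 * (Qz l mu x)%:~R = (2 * Qz l mu x)%:~R :> R by rewrite intrM.
rewrite Qz2 /Qlh mulrCA mulfV ?pnatr_eq0// mulr1 mform_lat blin_hvec//.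
have -> : dotv (lat R mu) (lat R x) = (dotv mu x)%:~R.
  by rewrite /dotv rmorph_sum; apply: eq_bigr => j _; rewrite !mxE rmorphM.
by rewrite intrD intrB !intrM -pmulrn.
Qed.

Lemma int_div_dvd (a : int) (n : nat) : (a%:~R / n.+1%:R : R) \is a Num.int = (n.+1%:Z %| a)%Z.
Proof.
have nn : n.+1%:R != 0 :> R by rewrite pnatr_eq0.
apply/idP/idP => [/intrP [q E]|/dvdzP[q ->]]; last by rewrite intrM -pmulrn mulfK ?intr_int.
apply/dvdzP; exists q; apply: (@intr_inj R); rewrite intrM -pmulrn -E.
by rewrite -mulrA mulVf// mulr1.
Qed.

Lemma Na_zerosN l mu n : Na S m l (hvec R S mu) n.+1 = zerosN (Qz l mu) n.+1.
Proof.
by rewrite /Na /zerosN; apply: eq_card => x; rewrite !inE Qlh_Qz int_div_dvd.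
Qed.

Variable (D : tri R N).
Hypotheses (pD : tri_pos D) (SD : forall z : 'cV[R[i]]_N, blin S z z = qf D z).
Local Notation mR := (m%:R : R).
Let mR0 : 0 < mR. Proof. by rewrite ltr0n. Qed.
Let kN2 : (N + 2 <= k)%N. Proof. by rewrite addnC ltnW. Qed.
Let s3 : (3 <= k - N)%N. Proof. by move: kN; clear; lia. Qed.
Let sN : (k - N + N)%N = k. Proof. by move: kN; clear; lia. Qed.

Lemma Qz0_phase (n : nat) (v : int) la :
  epii (m%:R * (v%:~R * (mform S la la)%:~R) / n%:R) = chi R n (v * Qz 0 0 la).
Proof.
rewrite /chi; congr epii; have [q E] := mformS_even hS la.
have -> : Qz 0 0 la = m%:Z * q.
  by rewrite /Qz E mulKz// dotvC dotvr0 subr0 addr0.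
by rewrite E !intrM -!pmulrn; ring.
Qed.

Lemma chi_congr n a b : (0 < n)%N -> (n%:Z %| a - b)%Z -> chi R n a = chi R n b.
Proof. by move=> n0 /dvdzP[q E]; rewrite -[a](subrK b) E chiD [q * _]mulrC chi_mul// mul1r. Qed.

(** An inverse of d modulo c + 1 when the two are coprime. *)
Definition bez (c : nat) (d : int) : int := (egcdz c.+1 d).2.

Lemma bezP c d : coprimez c.+1 d -> (c.+1%:Z %| bez c d * d - 1)%Z.
Proof.
rewrite /bez; case: egcdzP => u v /= E _ /eqP h; rewrite h in E.
by apply/dvdzP; exists (- u); rewrite -E; ring.
Qed.

(* The term of the Eisenstein series at (c + 1, d, lambda). *)
Definition eterm (tau : R[i]) (z : 'cV[R[i]]_N) (c : nat) (p : int * 'cV[int]_N) : R[i] :=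
  if coprimez c.+1 p.1 then
    c.+1%:R ^- k * (chi R c.+1 (bez c p.1 * Qz 0 0 p.2) *
      jkernel mR D k (tau + p.1%:~R / c.+1%:R) (z - c.+1%:R^-1 *: lat R[i] p.2))
  else 0.

Lemma coprimez_modl c d a : coprimez c.+1 (d + c.+1%:Z * a) = coprimez c.+1 d.
Proof. by rewrite /coprimez addrC mulrC gcdzMDl. Qed.

Lemma bez_congr c d d' : coprimez c.+1 d -> coprimez c.+1 d' -> (c.+1%:Z %| d - d')%Z ->
  (c.+1%:Z %| bez c d - bez c d')%Z.
Proof.
move=> cd cd' dd; have h := bezP cd; have h' := bezP cd'.
have -> : bez c d - bez c d' = bez c d' * (bez c d * d - 1) - bez c d * (bez c d' * d' - 1)
   - bez c d * bez c d' * (d - d') by ring.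
by rewrite !rpredB// dvdz_mull.
Qed.

(** The phase depends on residues only, as the inverse of d is well defined mod c and Q is periodic.
    Multiples of c merely translate the kernel by a lattice point, as Poisson summation requires. *)
Lemma eterm_split tau z c (i : 'I_c.+1) (x : 'cV['I_c.+1]_N) (a : int) mu :
  eterm tau z c (split_mod ((i, x), (a, mu))) =
  (if coprime c.+1 i then c.+1%:R ^- k * chi R c.+1 (bez c (i : nat)%:Z * Qz 0 0 (vz x)) else 0) *
  jkernel mR D k ((tau + (i : nat)%:R / c.+1%:R) + a%:~R) ((z - c.+1%:R^-1 *: lat R[i] (vz x)) + lat R[i] mu).
Proof.
have cn : c.+1%:R != 0 :> R[i] by rewrite pnatr_eq0.
rewrite /eterm /split_mod /= coprimez_modl; have -> : coprimez c.+1 (i : nat)%:Z = coprime c.+1 i by [].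
case: ifPn => cd; last by rewrite mul0r.
rewrite -[RHS]mulrA; congr (_ * (_ * _)).
  apply: chi_congr => //.
  have cd' : coprimez c.+1 ((i : nat)%:Z + c.+1%:Z * a) by rewrite coprimez_modl.
  have h1 := bez_congr cd' (cd : coprimez c.+1 (i : nat)%:Z).
  have h2 := Qz_per 0 0 c.+1 (vz x) (- mu); rewrite scalerN in h2.
  set v := bez _ _ in h1 *; set v' := bez _ _ in h1 *.
  set q := Qz _ _ _ in h2 *; set q' := Qz _ _ _ in h2 *.
  have -> : v * q - v' * q' = v * (q - q') + (v - v') * q' by ring.
  apply: rpredD; first exact: dvdz_mull.
  by apply: dvdz_mulr; apply: h1; rewrite addrC addKr; exact: dvdz_mulr.
congr jkernel.
  by rewrite intrD intrM -!pmulrn; field.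
by apply/colP => j; rewrite !mxE intrB intrM -!pmulrn; field.
Qed.

Lemma Im_shift_real tau (r : R) : complex.Im (tau + r%:C) = complex.Im tau.
Proof. by rewrite Im_add Im_real addr0. Qed.

Lemma natdivC (a b : nat) : a%:R / b%:R = (a%:R / b%:R : R)%:C :> R[i].
Proof. by rewrite realCM realCV -!natrC. Qed.

Lemma map_Im_shift (z : 'cV[R[i]]_N) (c : nat) (x : 'cV[int]_N) :
  map_mx (@complex.Im R) (z - c%:R^-1 *: lat R[i] x) = map_mx (@complex.Im R) z.
Proof.
apply/colP => j; rewrite !mxE intrC natrC -realCV -realCM Im_add Im_opp Im_real oppr0 addr0 //.
Qed.

Lemma normc_chi_coef c (i : 'I_c.+1) (r : int) :
  normc (if coprime c.+1 i then c.+1%:R ^- k * chi R c.+1 r else 0) <= c.+1%:R ^- k.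
Proof.
case: ifP => _; last by rewrite Normc.normc0 invr_ge0 exprn_ge0.
by rewrite (Normc.normcM (_ ^- k)) normc_chi mulr1 normc_invpow.
Qed.

(** Writing n = c + 1, there are n^(N+1) residue classes, each contributing at most n^-k B. Their
    total, B n^(1-(k-N)), is at most B n^-2 because k - N >= 3. *)
Lemma eterm_esum tau z : 0 < complex.Im tau -> exists2 B : R, 0 <= B &
  forall c, (\esum_(p in [set: int * 'cV[int]_N]) (normc (eterm tau z c p))%:E <= (B * c.+1%:R ^- 2)%:E)%E.
Proof.
move=> t0; have [B B0 HB] := jkernel_esum_bound mR0 pD kN2 (map_mx (@complex.Im R) z) t0.
exists B => // c; rewrite (esum_bij _ (@split_mod_bij N c)).
apply: (@le_trans _ _ (esumT (fun q : 'I_c.+1 * 'cV['I_c.+1]_N => c.+1%:R ^- k * B))).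
  apply: esum_pair_le => [p|[i x]]; first exact: normc_ge0.
  rewrite [leLHS](_ : _ = \esum_(p in [set: int * 'cV[int]_N])
    ((normc (if coprime c.+1 i then c.+1%:R ^- k * chi R c.+1 (bez c (i : nat)%:Z * Qz 0 0 (vz x)) else 0))%:E *
     (normc (jkernel mR D k ((tau + (i : nat)%:R / c.+1%:R) + p.1%:~R) ((z - c.+1%:R^-1 *: lat R[i] (vz x)) + lat R[i] p.2)))%:E))%E; last first.
    by apply: eq_esum => -[a mu] _; rewrite eterm_split (Normc.normcM (if _ then _ else _)) EFinM.
  rewrite esumZ ?normc_ge0//; last by move=> p; rewrite lee_fin normc_ge0.
  apply: (@le_trans _ _ ((normc (if coprime c.+1 i then c.+1%:R ^- k * chi R c.+1 (bez c (i : nat)%:Z * Qz 0 0 (vz x)) else 0))%:E * B%:E)%E).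
    apply: lee_wpmul2l; first by rewrite lee_fin normc_ge0.
    by apply: HB; [rewrite natdivC Im_shift_real|exact: map_Im_shift].
  by rewrite -EFinM lee_fin ler_wpM2r// normc_chi_coef.
rewrite esum_fin; last by move=> _; rewrite mulr_ge0// invr_ge0 exprn_ge0.
rewrite sumr_const card_prod card_mx !card_ord muln1 lee_fin -[_ *+ _]mulr_natr natrM natrX.
rewrite [leLHS](_ : _ = B * (c.+1%:R * c.+1%:R ^- (k - N))).
  by rewrite ler_wpM2l// inv_pow_le.
rewrite -{1}sN exprD; have nz : c.+1%:R != 0 :> R by rewrite pnatr_eq0.
have := expf_neq0 (k - N) nz; have := expf_neq0 N nz.
move: (_ ^+ (k - N)) (_ ^+ N) => X Y X0 Y0; field; by rewrite X0 Y0.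
Qed.

Lemma eterm_summable tau z : 0 < complex.Im tau ->
  csm (fun p : nat * (int * 'cV[int]_N) => eterm tau z p.1 p.2).
Proof.
move=> t0; have [B B0 HB] := eterm_esum z t0.
apply: (csummable_pair_le (b := fun c => B * c.+1%:R ^- 2)) => [c|]; first exact: HB.
under eq_esum do rewrite EFinM.
have i2 := @esum_inv_sqr R.
rewrite esumZ//.
by rewrite (esum_fine _ i2) -?EFinM ?ltry// => c; rewrite invr_ge0 exprn_ge0.
Qed.

Lemma jterm_shift y tau z c (i : 'I_c.+1) (x : 'cV['I_c.+1]_N) p :
  jterm mR D k y (tau + (i : nat)%:R / c.+1%:R) (z - c.+1%:R^-1 *: lat R[i] (vz x)) p =
  jterm mR D k y tau z p * chi R c.+1 (p.1 * (i : nat)%:Z - dotv p.2 (vz x)).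
Proof.
have cn : c.+1%:R != 0 :> R[i] by rewrite pnatr_eq0.
have E1 (g A B : R[i]) : g * epii A * epii B = g * epii (A + B) by rewrite epiiD mulrA.
rewrite /jterm /chi !E1; congr (_ * epii _).
have -> : dotv (lat R[i] p.2) (z - c.+1%:R^-1 *: lat R[i] (vz x)) =
   dotv (lat R[i] p.2) z - c.+1%:R^-1 * (dotv p.2 (vz x))%:~R.
  rewrite dotvDr -scaleNr dotvZr mulNr; congr (_ - _ * _).
  by rewrite /dotv rmorph_sum; apply: eq_bigr => j _; rewrite !mxE rmorphM.
by rewrite intrB intrM -!pmulrn; field.
Qed.

(* Substituting lambda = d x turns the inverse of d mod c into d itself. *)
Lemma gauss_phase_sum c (i : 'I_c.+1) l mu : coprime c.+1 i ->
  \sum_(x : 'cV['I_c.+1]_N) chi R c.+1 (bez c (i : nat)%:Z * Qz 0 0 (vz x) + (l * (i : nat)%:Z - dotv mu (vz x))) =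
  c.+1%:R ^+ N * gsumK R (Qz l mu) (i : nat)%:Z c.+1.
Proof.
move=> cd; have nn : c.+1%:R != 0 :> R[i] by rewrite pnatr_eq0.
rewrite /gsumK mulrA mulfV ?expf_neq0// mul1r.
pose P (x : 'cV[int]_N) := chi R c.+1 (bez c (i : nat)%:Z * Qz 0 0 x + (l * (i : nat)%:Z - dotv mu x)).
have pP : vperiodic c.+1 P.
  move=> x u; apply: chi_congr => //.
  have h := Qz_per 0 0 c.+1 x u; move: h; set q := Qz _ _ _; set q' := Qz _ _ _ => h.
  rewrite dotvDr dotvZr.
  have -> : bez c i%:Z * q + (l * i%:Z - (dotv mu x + c.+1%:Z * dotv mu u)) -
     (bez c i%:Z * q' + (l * i%:Z - dotv mu x)) = bez c i%:Z * (q - q') - c.+1%:Z * dotv mu u by ring.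
  by apply: rpredB; [exact: dvdz_mull|exact: dvdz_mulr].
rewrite -/(\sum_(x : 'cV['I_c.+1]_N) P (vz x)) (sum_unit_scale cd pP).
apply: eq_bigr => x _; apply: chi_congr => //; set d := (i : nat)%:Z.
have [q E] := mformS_even hS (vz x).
have -> : Qz 0 0 (d *: vz x) = d * d * (m%:Z * q).
  rewrite /Qz mformZl mformZr E dotvC dotvr0 subr0 addr0 (_ : d * (d * (2 * q)) = 2 * (d * d * q)); last by ring.
  by rewrite mulKz//; ring.
have -> : Qz l mu (vz x) = m%:Z * q - dotv mu (vz x) + l by rewrite /Qz E mulKz.
rewrite dotvZr.
have -> : bez c d * (d * d * (m%:Z * q)) + (l * d - d * dotv mu (vz x)) - d * (m%:Z * q - dotv mu (vz x) + l) =
  (bez c d * d - 1) * (d * (m%:Z * q)) by ring.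
by rewrite dvdz_mulr// bezP.
Qed.

(** For one c: Poisson summation in each residue class, then the finite sum over classes is taken
    inside. The sum over x mod c yields c^N K(d/c), turning c^-k into the c^-(k-N) of
    [farey_reduced]. *)
Lemma eterm_csum y tau z c : 0 < y -> 0 < complex.Im tau ->
  csumT (eterm tau z c) =
  csumT (fun p => jterm mR D k y tau z p * csumT (fun d : nat => farey_reduced R (Qz p.1 p.2) (k - N) (c, d))).
Proof.
move=> y0 t0.
have sE : csm (eterm tau z c) := csummable_row (eterm_summable z t0) c.
have sE' := (csummable_bij _ (@split_mod_bij N c)).1 sE.
rewrite (csum_bij _ (@split_mod_bij N c)) (csum_pair sE') csum_fin.
pose C (q : 'I_c.+1 * 'cV['I_c.+1]_N) : R[i] :=
  if coprime c.+1 q.1 then c.+1%:R ^- k * chi R c.+1 (bez c (q.1 : nat)%:Z * Qz 0 0 (vz q.2)) else 0.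
have sJ := jterm_summable mR0 pD kN2 z y0 t0.
have sJi (q : 'I_c.+1 * 'cV['I_c.+1]_N) : csm (fun p : int * 'cV[int]_N =>
    C q * (jterm mR D k y tau z p * chi R c.+1 (p.1 * (q.1 : nat)%:Z - dotv p.2 (vz q.2)))).
  apply: csummableZ; apply: csummable_norm_le sJ => p.
  by rewrite (Normc.normcM (jterm _ _ _ _ _ _ _)) normc_chi mulr1.
transitivity (\sum_q csumT (fun p : int * 'cV[int]_N =>
    C q * (jterm mR D k y tau z p * chi R c.+1 (p.1 * (q.1 : nat)%:Z - dotv p.2 (vz q.2))))).
  apply: eq_bigr => -[i x] _.
  have t0' : 0 < complex.Im (tau + (i : nat)%:R / c.+1%:R) by rewrite natdivC Im_shift_real.
  transitivity (C (i, x) * csumT (fun p : int * 'cV[int]_N => jkernel mR D k ((tau + (i : nat)%:R / c.+1%:R) + p.1%:~R) ((z - c.+1%:R^-1 *: lat R[i] (vz x)) + lat R[i] p.2))).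
    rewrite -csumZ; last first.
      have [B _ HB] := jkernel_esum_bound mR0 pD kN2 (map_mx (@complex.Im R) (z - c.+1%:R^-1 *: lat R[i] (vz x))) t0'.
      by apply/csummableE; apply: (le_lt_trans (HB _ _ (erefl _) (erefl _))); rewrite ltry.
    by congr csum; apply/funext => -[a mu]; rewrite eterm_split.
  rewrite (jkernel_poisson mR0 pD kN2 _ y0 t0') -csumZ; last exact: jterm_summable.
  by congr csum; apply/funext => p; rewrite jterm_shift.
rewrite csum_bigsum//; congr csum; apply/funext => p.
rewrite (_ : (fun d => farey_reduced R (Qz p.1 p.2) (k - N) (c, d)) = (fun d : nat => if (d < c.+1)%N then
   (if coprime c.+1 d then c.+1%:R ^- (k - N) * gsumK R (Qz p.1 p.2) d%:Z c.+1 else 0) else 0)); last first.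
  by apply/funext => d; rewrite /farey_reduced /=; case: (d < c.+1)%N.
rewrite csum_ltn mulr_sumr.
rewrite -(pair_bigA _ (fun i x => C (i, x) * (jterm mR D k y tau z p * chi R c.+1 (p.1 * (i : nat)%:Z - dotv p.2 (vz x))))) /=.
apply: eq_bigr => i _; rewrite /C /=; case: ifPn => cd; last first.
  by rewrite mulr0 big1// => x _; rewrite mul0r.
transitivity (\sum_(x : 'cV['I_c.+1]_N) (c.+1%:R ^- k * jterm mR D k y tau z p) *
  chi R c.+1 (bez c (i : nat)%:Z * Qz 0 0 (vz x) + (p.1 * (i : nat)%:Z - dotv p.2 (vz x)))).
  have aux (a b c' d : R[i]) : a * b * (c' * d) = a * c' * (b * d) by ring.
  by apply: eq_bigr => x _; rewrite [in RHS]chiD; exact: aux.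
rewrite -mulr_sumr gauss_phase_sum// -{1}sN exprD.
have nz : c.+1%:R != 0 :> R[i] by rewrite pnatr_eq0.
have := expf_neq0 (k - N) nz; have := expf_neq0 N nz; move: (gsumK _ _ _ _) => G.
move: (c.+1%:R ^+ (k - N)) (c.+1%:R ^+ N) => X Y X0 Y0; field.
by rewrite X0 Y0.
Qed.

Definition fcoef (p : int * 'cV[int]_N) : R[i] := csumT (farey_reduced R (Qz p.1 p.2) (k - N)).

Lemma eterm_total y tau z : 0 < y -> 0 < complex.Im tau ->
  csm (fun p => jterm mR D k y tau z p * fcoef p) /\
  csumT (fun p : nat * (int * 'cV[int]_N) => eterm tau z p.1 p.2) =
  csumT (fun p => jterm mR D k y tau z p * fcoef p).
Proof.
move=> y0 t0; have sJ := jterm_summable mR0 pD kN2 z y0 t0.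
have sF p : csm (farey_reduced R (Qz p.1 p.2) (k - N)).
  by apply: farey_reduced_summable => // n x u; exact: Qz_per.
pose W (q : nat * (int * 'cV[int]_N)) := jterm mR D k y tau z q.2 *
  csumT (fun d : nat => farey_reduced R (Qz q.2.1 q.2.2) (k - N) (q.1, d)).
(* The factor depending on c is at most (c+1)^-2 uniformly in (l, mu), since |K| <= 1; so [W] is
   dominated by a product. *)
have sW : csm W.
  have s1 : csm (fun c : nat => ((c.+1%:R : R) ^- 2)%:C).
    apply: (csummable_le (g := fun c : nat => (c.+1%:R : R) ^- 2)) (@esum_inv_sqr R) => c.
    by rewrite normc_real ger0_norm// invr_ge0 exprn_ge0.
  apply: csummable_norm_le (csummable_mul s1 sJ) => -[c p]; rewrite /W /fst /snd.
  rewrite (Normc.normcM (jterm _ _ _ _ _ _ _)) (Normc.normcM (_ ^- 2)%:C) mulrC ler_wpM2r ?normc_ge0//.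
  rewrite normc_real ger0_norm ?invr_ge0 ?exprn_ge0//.
  rewrite (_ : (fun d => farey_reduced R (Qz p.1 p.2) (k - N) (c, d)) = (fun d : nat => if (d < c.+1)%N then
     (if coprime c.+1 d then c.+1%:R ^- (k - N) * gsumK R (Qz p.1 p.2) d%:Z c.+1 else 0) else 0)); last first.
    by apply/funext => d; rewrite /farey_reduced /=; case: (d < c.+1)%N.
  rewrite csum_ltn; apply: le_trans (inv_pow_le R s3 c).
  apply: (le_trans (normc_sum xpredT (fun d : 'I_c.+1 => (if coprime c.+1 d then c.+1%:R ^- (k - N) * gsumK R (Qz p.1 p.2) (d : nat)%:Z c.+1 else 0)))).
  apply: (@le_trans _ _ (\sum_(d < c.+1) (c.+1%:R : R) ^- (k - N))); last first.
    by rewrite sumr_const card_ord mulr_natl.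
  apply: ler_sum => d _; case: ifP => _; last by rewrite Normc.normc0 invr_ge0 exprn_ge0.
  rewrite (Normc.normcM (_ ^- _)) normc_invpow -[leRHS]mulr1 ler_wpM2l ?invr_ge0 ?exprn_ge0//.
  exact: normc_gsumK.
have WE p : csumT (fun c : nat => W (c, p)) = jterm mR D k y tau z p * fcoef p.
  rewrite /W /fst /snd csumZ; last exact: (csummable_csum_row (sF p)).
  by rewrite /fcoef (csum_pair (sF p)).
split.
  have := csummable_csum_row (csummable_swap sW); apply: csummable_norm_le => p.
  by rewrite WE.
rewrite (csum_pair (eterm_summable z t0)).
transitivity (csumT (fun c : nat => csumT (fun p => W (c, p)))).
  by congr csum; apply/funext => c; rewrite (eterm_csum z c y0 t0).
by rewrite (csum_exchange sW); congr csum; apply/funext => p; rewrite WE.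
Qed.

(** By [singular_series] the sum over [Na] equals zeta(k-N) times [fcoef], which cancels the zeta in
    the denominator of [fj_coef]. *)
Lemma fourier_term_jterm y nu tau z l mu : 0 < y ->
  fourier_term S k m y nu tau z (l, hvec R S mu) = jterm mR D k y tau z (l, mu) * fcoef (l, mu).
Proof.
move=> y0; rewrite /fourier_term /fj_coef /=.
rewrite (gamma_gam hS k m0 pD SD)// (blin_hvec_cvec hS).
have [_] := @singular_series R N (Qz l mu) (@Qz_per l mu) (k - N) s3.
rewrite sN => h.
rewrite (_ : (fun n : nat => (Na S m l (hvec R S mu) n.+1)%:R / n.+1%:R ^+ k.-1) =
  (fun n : nat => (zerosN (Qz l mu) n.+1)%:R / (n.+1%:R : R) ^+ k.-1)); last first.
  by apply/funext => n; rewrite Na_zerosN.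
rewrite h /jterm /fcoef /=; have := @zeta_neq0 R (k - N) s3; move: (zeta R (k - N))%:C => Z Z0.
have aux (a F c d : R[i]) : a / Z * (Z * F) * c * d = a * c * d * F by field.
exact: aux.
Qed.

Lemma eterm_fourier y nu tau z : 0 < y -> 0 < complex.Im tau ->
  csummable (fourier_index S) (fourier_term S k m y nu tau z) /\
  csumT (fun p : nat * (int * 'cV[int]_N) => eterm tau z p.1 p.2) =
  csum (fourier_index S) (fourier_term S k m y nu tau z).
Proof.
move=> y0 t0; have [h1 h2] := eterm_total z y0 t0.
have E : (fun p : int * 'cV[int]_N => fourier_term S k m y nu tau z (p.1, hvec R S p.2)) =
  (fun p => jterm mR D k y tau z p * fcoef p).
  by apply/funext => -[l mu]; rewrite fourier_term_jterm.
split; first by apply/(csummable_reindex _ (fourier_index_bij hS)); rewrite E.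
by rewrite h2 (csum_reindex _ (fourier_index_bij hS)) E.
Qed.


End EisensteinFourier.

(** * Holomorphy *)

Section ExponentialSeries.
Variable R : realType.
Local Notation esumT f := (\esum_(t in [set: _]) (f t)%:E)%E.
Local Notation csm f := (csummable [set: _] f).
Local Notation csumT f := (csum [set: _] f).

Lemma cdiff_le (f df : R -> R[i]) (K : R) : (forall x, cderive f x (df x)) ->
  (forall x, `|x| <= 1 -> normc (df x) <= K) -> normc (f 1 - f 0) <= 2 * K.
Proof.
move=> der dK; apply: (le_trans (normc_le_ReIm _)).
have t1 : `|1 - 0 : R| <= 1 by rewrite subr0 normr1.
have bd (p : R[i] -> R) : (forall z, `|p z| <= normc z) -> forall x : R, `|x - 0| <= 1 -> `|p (df x)| <= K.
  by move=> pn x; rewrite subr0 => /dK; apply: le_trans; exact: pn.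
have h1 := diff_le (fun x => proj1 (der x)) (bd _ (@normc_Re R)) t1.
have h2 := diff_le (fun x => proj2 (der x)) (bd _ (@normc_Im R)) t1.
rewrite subr0 normr1 mulr1 in h1; rewrite subr0 normr1 mulr1 in h2.
by rewrite Re_add Re_opp Im_add Im_opp mulr2n mulrDl !mul1r lerD.
Qed.

Lemma cderive_scaled_exp (w : R[i]) (x : R) : cderive (fun s => cexp (s%:C * w)) x (cexp (x%:C * w) * w).
Proof.
have h := cderiveM (cderive_real x) (cderive_cst w x).
by apply: (cderive_eq (cderive_cexp h)); rewrite mul1r mulr0 addr0.
Qed.

Lemma normc_scaled_exp (w : R[i]) (x : R) : `|x| <= 1 -> normc (cexp (x%:C * w)) <= expR (normc w).
Proof.
move=> x1; rewrite normc_cexp ler_expR Re_mul Re_real Im_real mul0r subr0.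
apply: (le_trans (ler_norm _)); rewrite normrM -[leRHS]mul1r ler_pM//; exact: normc_Re.
Qed.

Lemma cexp_lin (w : R[i]) : normc (cexp w - 1) <= 2 * (normc w * expR (normc w)).
Proof.
have := @cdiff_le (fun s => cexp (s%:C * w)) _ (normc w * expR (normc w)) (cderive_scaled_exp w) _.
rewrite mul1r mul0r cexp0; apply=> x x1.
by rewrite (Normc.normcM (cexp _)) mulrC ler_wpM2l ?normc_ge0 ?normc_scaled_exp.
Qed.

(** [cdiff_le] along the segment from 0 to w: the derivative of e^{s w} - 1 - s w is (e^{s w} - 1)
    w, already controlled by [cexp_lin]. *)
Lemma cexp_quad (w : R[i]) : normc (cexp w - 1 - w) <= 4 * (normc w ^+ 2 * expR (normc w)).
Proof.
have der (x : R) : cderive (fun s => cexp (s%:C * w) - 1 - s%:C * w) x ((cexp (x%:C * w) - 1) * w).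
  have h := cderiveD (cderiveD (cderive_scaled_exp w x) (cderive_cst (-1) x))
    (cderiveN (cderiveM (cderive_real x) (cderive_cst w x))).
  by apply: (cderive_eq h); ring.
have := @cdiff_le _ _ (2 * (normc w ^+ 2 * expR (normc w))) der _.
rewrite mul1r mul0r cexp0 subrr !subr0 => H.
rewrite (_ : 4 * (normc w ^+ 2 * expR (normc w)) = 2 * (2 * (normc w ^+ 2 * expR (normc w)))); last by ring.
apply: H => x x1.
rewrite (Normc.normcM (_ - _)) mulrC expr2 -(mulrA (normc w)) [leRHS]mulrCA ler_wpM2l ?normc_ge0//.
apply: (le_trans (cexp_lin _)); rewrite ler_wpM2l//.
have nx : normc (x%:C * w) <= normc w.
  by rewrite (Normc.normcM x%:C) normc_real ler_piMl ?normc_ge0.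
by rewrite ler_pM ?normc_ge0 ?expR_ge0// ler_expR.
Qed.

Lemma csummable_bigsum (I : finType) (T : choiceType) (f : I -> T -> R[i]) : (forall i, csm (f i)) ->
  csm (fun t => \sum_i f i t).
Proof.
move=> sf; suff H (r : seq I) : csm (fun t => \sum_(i <- r) f i t) by exact: (H (index_enum I)).
elim: r => [|i r H].
  by under eq_fun do rewrite big_nil; exact: csummable0.
by under eq_fun do rewrite big_cons; exact: csummableD.
Qed.

Variable N : nat.
Local Notation W := (R[i]^o : normedModType R[i]).
Local Notation V := ((R[i]^o * 'cV[R[i]]_N)%type : normedModType R[i]).

Definition lin_form (A : R[i]) (B : 'cV[R[i]]_N) (h : V) : W := A * h.1 + dotv B h.2.

Lemma lin_form_linear A B : linear (lin_form A B).
Proof.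
move=> c h h'; rewrite /lin_form /= dotvDr dotvZr.
have E (x : R[i]^o) : c *: x = c * x by [].
by rewrite !E mulrDr mulrDr mulrCA addrACA.
Qed.

HB.instance Definition _ A B := GRing.isLinear.Build R[i] V R[i]^o *:%R (lin_form A B) (lin_form_linear A B).

Lemma lin_form_continuous A B : continuous (lin_form A B : V -> W).
Proof.
have mulc (c : R[i]) (g : V -> W) : continuous g -> continuous (fun h => c * g h : W).
  by move=> cg h; apply: (@cvgZr R[i] W) => //; exact: cg.
have c1 : continuous (fun h : V => h.1 : W) by move=> h; exact: cvg_fst.
have c2 j : continuous (fun h : V => h.2 j 0 : W).
  move=> h; apply: (@cvg_comp _ _ _ snd (fun M : 'cV[R[i]]_N => M j 0 : W) (nbhs h) (nbhs h.2) (nbhs (h.2 j 0 : W))).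
    exact: cvg_snd.
  exact: (@coord_continuous R[i] N 1 j 0 h.2).
have addc (f g : V -> W) : continuous f -> continuous g -> continuous (fun h => f h + g h : W).
  by move=> cf cg h; apply: (@cvgD R[i] W); [exact: cf|exact: cg].
apply: (addc (fun h => A * h.1) (fun h => dotv B h.2)); first exact: (mulc A (fun h => h.1) c1).
rewrite /dotv; elim: (index_enum _) => [|j l IH].
  by under eq_fun do rewrite big_nil; move=> h; exact: cvg_cst.
have -> : (fun h : V => \sum_(i <- j :: l) B i 0 * h.2 i 0 : W) =
  (fun h : V => B j 0 * h.2 j 0 + \sum_(i <- l) B i 0 * h.2 i 0).
  by apply/funext => h; rewrite big_cons.
exact: (addc _ _ (mulc (B j 0) (fun h => h.2 j 0) (c2 j)) IH).
Qed.

(** The norm on [V] takes values in [R[i]]; this extracts the underlying real number for use in real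
    estimates. *)
Lemma norm_coord_le (h : V) : exists2 r : R, 0 <= r & [/\ `|h| = r%:C, normc h.1 <= r & forall j, normc (h.2 j 0) <= r].
Proof.
have h0 : 0 <= `|h| by exact: normr_ge0.
exists (complex.Re `|h|); first by move: h0; rewrite lecE => /andP[_].
have E : `|h| = (complex.Re `|h|)%:C.
  by move: h0; rewrite lecE => /andP[/eqP e _]; apply: complex_ext; rewrite !ReImE.
have le1 : `|h.1| <= `|h| by rewrite prod_normE comparable_le_max ?lexx// real_comparable ?normr_real.
have le2 j : `|h.2 j 0| <= `|h|.
  apply: (@le_trans _ _ `|h.2|); last by rewrite prod_normE comparable_le_max ?lexx ?orbT// real_comparable ?normr_real.
  rewrite [leRHS]/Num.norm /= mx_normE -[leLHS]nngE num_le.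
  exact: (le_bigmax _ (fun i : 'I_N * 'I_1 => `|h.2 i.1 i.2|%:nng) (j, ord0)).
split=> //; first by move: le1; rewrite E normr_normc lecR.
by move=> j; move: (le2 j); rewrite E normr_normc lecR.
Qed.

(** Series identities hold only for Im tau > 0. On the ball of radius Im(p.1)/2 the two functions
    agree, so their first-order remainders do too. *)
Lemma differentiable_upper (f g : V -> W) (p : V) : 0 < complex.Im p.1 ->
  (forall q : V, 0 < complex.Im q.1 -> f q = g q) -> differentiable g p -> differentiable f p.
Proof.
move=> v0 fg dg; have [cg lg] := (diff_locallyP p g).1 dg.
have v0' : 0 < (complex.Im p.1 / 2)%:C :> R[i] by rewrite ltcR divr_gt0.
have nb : \forall h \near (0 : V), `|h| <= (complex.Im p.1 / 2)%:C.
  exact: (pseudometric_normed_Zmodule.nbhs0_le v0').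
have lf : f \o shift p = cst (f p) + 'd g p +o_ (0 : V) id.
  move/eqaddoP: lg => lg; apply/eqaddoP => eps eps0.
  apply: filterS2 nb (lg eps eps0) => h hd.
  have [r r0 [hE h1 _]] := norm_coord_le h; move: hd; rewrite hE lecR => hd.
  have Ih : 0 < complex.Im (h + p).1.
    rewrite /= Im_add; have := le_trans (normc_Im h.1) h1.
    by rewrite ler_norml => /andP[]; lra.
  have e1 : (f \o shift p - (cst (f p) + 'd g p)) h = (g \o shift p - (cst (g p) + 'd g p)) h.
    rewrite -[LHS]/(f (h + p) - (f p + 'd g p h)) -[RHS]/(g (h + p) - (g p + 'd g p h)).
    by rewrite !fg.
  by rewrite e1.
have dE := @diff_unique R[i] V W f ('d g p) p cg lf.
by apply/diff_locallyP; rewrite dE; split.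
Qed.

Section Series.
Variables (T : choiceType) (a : T -> R[i]) (al : T -> R) (be : T -> 'cV[R]_N).

Definition eseries_term (q : V) (t : T) : R[i] :=
  a t * epii ((al t)%:C * q.1 + dotv (cvec (be t)) q.2).

Hypothesis esm : forall q : V, 0 < complex.Im q.1 -> csm (eseries_term q).

Let Lam t : R := pi * (`|al t| + \sum_j `|be t j 0|).
Let Lam0 t : 0 <= Lam t. Proof. by rewrite mulr_ge0 ?pi_ge0// addr_ge0// sumr_ge0. Qed.

(* The value at a point whose imaginary parts are moved by dl, with signs chosen according to t,
   is larger by the factor e^{dl Lam t}; there are only finitely many such points. *)
Lemma eseries_dominated (p : V) (dl : R) : 0 < dl -> dl < complex.Im p.1 ->
  csm (fun t => eseries_term p t * (expR (dl * Lam t))%:C).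
Proof.
move=> d0 dv.
pose sg (b : bool) : R := (-1) ^+ b.
pose q (s : bool * {ffun 'I_N -> bool}) : V :=
  (p.1 + (0 +i* (dl * sg s.1)), p.2 + \col_j (0 +i* (dl * sg (s.2 j)))).
have q0 s : 0 < complex.Im (q s).1.
  rewrite /q /= Im_add Im_cplx /sg; case: s.1; rewrite ?expr1 ?expr0; lra.
have nq s t : normc (eseries_term (q s) t) = normc (eseries_term p t) *
    expR (- (pi * dl * (al t * sg s.1 + \sum_j be t j 0 * sg (s.2 j)))).
  rewrite /eseries_term (Normc.normcM (a t)) (Normc.normcM (a t)) -[RHS]mulrA; congr (_ * _).
  rewrite !normc_epii -expRD; congr expR; rewrite !Im_add !Im_mul !Re_real !Im_real !Im_dotv.
  have -> : dotv (be t) (map_mx (@complex.Im R) (q s).2) =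
     dotv (be t) (map_mx (@complex.Im R) p.2) + dl * \sum_j be t j 0 * sg (s.2 j).
    rewrite /dotv mulr_sumr -big_split /=; apply: eq_bigr => j _.
    by rewrite /q /= !mxE Im_add Im_cplx; ring.
  by rewrite /q /= Im_add Im_cplx; ring.
have sq : csm (fun t => \sum_s (normc (eseries_term (q s) t))%:C).
  apply: csummable_bigsum => s; apply: csummable_norm_le (esm (q0 s)) => t.
  by rewrite normc_real ger0_norm ?normc_ge0.
apply: csummable_norm_le sq => t.
have -> : \sum_s (normc (eseries_term (q s) t))%:C = (\sum_s normc (eseries_term (q s) t))%:C.
  by rewrite rmorph_sum.
rewrite normc_real ger0_norm; last by apply: sumr_ge0 => s _; exact: normc_ge0.
rewrite (Normc.normcM (eseries_term p t)) normc_real ger0_norm ?expR_ge0//.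
pose s : bool * {ffun 'I_N -> bool} := (0 <= al t, [ffun j => 0 <= be t j 0]).
have sgE (x : R) : - (x * sg (0 <= x)) = `|x|.
  rewrite /sg; have [x0|x0] := leP 0 x; first by rewrite expr1 mulrN1 opprK ger0_norm.
  by rewrite expr0 mulr1 ltr0_norm.
rewrite (bigD1 s)//= -[leLHS]addr0 lerD//; last by apply: sumr_ge0 => i _; exact: normc_ge0.
rewrite nq le_eqVlt; apply/orP; left; apply/eqP; congr (_ * expR _).
rewrite /Lam -sgE (_ : \sum_j `|be t j 0| = - \sum_j be t j 0 * sg (s.2 j)).
  by rewrite /s /=; ring.
by rewrite -sumrN; apply: eq_bigr => j _; rewrite ffunE sgE.
Qed.

Let wt (t : T) (h : V) : R[i] := pi%:C * 'i * ((al t)%:C * h.1 + dotv (cvec (be t)) h.2).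

Lemma normc_wt t (h : V) (r : R) : normc h.1 <= r -> (forall j, normc (h.2 j 0) <= r) ->
  normc (wt t h) <= Lam t * r.
Proof.
move=> h1 h2; rewrite /wt (Normc.normcM (pi%:C * 'i)) (Normc.normcM pi%:C) normc_i mulr1 normc_real.
rewrite (ger0_norm (pi_ge0 R)) /Lam -mulrA ler_wpM2l ?pi_ge0//.
apply: (le_trans (le_normcD _ _)); rewrite mulrDl lerD//.
  by rewrite (Normc.normcM (al t)%:C) normc_real ler_wpM2l.
rewrite /dotv mulr_suml; apply: (le_trans (normc_sum xpredT _)); apply: ler_sum => j _.
by rewrite (Normc.normcM (cvec (be t) j 0)) mxE normc_real ler_wpM2l.
Qed.

Lemma eseries_shift (p h : V) t : eseries_term (h + p) t = eseries_term p t * cexp (wt t h).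
Proof.
rewrite /eseries_term -[RHS]mulrA; congr (_ * _).
rewrite /wt -[cexp _]/(epii _) -epiiD; congr epii; rewrite /= dotvDr; ring.
Qed.

(** The candidate derivative is the termwise one, and the remainder is O(r^2) by the quadratic
    estimate for each exponential. [eseries_dominated] pays for the growth of the frequencies. *)
Theorem eseries_differentiable (p : V) : 0 < complex.Im p.1 ->
  differentiable (fun q : V => csumT (eseries_term q) : W) p.
Proof.
move=> v0; set v := complex.Im p.1 in v0; pose dl := v / 2.
have d0 : 0 < dl by rewrite divr_gt0.
have dv : dl < complex.Im p.1 by rewrite /dl -/v; lra.
have sD := eseries_dominated d0 dv; pose ct := eseries_term p.
pose E t : R := expR (dl * Lam t).
have E0 t : 0 <= E t := expR_ge0 _.
have nE t : normc (ct t * (E t)%:C) = normc (ct t) * E t.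
  by rewrite (Normc.normcM (ct t)) normc_real ger0_norm.
(* Factors bounded by a multiple of [E] keep the series summable; the frequencies are such factors,
   since x <= e^x. *)
have sle (C : R) (g : T -> R[i]) : (forall t, normc (g t) <= C * E t) -> csm (fun t => ct t * g t).
  move=> gC; apply: csummable_norm_le (csummableZ C%:C sD) => t.
  rewrite (Normc.normcM C%:C) nE normc_real (Normc.normcM (ct t)) mulrCA ler_wpM2l ?normc_ge0//.
  apply: (le_trans (gC t)); rewrite ler_wpM2r//; exact: ler_norm.
have LE t : Lam t <= dl^-1 * E t.
  rewrite ler_pdivlMl//; apply: le_trans (expR_ge1Dx _) => //.
  by rewrite lerDr.
have le_al t : pi * `|al t| <= Lam t by rewrite ler_wpM2l ?pi_ge0// lerDl sumr_ge0.
have le_be t j : pi * `|be t j 0| <= Lam t.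
  rewrite ler_wpM2l ?pi_ge0// (bigD1 j)//= addrCA lerDl addr_ge0// sumr_ge0//.
have npi (x : R) : normc (pi%:C * 'i * x%:C) = pi * `|x|.
  by rewrite (Normc.normcM (pi%:C * 'i)) (Normc.normcM pi%:C) normc_i mulr1 !normc_real (ger0_norm (pi_ge0 R)).
have sA : csm (fun t => ct t * (pi%:C * 'i * (al t)%:C)).
  by apply: (sle dl^-1) => t; rewrite npi (le_trans (le_al t)).
have sB j : csm (fun t => ct t * (pi%:C * 'i * (be t j 0)%:C)).
  by apply: (sle dl^-1) => t; rewrite npi (le_trans (le_be t j)).
pose A := csumT (fun t => ct t * (pi%:C * 'i * (al t)%:C)).
pose B : 'cV[R[i]]_N := \col_j csumT (fun t => ct t * (pi%:C * 'i * (be t j 0)%:C)).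
have sW h : csm (fun t => ct t * wt t h).
  have [r r0 [_ h1 h2]] := norm_coord_le h.
  apply: (sle (dl^-1 * r)) => t; apply: (le_trans (normc_wt t h1 h2)).
  by rewrite [leRHS]mulrAC ler_wpM2r.
have dfE h : lin_form A B h = csumT (fun t => ct t * wt t h).
  have e1 : (fun t => ct t * wt t h) = (fun t => h.1 * (ct t * (pi%:C * 'i * (al t)%:C)) +
      \sum_j (h.2 j 0 * (ct t * (pi%:C * 'i * (be t j 0)%:C)))).
    apply/funext => t; rewrite /wt /dotv mulrDr mulrDr; congr (_ + _); first by ring.
    by rewrite !mulr_sumr; apply: eq_bigr => j _; rewrite mxE; ring.
  have sBj j : csm (fun t => h.2 j 0 * (ct t * (pi%:C * 'i * (be t j 0)%:C))) by exact: csummableZ.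
  rewrite e1 csumD; [|exact: csummableZ|exact: csummable_bigsum].
  rewrite csumZ// -csum_bigsum// /lin_form mulrC; congr (_ + _).
  by rewrite /dotv; apply: eq_bigr => j _; rewrite mxE csumZ// mulrC.
have sn : (\esum_(t in [set: T]) (normc (ct t * (E t)%:C))%:E < +oo)%E.
  exact: ((csummableE setT (fun t => ct t * (E t)%:C)).1 sD).
pose tot := fine (\esum_(t in [set: T]) (normc (ct t * (E t)%:C))%:E)%E.
have tot0 : 0 <= tot by apply/fine_ge0/esum_ge0 => t _; rewrite lee_fin normc_ge0.
pose K := 2 * (64 / dl ^+ 2 * tot).
have K0 : 0 <= K by rewrite mulr_ge0// mulr_ge0// divr_ge0// exprn_ge0// ltW.
have rem (h : V) (r : R) : 0 <= r -> r <= dl / 2 -> normc h.1 <= r -> (forall j, normc (h.2 j 0) <= r) ->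
    normc (csumT (eseries_term (h + p)) - (csumT (eseries_term p) + lin_form A B h)) <= K * r ^+ 2.
  move=> r0 rd h1 h2.
  have Ih : 0 < complex.Im (h + p).1.
    rewrite /= Im_add -/v; have := le_trans (normc_Im h.1) h1.
    by rewrite ler_norml => /andP[]; rewrite /dl in rd; lra.
  have s1 := esm Ih; have s2 := esm v0.
  have s1' : csm (fun t => ct t * (cexp (wt t h))).
    by apply: csummable_norm_le s1 => t; rewrite eseries_shift.
  have s3 : csm (fun t => - ct t + - (ct t * wt t h)).
    apply: csummableD; first by apply: csummable_norm_le s2 => t; rewrite normcN.
    by apply: csummable_norm_le (sW h) => t; rewrite normcN.
  have -> : csumT (eseries_term (h + p)) - (csumT (eseries_term p) + lin_form A B h) =
     csumT (fun t => ct t * (cexp (wt t h) - 1 - wt t h)).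
    rewrite dfE opprD -!csumN -csumD.
    - rewrite -csumD//.
      by congr csum; apply/funext => t; rewrite eseries_shift /ct; ring.
    - by apply: csummable_norm_le s2 => t; rewrite normcN.
    - by apply: csummable_norm_le (sW h) => t; rewrite normcN.
  rewrite (_ : K * r ^+ 2 = 2 * (r ^+ 2 * (64 / dl ^+ 2) * tot)); last by rewrite /K; ring.
  apply: (csum_normc_bound (g := fun t => r ^+ 2 * (64 / dl ^+ 2) * normc (ct t * (E t)%:C))).
    move=> t; rewrite nE (Normc.normcM (ct t)) [leRHS]mulrCA ler_wpM2l ?normc_ge0//.
    apply: (le_trans (cexp_quad _)).
    have nw := normc_wt t h1 h2.
    apply: (@le_trans _ _ (4 * ((Lam t * r) ^+ 2 * expR (Lam t * r)))).
      by rewrite ler_wpM2l// ler_pM ?exprn_ge0 ?normc_ge0 ?expR_ge0 ?ler_expR// lerXn2r ?nnegrE ?normc_ge0// mulr_ge0.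
    (* Half of the exponent dl Lam pays for Lam^2, through x^2 <= e^{2x} and Lam = 4x/dl; the other
       half pays for e^{Lam r}, as r <= dl/2. The constant is 64 = 4 * 16, with 4 from
       [cexp_quad]. *)
    set x := dl * Lam t / 4; have x0 : 0 <= x by rewrite divr_ge0// mulr_ge0// ltW.
    have e2 : x ^+ 2 <= expR (dl * Lam t / 2).
      rewrite (_ : dl * Lam t / 2 = x * 2%:R); last by rewrite /x; field.
      rewrite expRM_natr lerXn2r ?nnegrE ?expR_ge0//.
      by apply: le_trans (expR_ge1Dx _); rewrite lerDr.
    have L2 : Lam t ^+ 2 <= 16 / dl ^+ 2 * expR (dl * Lam t / 2).
      rewrite (_ : Lam t ^+ 2 = 16 / dl ^+ 2 * x ^+ 2); last by rewrite /x; field; rewrite gt_eqF.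
      by rewrite ler_wpM2l// divr_ge0// exprn_ge0// ltW.
    have e3 : expR (Lam t * r) <= expR (dl * Lam t / 2).
      by rewrite ler_expR [dl * _]mulrC -[leRHS]mulrA ler_wpM2l.
    have -> : E t = expR (dl * Lam t / 2) * expR (dl * Lam t / 2).
      by rewrite -expRD /E; congr expR; field.
    rewrite exprMn (_ : 4 * (Lam t ^+ 2 * r ^+ 2 * _) = (4 * r ^+ 2) * (Lam t ^+ 2 * expR (Lam t * r))); last by ring.
    rewrite [leRHS](_ : _ = (4 * r ^+ 2) * (16 / dl ^+ 2 * expR (dl * Lam t / 2) * expR (dl * Lam t / 2))); last first.
      by field; rewrite gt_eqF.
    by rewrite ler_wpM2l ?mulr_ge0 ?sqr_ge0// ler_pM ?exprn_ge0 ?expR_ge0.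
  under eq_esum do rewrite EFinM.
  rewrite esumZ; [|by rewrite mulr_ge0 ?sqr_ge0// divr_ge0// exprn_ge0// ltW|by move=> t; rewrite lee_fin normc_ge0].
  by rewrite (esum_fine (fun t => normc_ge0 _) sn) -EFinM.
have cdf := @lin_form_continuous A B.
have lo : (fun q : V => csumT (eseries_term q) : W) \o shift p =
    cst (csumT (eseries_term p) : W) + (lin_form A B : V -> W) +o_ (0 : V) id.
  apply/eqaddoP => eps eps0.
  have e0 : 0 < complex.Re eps by move: eps0; rewrite ltcE => /andP[].
  have eE : eps = (complex.Re eps)%:C.
    by move: eps0; rewrite ltcE => /andP[/eqP e _]; apply: complex_ext; rewrite !ReImE.
  (* Within [de] the remainder K r^2 is at most eps r; the 1 added to [K] keeps the quotient
     meaningful when K = 0. *)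
  pose de := Num.min (dl / 2) (complex.Re eps / (K + 1)).
  have K1 : 0 < K + 1 by rewrite ltr_wpDl.
  have de0 : 0 < de by rewrite lt_min !divr_gt0.
  have de0' : 0 < de%:C :> R[i] by rewrite ltcR.
  have nb : \forall h \near (0 : V), `|h| <= de%:C .
    exact: (pseudometric_normed_Zmodule.nbhs0_le de0').
  apply: filterS nb => h hde; have [r r0 [hE h1 h2]] := norm_coord_le h.
  have rde : r <= de by rewrite -lecR -hE.
  have r1 : r <= dl / 2 by apply: (le_trans rde); rewrite ge_min lexx.
  have r2 : r <= complex.Re eps / (K + 1) by apply: (le_trans rde); rewrite ge_min lexx orbT.
  have := rem h r r0 r1 h1 h2.
  rewrite -[leLHS]/(normc (csumT (eseries_term (h + p)) - (csumT (eseries_term p) + lin_form A B h))).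
  rewrite /= hE eE -realCM normr_normc lecR => hh.
  apply: (le_trans hh); rewrite expr2 mulrA ler_wpM2r//.
  apply: (@le_trans _ _ ((K + 1) * r)); first by rewrite ler_wpM2r// lerDl.
  by rewrite mulrC -ler_pdivlMr.
have dE := @diff_unique R[i] V W _ (lin_form A B) p cdf lo.
by apply/diff_locallyP; rewrite dE; split.
Qed.

End Series.
End ExponentialSeries.

(** * Theta part, Fourier part and holomorphy put together *)

Section Assembly.
Variables (R : realType) (N : nat) (S : 'M[int]_N).
Local Notation csm f := (csummable [set: _] f).
Local Notation csumT f := (csum [set: _] f).
Local Notation W := (R[i]^o : normedModType R[i]).
Local Notation V := ((R[i]^o * 'cV[R[i]]_N)%type : normedModType R[i]).
Hypothesis hS : even_posdef R S.
Variables (k m : nat).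
Hypotheses (m0 : (0 < m)%N) (keven : ~~ odd k) (kN : (2 + N < k)%N).
Variable (D : tri R N).
Hypotheses (pD : tri_pos D) (SD : forall z : 'cV[R[i]]_N, blin S z z = qf D z).
Local Notation mR := (m%:R : R).
Let mR0 : 0 < mR. Proof. by rewrite ltr0n. Qed.
Let k0 : (0 < k)%N. Proof. exact: leq_ltn_trans kN. Qed.

Definition theta_term (tau : R[i]) (z : 'cV[R[i]]_N) (x : 'cV[int]_N) : R[i] :=
  epii (m%:R * (blin S (lat R[i] x) (lat R[i] x) * tau + 2 * blin S (lat R[i] x) z)).

(** Convergence is borrowed from the other side of the inversion formula: at -1/tau and z/tau the
    general term is the theta term times e^{pi i m (z,z)/tau}. *)
Lemma theta_summable tau z : 0 < complex.Im tau -> csm (theta_term tau z).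
Proof.
move=> t0; have tn := Im_gt0_neq0 t0.
have t0' : 0 < complex.Im (- tau^-1).
  rewrite Im_opp Im_inv opprK divr_gt0// -!expr2 -normc_sqr exprn_gt0// normc_gt0//.
have sP := theta_primal_summable mR0 (tau^-1 *: z) pD t0'.
apply: csummable_norm_le (csummableZ (epii (- (m%:R * blin S z z / tau))) sP) => x.
rewrite -epiiD -SD /theta_term !blin_mform !blinE -!blin_mform (blinC hS z (lat R[i] x)).
rewrite le_eqVlt; apply/orP; left; apply/eqP; congr (normc (epii _)); rewrite natrC.
move: (blin S _ _) (blin S _ _) (blin S _ _) (mR%:C) => a b c d.
by field; rewrite ?tn ?oppr_eq0 ?oner_eq0.
Qed.

Lemma jindex_split : @jindex N = [set p : nat * (int * 'cV[int]_N) | p.1 = 0%N /\ p.2.1 = 1]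
  `|` [set p : nat * (int * 'cV[int]_N) | (0 < p.1)%N /\ coprimez p.1%:Z p.2.1].
Proof.
apply/seteqP; split=> -[c [d la]] /=.
  rewrite /jindex /= => /andP[cd /implyP h]; have [c0|c0] := posnP c; [left|right] => //.
  by split => //; apply/eqP/h/eqP.
rewrite /jindex /= => -[[-> ->]|[c0 cd]] //.
by rewrite cd /= eqn0Ngt c0.
Qed.

(** Cosets are indexed by [jindex]. Those with c = 0 give the theta terms; those with c > 0, with c
    lowered by one and non-coprime pairs filled in by 0, give [eterm]. *)
Lemma eisenstein_split tau z : 0 < complex.Im tau ->
  csummable (jcosets R S k m) (eis_term S k m tau z) /\
  eisenstein S k m tau z = theta S m tau z +
    csumT (fun p : nat * (int * 'cV[int]_N) => eterm S k m D tau z p.1 p.2).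
Proof.
move=> t0; have bij := jindex_bij hS m0 keven k0 SD.
pose f p := eis_term S k m tau z (jcoset_of R S k m p).
pose A := [set p : nat * (int * 'cV[int]_N) | p.1 = 0%N /\ p.2.1 = 1].
pose B := [set p : nat * (int * 'cV[int]_N) | (0 < p.1)%N /\ coprimez p.1%:Z p.2.1].
have bA : set_bij [set: 'cV[int]_N] A (fun la => (0%N, (1, la))).
  split=> [la _ //|la la' _ _ [] //|[c [d la]] [/= -> ->]]; by exists la.
pose B' := [set p : nat * (int * 'cV[int]_N) | coprimez p.1.+1%:Z p.2.1].
have bB : set_bij B' B (fun p => (p.1.+1, p.2)).
  split=> [p h //|[c q] [c' q'] _ _ [-> ->] //|[[|c] q] /= [] // _ h].
  by exists (c, q).
have fA la : f (0%N, (1, la)) = theta_term tau z la.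
  by rewrite /f (eis_term_theta hS m0 keven k0 SD).
have fB p : (if p \in B' then f (p.1.+1, p.2) else 0) = eterm S k m D tau z p.1 p.2.
  rewrite /eterm; have -> : (p \in B') = coprimez p.1.+1 p.2.1.
    by apply/idP/idP => [/set_mem//|h]; apply/mem_set.
  case: ifPn => // cd; case: p cd => c [d la] cd.
  by rewrite /f (eis_term_c hS m0 keven k0 SD)// (Qz0_phase hS).
have sA : csummable A f.
  apply/(csummable_reindex _ bA); apply: csummable_norm_le (theta_summable z t0) => la.
  by rewrite fA.
have sB : csummable B f.
  apply/(csummable_reindex _ bB)/csummable_mkcond.
  by apply: csummable_norm_le (eterm_summable hS m0 kN pD z t0) => p; rewrite fB.
have fE p : (if p \in @jindex N then f p else 0) = (if p \in A then f p else 0) + (if p \in B then f p else 0).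
  rewrite jindex_split -/A -/B in_setU; case: (boolP (p \in A)) => [/set_mem [pA _]|_] /=; last by rewrite add0r.
  case: ifPn => [/set_mem [pB _]|_]; last by rewrite addr0.
  by rewrite pA in pB.
have sF : csm (fun p => if p \in @jindex N then f p else 0).
  have := csummableD ((csummable_mkcond _ _).1 sA) ((csummable_mkcond _ _).1 sB).
  by apply: csummable_norm_le => p; rewrite fE.
split; first by apply/(csummable_reindex _ bij)/csummable_mkcond.
rewrite /eisenstein (csum_reindex _ bij) csum_mkcond.
transitivity (csum A f + csum B f).
  rewrite !(csum_mkcond _ f) -csumD; [|exact: (csummable_mkcond _ _).1..].
  by congr csum; apply/funext => p; rewrite fE.
rewrite (csum_reindex _ bA) (csum_reindex _ bB); congr (_ + _).
  by congr csum; apply/funext => la; rewrite fA.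
by rewrite csum_mkcond; congr csum; apply/funext => p; rewrite fB.
Qed.

Lemma theta_term_eseries (q : V) x : theta_term q.1 q.2 x =
  eseries_term (fun=> 1) (fun x : 'cV[int]_N => mR * (mform S x x)%:~R)
    (fun x => (2 * mR) *: (map_mx intr S *m lat R x)) q x.
Proof.
rewrite /theta_term /eseries_term mul1r; congr epii.
have -> : dotv (cvec ((2 * mR) *: (map_mx intr S *m lat R x))) q.2 = 2 * m%:R * blin S (lat R[i] x) q.2.
  rewrite (blinC hS) blin_mform mform_dotv [LHS]dotvC -(dotvZr _ _ (2 * m%:R)).
  suff -> : cvec ((2 * mR) *: (map_mx intr S *m lat R x)) = (2 * m%:R) *: (map_mx intr S *m lat R[i] x) by [].
  apply/colP => i; rewrite !mxE realCM realCM -!natrC; congr (_ * _).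
  by rewrite rmorph_sum; apply: eq_bigr => j _; rewrite !mxE rmorphM !intrC.
by rewrite mform_lat realCM -natrC -intrC; ring.
Qed.

Lemma jterm_eseries (q : V) (p : int * 'cV[int]_N) :
  jterm mR D k 1 q.1 q.2 p * fcoef R S k m p =
  eseries_term (fun p => gam mR D k 1 p.1 (lat R p.2) * fcoef R S k m p)
    (fun p => 2 * p.1%:~R) (fun p => 2 *: lat R p.2) q p.
Proof.
rewrite /jterm /eseries_term realCM -natrC -intrC.
have -> : cvec (2 *: lat R p.2) = 2 *: lat R[i] p.2.
  by apply/colP => j; rewrite !mxE realCM -natrC -intrC.
rewrite [dotv (2 *: _) _]dotvC dotvZr [dotv q.2 _]dotvC epiiD.
have aux (a b c d : R[i]) : a * b * c * d = a * d * (b * c) by ring.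
exact: aux.
Qed.

Lemma eisenstein_holomorphic : holomorphic_on_H (@eisenstein R N S k m).
Proof.
move=> p p0.
pose g1 (q : V) : W := csumT (theta_term q.1 q.2).
pose g2 (q : V) : W := csumT (fun t => jterm mR D k 1 q.1 q.2 t * fcoef R S k m t).
have d1 : differentiable g1 p.
  rewrite (_ : g1 = (fun q : V => csumT (eseries_term (fun=> 1) (fun x : 'cV[int]_N => mR * (mform S x x)%:~R)
    (fun x => (2 * mR) *: (map_mx intr S *m lat R x)) q) : W)).
    apply: eseries_differentiable p0 => q q0.
    by apply: csummable_norm_le (theta_summable q.2 q0) => x; rewrite theta_term_eseries.
  by apply/funext => q; rewrite /g1; congr csum; apply/funext => x; rewrite theta_term_eseries.
have d2 : differentiable g2 p.
  rewrite (_ : g2 = (fun q : V => csumT (eseries_term (fun p => gam mR D k 1 p.1 (lat R p.2) * fcoef R S k m p)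
    (fun p => 2 * p.1%:~R) (fun p => 2 *: lat R p.2) q) : W)).
    apply: eseries_differentiable p0 => q q0.
    have [h _] := eterm_total hS m0 kN pD q.2 (@ltr01 R) q0.
    by apply: csummable_norm_le h => t; rewrite jterm_eseries.
  by apply/funext => q; rewrite /g2; congr csum; apply/funext => x; rewrite jterm_eseries.
apply: (@differentiable_upper R N _ (fun q => g1 q + g2 q) p p0); last exact: differentiableD.
move=> q q0; have [_ ->] := eisenstein_split q.2 q0.
by have [_ ->] := eterm_total hS m0 kN pD q.2 (@ltr01 R) q0.
Qed.

End Assembly.

Theorem theorem2p1 (R : realType) (N : nat) (S : 'M[int]_N) (k m : nat) :
  (0 < N)%N -> even_posdef R S ->
  (0 < m)%N -> ~~ odd k -> (2 + N < k)%N ->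
  [/\ forall (tau : R[i]) (z : 'cV[R[i]]_N), 0 < complex.Im tau ->
        csummable (jcosets R S k m) (eis_term S k m tau z),
      holomorphic_on_H (@eisenstein R N S k m) &
      forall (y : R) (nu : 'cV[R]_N), 0 < y ->
      forall (tau : R[i]) (z : 'cV[R[i]]_N), 0 < complex.Im tau ->
        csummable (fourier_index S) (fourier_term S k m y nu tau z) /\
        eisenstein S k m tau z =
          theta S m tau z
          + csum (fourier_index S) (fourier_term S k m y nu tau z)].
Proof.
move=> _ hS m0 keven kN; have [D pD SD] := S_tri hS.
split=> [tau z t0||y nu y0 tau z t0].
- by have [] := eisenstein_split hS m0 keven kN pD SD z t0.
- exact: eisenstein_holomorphic pD SD.
- have [h1 h2] := eterm_fourier hS m0 kN pD SD nu z y0 t0.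
  by split => //; have [_ ->] := eisenstein_split hS m0 keven kN pD SD z t0; rewrite h2.
Qed.
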